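(* For $\nu\in\mathcal{M}_0^{W^{-1}}(A)$ let $\Lambda_\nu([f]):=\int_A f\,d\nu$ for $[f]\in\mathcal{X}$. The map $\nu\mapsto\Lambda_\nu$ is an isometric linear embedding of $\bigl(\mathcal{M}_0^{W^{-1}}(A),\|\cdot\|_{W^{-1}}\bigr)$ into the dual $\mathcal{X}^{\ast}$. Under the identification $\mathcal{X}^{\ast}\cong\mathcal{M}(A)$ (in which $\sigma\in\mathcal{M}(A)$ corresponds to the functional $[f]\mapsto\int_A T([f])\,d\sigma$, and $\Lambda_\nu$ corresponds to $\sigma_\nu=W^{-1}\nu$), its range is $$\mathcal{R}=\Bigl\{\sigma\in\mathcal{M}(A):\ \int_A W\,d|\sigma|<\infty\ \text{ and }\ \int_A W\,d\sigma=0\Bigr\},$$ which is norm-dense in $\mathcal{M}(A)$ but proper. In particular $\mathcal{X}^{\ast}$ is not isometrically isomorphic to $\mathcal{M}_0^{W^{-1}}(A)$; it is isometrically isomorphic to $\mathcal{M}(A)$.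
   Context: $A$ is a non-compact, locally compact, $\sigma$-compact Hausdorff space, assumed second countable; $h:A\to[0,\infty)$ is a fixed continuous proper exhaustion function, i.e. $h$ is continuous and $h^{-1}([0,R])$ is compact for every $R<\infty$. $C(A)$ is the space of real continuous functions, $C_0(A)$ those vanishing at infinity with the sup-norm, and $\mathcal{M}(A)$ the finite signed regular Borel measures on $A$ with the total variation norm. $\varphi:[0,\infty)\to[1,\infty)$ is admissible: continuous, non-decreasing, $\varphi(0)=1$, and there is $K\ge1$ with $\varphi(r+s)\le K\varphi(r)\varphi(s)$ for all $r,s\ge0$. It is moreover unbounded: $\varphi(t)\to\infty$ as $t\to\infty$. $W:=\varphi\circ h$. $\|[f]\|^{\sharp}_{\infty,h;\varphi}:=\inf_{c\in\mathbb{R}}\sup_{A}W|f-c|$, for $[f]$ the class of $f$ in $C(A)/\mathbb{R}$ (modulo constants). $C^{\sharp}_{h;\varphi}(A)$ is the space of classes for which this is finite. $C^{(h)}_\varphi([f]):=\inf_{c\in\mathbb{R}}\limsup_{h(a)\to\infty}W(a)|f(a)-c|$, and $\mathcal{X}:=\{[f]\in C^{\sharp}_{h;\varphi}(A):C^{(h)}_\varphi([f])=0\}$, normed by $\|\cdot\|^{\sharp}_{\infty,h;\varphi}$. For $[f]\in C^{\sharp}_{h;\varphi}(A)$ the limit $L(f)$ of $f(a)$ as $h(a)\to\infty$ exists, and $T([f]):=W(f-L(f))$; $T$ restricts to a surjective linear isometry $\mathcal{X}\to C_0(A)$. $\mathcal{M}_0^{W^{-1}}(A)$ is the space of finite signed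 regular Borel measures $\nu$ on $A$ with $\nu(A)=0$ and $\|\nu\|_{W^{-1}}:=\int_A W^{-1}\,d|\nu|<\infty$. *)

(* Defs.v *)
From HB Require Import structures.
From mathcomp Require Import all_boot all_order all_algebra.
From mathcomp Require Import all_classical all_reals all_analysis.
From mathcomp Require Import measurable_realfun lra.
Set Implicit Arguments.
Unset Strict Implicit.
Unset Printing Implicit Defensive.
Import Order.TTheory GRing.Theory Num.Theory.
Import numFieldNormedType.Exports.
Local Open Scope classical_set_scope.
Local Open Scope ring_scope.
Local Open Scope quotient_scope.


Definition sigma_compact (A : topologicalType) :=
  exists2 K : (set A)^nat, forall n, compact (K n) & \bigcup_n K n = [set: A].

Definition isometrically_isomorphic (R : realType) (E F : normedModType R) :=
  exists2 f : {linear E -> F}, bijective f & forall x, `|f x| = `|x|.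

Section dual.
Context (R : realType) (E : normedModType R).

Definition dual_pred : {pred E -> R} :=
  [pred f | `[< linear (f : E -> R^o) /\ continuous f >]].

Lemma dual_pred_submod : submod_closed (dual_pred : {pred E -> R^o}).
Proof.
split.
- by apply/asboolP; split=> [a u v|x]; [rewrite /= scaler0 addr0|exact: cst_continuous].
- move=> a f g /asboolP[fl fc] /asboolP[gl gc]; apply/asboolP; split.
    by move=> b u v /=; rewrite !fctE fl gl !scalerDr !scalerA mulrC addrACA.
  by move=> x; apply: cvgD; [apply: cvgZr; exact: fc|exact: gc].
Qed.

HB.instance Definition _ := GRing.isSubmodClosed.Build R (E -> R^o) dual_pred
  (GRing.submod_closed_semi dual_pred_submod).

(* continuous linear functionals, with the operator norm [opnorm] *)
Record dual := Dual { dual_val :> E -> R^o ; _ : dual_val \in dual_pred }.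

HB.instance Definition _ := [isSub for dual_val].
HB.instance Definition _ := [Choice of dual by <:].
HB.instance Definition _ := [SubChoice_isSubLmodule of dual by <:].

Implicit Types f : dual.

Lemma dual_linear f : linear f.
Proof. by case: f => f /= /asboolP[]. Qed.

Lemma dual_continuous f : continuous f.
Proof. by case: f => f /= /asboolP[]. Qed.

HB.instance Definition _ f := GRing.isLinear.Build R E R^o _ f (dual_linear f).

Definition opnorm f : R := sup [set `|f x| | x in [set x | `|x| <= 1]].

Let dual_bound f : has_sup [set `|f x| | x in [set x | `|x| <= 1]].
Proof.
split; first by exists `|f 0|; exists 0 => //=; rewrite normr0.
have /continuous_linear_bounded/linear_boundedP/pinfty_ex_gt0 [M M0 fM] :
  {for 0, continuous (f : {linear E -> R^o})} by exact: dual_continuous.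
exists M => _ [x /= x1 <-]; rewrite (le_trans (fM x))//.
by rewrite ler_piMr// ltW.
Qed.

Lemma opnorm_ge f x : `|x| <= 1 -> `|f x| <= opnorm f.
Proof. by move=> x1; apply: sup_upper_bound => //; exists x. Qed.

Lemma opnorm_le f r : (forall x, `|x| <= 1 -> `|f x| <= r) -> opnorm f <= r.
Proof.
by move=> fr; apply: ge_sup; [case: (dual_bound f)|move=> _ [x /= x1 <-]; exact: fr].
Qed.

Lemma dual_addE f g x : (f + g) x = f x + g x. Proof. by []. Qed.
Lemma dual_scaleE (a : R) f x : (a *: f) x = a * f x. Proof. by []. Qed.

Let opnormD f g : opnorm (f + g) <= opnorm f + opnorm g.
Proof.
apply: opnorm_le => x x1; rewrite dual_addE (le_trans (ler_normD _ _))//.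
by rewrite lerD// opnorm_ge.
Qed.

Let opnormZ_le a f : opnorm (a *: f) <= `|a| * opnorm f.
Proof.
by apply: opnorm_le => x x1; rewrite dual_scaleE normrM ler_wpM2l// opnorm_ge.
Qed.

Let opnorm_ge0 f : 0 <= opnorm f.
Proof. by rewrite (le_trans _ (@opnorm_ge f 0 _)) ?normr0. Qed.

Let opnormZ a f : opnorm (a *: f) = `|a| * opnorm f.
Proof.
apply/eqP; rewrite eq_le opnormZ_le/=; have [->|a0] := eqVneq a 0.
  by rewrite normr0 mul0r.
rewrite -ler_pdivlMl ?normr_gt0// -normfV.
by rewrite (le_trans _ (opnormZ_le _ _))// scalerA mulVf// scale1r.
Qed.

Let opnorm0_eq0 f : opnorm f = 0 -> f = 0.
Proof.
move=> f0; apply/val_inj/funext => x /=.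
have [->|x0] := eqVneq x 0; first by rewrite linear0.
have := @opnorm_ge f (`|x|^-1 *: x).
rewrite f0 normrZ normfV normr_id mulVf ?normr_eq0// => /(_ (lexx _)).
rewrite normr_le0 linearZ/= scaler_eq0 invr_eq0 normr_eq0 (negbTE x0)/=.
by move=> /eqP.
Qed.

HB.instance Definition _ := @Lmodule_isNormed.Build R dual opnorm
  opnormD opnormZ opnorm0_eq0.

Lemma dual_normE f : `|f| = opnorm f. Proof. by []. Qed.

End dual.
Section continuous_functions.
Context (R : realType) (A : topologicalType).
Local Notation C := (continuousType A R).
Implicit Types f g : C.

Let addf_continuous f g : continuous (f \+ g : A -> R).
Proof. by move=> a; apply: cvgD; exact: cts_fun. Qed.
Let oppf_continuous f : continuous (\- f : A -> R).
Proof. by move=> a; apply: cvgN; exact: cts_fun. Qed.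
Let scalef_continuous (r : R) f : continuous (r \*o f : A -> R).
Proof. by move=> a; apply: cvgMr; exact: cts_fun. Qed.

Definition cts_zero : C := cst (0 : R).
Definition cts_opp f : C := mkcts (@oppf_continuous f).
Definition cts_add f g : C := mkcts (@addf_continuous f g).
Definition cts_scale (r : R) f : C := mkcts (@scalef_continuous r f).

Let cts_addA : associative cts_add.
Proof. by move=> f g k; apply/continuousEP => a; exact: addrA. Qed.
Let cts_addC : commutative cts_add.
Proof. by move=> f g; apply/continuousEP => a; exact: addrC. Qed.
Let cts_add0 : left_id cts_zero cts_add.
Proof. by move=> f; apply/continuousEP => a; exact: add0r. Qed.
Let cts_addN : left_inverse cts_zero cts_opp cts_add.
Proof. by move=> f; apply/continuousEP => a; exact: addNr. Qed.

HB.instance Definition _ := GRing.isZmodule.Build C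
  cts_addA cts_addC cts_add0 cts_addN.

Let cts_scaleA r s f : cts_scale r (cts_scale s f) = cts_scale (r * s) f.
Proof. by apply/continuousEP => a; exact: mulrA. Qed.
Let cts_scale1 : left_id 1 cts_scale.
Proof. by move=> f; apply/continuousEP => a; exact: mul1r. Qed.
Let cts_scaleDr : right_distributive cts_scale +%R.
Proof. by move=> r f g; apply/continuousEP => a; exact: mulrDr. Qed.
Let cts_scaleDl f : {morph cts_scale^~ f : r s / r + s}.
Proof. by move=> r s; apply/continuousEP => a; exact: mulrDl. Qed.

HB.instance Definition _ := GRing.Zmodule_isLmodule.Build R C
  cts_scaleA cts_scale1 cts_scaleDr cts_scaleDl.

Lemma cts_addE f g a : (f + g) a = f a + g a. Proof. by []. Qed.
Lemma cts_subE f g a : (f - g) a = f a - g a. Proof. by []. Qed.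
Lemma cts_scaleE (r : R) f a : (r *: f) a = r * f a. Proof. by []. Qed.

Definition cts_const : {pred C} :=
  [pred f : C | `[< exists c : R, forall a, f a = c >]].

Let cts_const_zmod : zmod_closed cts_const.
Proof.
split; first by apply/asboolP; exists 0.
move=> f g /asboolP[c fc] /asboolP[d gd]; apply/asboolP; exists (c - d) => a.
by rewrite -(fc a) -(gd a).
Qed.

HB.instance Definition _ := GRing.isZmodClosed.Build C cts_const cts_const_zmod.

(* C(A)/R, the continuous functions modulo the constants *)
Definition ctsmod := Quotient.quot cts_const.

HB.instance Definition _ := Choice.on ctsmod.
HB.instance Definition _ := EqQuotient.on ctsmod.
HB.instance Definition _ := ZmodQuotient.on ctsmod.
HB.instance Definition _ := GRing.Zmodule.on ctsmod.

Lemma ctsmodP f g :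
  \pi_ctsmod f = \pi_ctsmod g <-> exists c : R, forall a, f a = g a + c.
Proof.
have -> : (\pi_ctsmod f = \pi_ctsmod g) <-> (f - g \in cts_const).
  by rewrite Quotient.idealrBE; split=> [/eqP|/eqP].
split=> [/asboolP[c fgc]|[c fgc]].
  by exists c => a; rewrite -(fgc a) cts_subE addrC subrK.
by apply/asboolP; exists c => a; rewrite cts_subE fgc addrC addKr.
Qed.

Definition ctsmod_scale (r : R) (x : ctsmod) : ctsmod :=
  \pi_ctsmod (r *: repr x).

Lemma pi_scale r f : ctsmod_scale r (\pi_ctsmod f) = \pi_ctsmod (r *: f).
Proof.
have [c fc] := (ctsmodP _ _).1 (reprK (\pi_ctsmod f)).
apply/ctsmodP; exists (r * c) => a.
rewrite [LHS](_ : _ = r * repr (\pi_ctsmod f) a)// fc.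
by rewrite mulrDr.
Qed.

Lemma pi_addm f g : \pi_ctsmod f + \pi_ctsmod g = \pi_ctsmod (f + g).
Proof. by rewrite [RHS]raddfD. Qed.

Let ctsmod_scaleA r s x : ctsmod_scale r (ctsmod_scale s x) = ctsmod_scale (r * s) x.
Proof. by elim/quotW: x => f; rewrite (pi_scale s f) !pi_scale scalerA. Qed.
Let ctsmod_scale1 : left_id 1 ctsmod_scale.
Proof. by elim/quotW => f; rewrite pi_scale scale1r. Qed.
Let ctsmod_scaleDr : right_distributive ctsmod_scale +%R.
Proof.
by move=> r; elim/quotW => f; elim/quotW => g; rewrite pi_addm !pi_scale pi_addm scalerDr.
Qed.
Let ctsmod_scaleDl x : {morph ctsmod_scale^~ x : r s / r + s}.
Proof. by move=> r s; elim/quotW: x => f; rewrite !pi_scale pi_addm scalerDl. Qed.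

HB.instance Definition _ := GRing.Zmodule_isLmodule.Build R ctsmod
  ctsmod_scaleA ctsmod_scale1 ctsmod_scaleDr ctsmod_scaleDl.

Lemma pi_scaleE r f : r *: \pi_ctsmod f = \pi_ctsmod (r *: f).
Proof. exact: pi_scale. Qed.

End continuous_functions.

Record exhaustion (R : realType) (A : topologicalType) := Exhaustion {
  exh_fun :> A -> R ;
  exh_continuous : continuous exh_fun ;
  exh_ge0 : forall a, 0 <= exh_fun a ;
  exh_proper : forall M : R, compact (exh_fun @^-1` `[0, M]) ;
  exh_noncompact : ~ compact [set: A] }.

(* Functions on [0, +oo[ are encoded as functions on R of which only the
   restriction to [0, +oo[ matters. *)
Record admissible (R : realType) := Admissible {
  adm_fun :> R -> R ;
  adm_continuous : {within `[0, +oo[, continuous adm_fun} ;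
  adm_ge1 : forall r, 0 <= r -> 1 <= adm_fun r ;
  adm_nondecreasing : forall r s, 0 <= r -> r <= s -> adm_fun r <= adm_fun s ;
  adm0 : adm_fun 0 = 1 ;
  adm_submul : exists2 K : R, 1 <= K & forall r s, 0 <= r -> 0 <= s ->
    adm_fun (r + s) <= K * adm_fun r * adm_fun s }.

Section weighted_space.
Context (R : realType) (A : topologicalType).
Variables (h : exhaustion R A) (phi : admissible R).
Local Notation C := (continuousType A R).
Local Notation Q := (ctsmod R A).
Implicit Types (f g : C) (x y : Q).

Definition weight : A -> R := phi \o h.
Local Notation W := weight.

(* filter of the limits as h(a) tends to infinity; proper because A is not
   compact, see [exh_infty_proper] *)
Definition exh_infty : set_system A := filter_from setT (fun M : R => [set a | M < h a]).

Definition exh_lim (f : A -> R) : R := lim (f a @[a --> exh_infty]).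

Definition weighted_transform (f : A -> R) : A -> R := fun a => W a * (f a - exh_lim f).

(* Both quantities below are invariant under adding a constant to f
   ([sharp_norm_pi], [sharp_limsup_pi]) and hence pass to C(A)/R. *)
Definition fsharp_norm (f : A -> R) : \bar R :=
  ereal_inf [set ereal_sup [set (W a * `|f a - c|)%:E | a in setT] | c in setT].

Definition fsharp_limsup (f : A -> R) : \bar R :=
  ereal_inf [set limf_esup (fun a => (W a * `|f a - c|)%:E) exh_infty | c in setT].

Definition sharp_norm x := fsharp_norm (repr x).
Definition sharp_limsup x := fsharp_limsup (repr x).

Let repr_pi f : exists c : R, forall a, f a = repr (\pi_Q f) a + c.
Proof. by apply/ctsmodP; rewrite reprK. Qed.

Let image_shift (B : A -> R -> R) (G : (A -> R) -> \bar R) (f f' : A -> R) (c : R) :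
  (forall a, f a = f' a + c) ->
  [set G (fun a => B a (f a - d)) | d in setT] =
  [set G (fun a => B a (f' a - d)) | d in setT].
Proof.
move=> ff'; apply/seteqP; split=> _ [d _ <-].
  exists (d - c) => //; congr G; apply/funext => a; rewrite ff'; congr B.
  by rewrite opprB addrA.
exists (d + c) => //; congr G; apply/funext => a; rewrite ff'; congr B.
by rewrite opprD addrACA subrr addr0.
Qed.

Lemma sharp_norm_pi f : sharp_norm (\pi_Q f) = fsharp_norm f.
Proof.
have [c fc] := repr_pi f; congr ereal_inf.
by rewrite (image_shift (fun a r => W a * `|r|)
  (fun k => ereal_sup [set (k a)%:E | a in setT]) fc).
Qed.

Lemma sharp_limsup_pi f : sharp_limsup (\pi_Q f) = fsharp_limsup f.
Proof.
have [c fc] := repr_pi f; congr ereal_inf.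
by rewrite (image_shift (fun a r => W a * `|r|)
  (fun k => limf_esup (EFin \o k) exh_infty) fc).
Qed.

Lemma weight_ge1 a : 1 <= W a. Proof. by apply/adm_ge1/exh_ge0. Qed.

Lemma weight_gt0 a : 0 < W a. Proof. exact/(lt_le_trans _ (weight_ge1 a)). Qed.

Lemma exh_unbounded (M : R) : exists a, M < h a.
Proof.
apply/not_existsP => hM; apply: (@exh_noncompact _ _ h).
rewrite (_ : setT = h @^-1` `[0, M]); first exact: exh_proper.
apply/seteqP; split=> // a _ /=.
by rewrite in_itv/= exh_ge0/= leNgt; apply/negP/hM.
Qed.

Lemma exh_infty_proper : ProperFilter exh_infty.
Proof.
apply: filter_from_proper; last by move=> M _; have [a ?] := exh_unbounded M; exists a.
apply: filter_from_filter; first by exists 0.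
move=> M N _ _; exists (Num.max M N) => // a /=.
by rewrite gt_max => /andP[].
Qed.

Lemma sharp_normP f (r : R) : (fsharp_norm f <= r%:E)%E <->
  forall e, 0 < e -> exists c, forall a, W a * `|f a - c| <= r + e.
Proof.
split=> [fr e e0|fr].
  have : (fsharp_norm f < (r + e)%:E)%E.
    by rewrite (le_lt_trans fr)// lte_fin ltrDl.
  move=> /ereal_inf_lt[_ [c _ <-]] /ltW cre.
  exists c => a; rewrite -lee_fin (le_trans _ cre)//.
  by apply: ereal_sup_ubound; exists a.
apply/lee_addgt0Pr => e /fr[c fc].
apply: (@le_trans _ _ (ereal_sup [set (W a * `|f a - c|)%:E | a in setT])).
  by apply: ereal_inf_lbound; exists c.
by apply: ge_ereal_sup => _ [a _ <-]; rewrite -EFinD lee_fin.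
Qed.

Lemma sharp_norm_ge0 f : (0 <= fsharp_norm f)%E.
Proof.
have [a _] := exh_unbounded 0.
apply: le_ereal_inf_tmp => _ [c _ <-]; apply: le_ereal_sup_tmp.
exists (W a * `|f a - c|)%:E; first by exists a.
by rewrite lee_fin mulr_ge0// ltW// weight_gt0.
Qed.

Lemma sharp_limsup_ge0 f : (0 <= fsharp_limsup f)%E.
Proof.
have [nF0] := exh_infty_proper => _.
apply: le_ereal_inf_tmp => _ [c _ <-]; apply: limf_esup_ge0 => // a.
by rewrite lee_fin mulr_ge0// ltW// weight_gt0.
Qed.

Lemma sharp_limsupP f : fsharp_limsup f = 0%E <->
  forall e, 0 < e -> exists c M, forall a, M < h a -> W a * `|f a - c| <= e.
Proof.
split=> [f0 e e0|fe].
  have : (fsharp_limsup f < e%:E)%E by rewrite f0 lte_fin.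
  move=> /ereal_inf_lt[_ [c _ <-]] /ereal_inf_lt[_ [V [M _ MV] <-]] /ltW Ve.
  exists c, M => a /MV Va; rewrite -lee_fin (le_trans _ Ve)//.
  by apply: ereal_sup_ubound; exists a.
apply/eqP; rewrite eq_le sharp_limsup_ge0 andbT.
apply/lee_addgt0Pr => e /fe[c [M fM]]; rewrite add0e.
apply: (@le_trans _ _ (limf_esup (fun a => (W a * `|f a - c|)%:E) exh_infty)).
  by apply: ereal_inf_lbound; exists c.
apply: (@le_trans _ _ (ereal_sup
    [set (W a * `|f a - c|)%:E | a in [set a | M < h a]])).
  by apply: ereal_inf_lbound; exists [set a | M < h a] => //; exists M.
by apply: ge_ereal_sup => _ [a Ma <-]; rewrite lee_fin fM.
Qed.

Definition wclass_pred : {pred Q} :=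
  [pred x : Q | `[< (sharp_norm x < +oo)%E /\ sharp_limsup x = 0%E >]].

Let weight_scale (r c : R) f a :
  W a * `|(r *: f) a - r * c| = `|r| * (W a * `|f a - c|).
Proof. by rewrite cts_scaleE -mulrBr normrM mulrCA. Qed.

Let weight_add (c d : R) f g a :
  W a * `|(f + g) a - (c + d)| <= W a * `|f a - c| + W a * `|g a - d|.
Proof.
by rewrite cts_addE opprD addrACA -mulrDr ler_wpM2l ?ler_normD// ltW// weight_gt0.
Qed.

Let fsharp_normZ_le (r s : R) f : (fsharp_norm f <= s%:E)%E ->
  (fsharp_norm (r *: f)%R <= (`|r| * s)%:E)%E.
Proof.
have [->|r0] := eqVneq r 0 => [_|/sharp_normP fs]; apply/sharp_normP => e e0.
  exists 0 => a.
  by rewrite cts_scaleE mul0r subrr !normr0 mulr0 mul0r add0r ltW.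
rewrite -normr_gt0 in r0.
have [c fc] := fs (e / `|r|) (divr_gt0 e0 r0).
exists (r * c) => a; rewrite weight_scale.
by rewrite (le_trans (ler_wpM2l _ (fc a)))// mulrDr mulrCA divff ?mulr1// gt_eqF.
Qed.

Let fsharp_normD (r s : R) f g : (fsharp_norm f <= r%:E)%E ->
  (fsharp_norm g <= s%:E)%E -> (fsharp_norm (f + g)%R <= (r + s)%:E)%E.
Proof.
move=> /sharp_normP fr /sharp_normP gs; apply/sharp_normP => e e0.
have [c fc] := fr _ (divr_gt0 e0 (ltr0n _ 2)).
have [d gd] := gs _ (divr_gt0 e0 (ltr0n _ 2)).
exists (c + d) => a; rewrite (le_trans (weight_add _ _ _ _ _))//.
by rewrite [e]splitr addrACA lerD.
Qed.

Let fsharp_limsup_lin (r : R) f g : fsharp_limsup f = 0%E ->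
  fsharp_limsup g = 0%E -> fsharp_limsup (r *: f + g)%R = 0%E.
Proof.
move=> /sharp_limsupP f0 /sharp_limsupP g0; apply/sharp_limsupP => e e0.
have [d [N gd]] := g0 _ (divr_gt0 e0 (ltr0n _ 2)).
have r1 : 0 < `|r| + 1 by rewrite ltr_wpDl.
have [c [M fc]] := f0 _ (divr_gt0 (divr_gt0 e0 (ltr0n _ 2)) r1).
exists (r * c + d), (Num.max M N) => a; rewrite gt_max => /andP[/fc Ma /gd Na].
rewrite (le_trans (weight_add _ _ _ _ _))// [e]splitr lerD// weight_scale.
rewrite (le_trans (ler_wpM2l _ Ma))// mulrCA ler_piMr// ?divr_ge0// ?ltW//.
by rewrite ltr_pdivrMr// mul1r ltrDl.
Qed.

Let fsharp_fin f : (fsharp_norm f < +oo)%E ->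
  fsharp_norm f = (fine (fsharp_norm f))%:E.
Proof. by move=> fy; rewrite fineK// ge0_fin_numE// sharp_norm_ge0. Qed.

Let wclass_submod : submod_closed wclass_pred.
Proof.
split.
  apply/asboolP; have -> : (0 : Q) = \pi_Q 0 by rewrite raddf0.
  rewrite sharp_norm_pi sharp_limsup_pi; split.
    apply: (@le_lt_trans _ _ 0%E); last exact: ltry.
    by apply/sharp_normP => e e0; exists 0 => a; rewrite subrr normr0 mulr0 add0r ltW.
  by apply/sharp_limsupP => e e0; exists 0, 0 => a _; rewrite subrr normr0 mulr0 ltW.
move=> r x y; elim/quotW: x => f; elim/quotW: y => g.
rewrite !inE !sharp_norm_pi !sharp_limsup_pi => -[fy f0] [gy g0].
rewrite pi_scaleE pi_addm sharp_norm_pi sharp_limsup_pi; split.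
  rewrite (le_lt_trans _ (ltry (`|r| * fine (fsharp_norm f) + fine (fsharp_norm g))))//.
  by apply: fsharp_normD; [apply: fsharp_normZ_le|]; rewrite -fsharp_fin.
exact: fsharp_limsup_lin.
Qed.

HB.instance Definition _ := GRing.isSubmodClosed.Build R Q wclass_pred
  (GRing.submod_closed_semi wclass_submod).

Record wclass := WClass { wclass_val :> Q ; _ : wclass_val \in wclass_pred }.

HB.instance Definition _ := [isSub for wclass_val].
HB.instance Definition _ := [Choice of wclass by <:].
HB.instance Definition _ := [SubChoice_isSubLmodule of wclass by <:].

Definition wclass_norm (x : wclass) : R := fine (sharp_norm x).

Let wclass_fin (x : wclass) : sharp_norm x = (wclass_norm x)%:E.
Proof. by have /asboolP[/fsharp_fin] := valP x. Qed.

Let wclass_normD (x y : wclass) :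
  wclass_norm (x + y) <= wclass_norm x + wclass_norm y.
Proof.
rewrite -lee_fin -wclass_fin.
have := wclass_fin x; have := wclass_fin y.
move: (wclass_norm x) (wclass_norm y) => r s.
rewrite [wclass_val (x + y)](_ : _ = wclass_val x + wclass_val y)//.
elim/quotW: (wclass_val x) => f; elim/quotW: (wclass_val y) => g.
rewrite pi_addm !sharp_norm_pi => gs fr.
by apply: fsharp_normD; rewrite ?gs ?fr.
Qed.

Let wclass_normZ_le (a : R) (x : wclass) :
  wclass_norm (a *: x) <= `|a| * wclass_norm x.
Proof.
rewrite -lee_fin -wclass_fin; have := wclass_fin x; move: (wclass_norm x) => r.
rewrite [wclass_val (a *: x)](_ : _ = a *: wclass_val x)//.
elim/quotW: (wclass_val x) => f; rewrite pi_scaleE !sharp_norm_pi => fr.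
by apply: fsharp_normZ_le; rewrite fr.
Qed.

Let wclass_norm_ge0 (x : wclass) : 0 <= wclass_norm x.
Proof. by rewrite -lee_fin -wclass_fin sharp_norm_ge0. Qed.

Let wclass_normZ (a : R) (x : wclass) :
  wclass_norm (a *: x) = `|a| * wclass_norm x.
Proof.
apply/eqP; rewrite eq_le wclass_normZ_le/=; have [->|a0] := eqVneq a 0.
  by rewrite normr0 mul0r.
rewrite -ler_pdivlMl ?normr_gt0// -normfV.
by rewrite (le_trans _ (wclass_normZ_le _ _))// scalerA mulVf// scale1r.
Qed.

Let wclass_norm0_eq0 (x : wclass) : wclass_norm x = 0 -> x = 0.
Proof.
move=> x0; apply: val_inj => /=; move: (wclass_fin x); rewrite x0.
elim/quotW: (wclass_val x) => f; rewrite sharp_norm_pi => f0.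
have [b _] := exh_unbounded 0.
have -> : (0 : Q) = \pi_Q 0 by rewrite raddf0.
apply/ctsmodP; exists (f b) => a.
rewrite add0r; apply/eqP; rewrite -subr_eq0 -normr_le0.
apply/ler_addgt0Pr => e e0; rewrite add0r.
have /sharp_normP/(_ _ (divr_gt0 e0 (ltr0n _ 2)))[c fc] : (fsharp_norm f <= 0%:E)%E.
  by rewrite f0.
have {}fc k : `|f k - c| <= e / 2.
  rewrite -[e / 2]add0r (le_trans _ (fc k))// ler_peMl//; exact: weight_ge1.
rewrite (le_trans (ler_distD c _ _))// [e]splitr lerD//.
by rewrite distrC.
Qed.

HB.instance Definition _ := @Lmodule_isNormed.Build R wclass wclass_norm
  wclass_normD wclass_normZ wclass_norm0_eq0.

Lemma wclass_normE (x : wclass) : (`|x|)%:E = sharp_norm x.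
Proof. by rewrite wclass_fin. Qed.

End weighted_space.

Section charge_integration.
Context d (T : measurableType d) (R : realType).
Implicit Types mu nu : {charge set T -> \bar R}.

Definition hahn_pos nu : set T := sval (cid (Hahn_decomposition nu)).
Definition hahn_neg nu : set T := sval (cid (svalP (cid (Hahn_decomposition nu)))).

Lemma hahnP nu : hahn_decomposition nu (hahn_pos nu) (hahn_neg nu).
Proof. exact: (svalP (cid (svalP (cid (Hahn_decomposition nu))))). Qed.

Definition total_variation nu : {measure set T -> \bar R} :=
  charge_variation (hahnP nu).

(* integral of f over D against the signed measure nu, by Jordan decomposition *)
Definition charge_integral nu (D : set T) (f : T -> R) : R :=
  \int[jordan_pos (hahnP nu)]_(x in D) f x -
  \int[jordan_neg (hahnP nu)]_(x in D) f x.

Lemma total_variation_fin nu B : measurable B -> (total_variation nu B < +oo)%E.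
Proof. by move=> mB; rewrite -ge0_fin_numE// fin_num_measure. Qed.

Lemma abse_total_variation nu B : measurable B ->
  (`|nu B| <= total_variation nu B)%E.
Proof. exact: abse_charge_variation. Qed.

Lemma total_variation_le nu (m : {measure set T -> \bar R}) :
  (forall B, measurable B -> `|nu B| <= m B)%E ->
  forall B, measurable B -> (total_variation nu B <= m B)%E.
Proof.
move=> num B mB; have [[mP _] [mN _] PN PN0] := hahnP nu.
have mBP : measurable (B `&` hahn_pos nu) by exact: measurableI.
have mBN : measurable (B `&` hahn_neg nu) by exact: measurableI.
rewrite /total_variation/= /charge_variation/= jordan_posE jordan_negE.
rewrite cjordan_posE cjordan_negE /crestr0 mem_set//= /crestr.
rewrite -[in leRHS](setIT B) -PN setIUr measureU//; last first.
  by rewrite setIACA PN0 setI0.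
rewrite leeD// (le_trans _ (num _ _))//; first exact: lee_abs.
by rewrite -abseN lee_abs.
Qed.

End charge_integration.

Notation Borel A := (g_sigma_algebraType (@open A)).

Lemma continuous_Borel_measurable (R : realType) (A : ptopologicalType) (f : A -> R) :
  continuous f -> measurable_fun [set: Borel A] f.
Proof.
move=> /continuousP cf; apply: (measurability _ (measurable_realfun.RGenOpens.measurableE R)).
move=> _ [_ [a [b ->] <-]]; rewrite setTI; apply: sub_sigma_algebra.
exact/cf/interval_open.
Qed.

Section signed_measures.
Context (R : realType) (A : ptopologicalType).
Implicit Types mu nu : {charge set (Borel A) -> \bar R}.

Definition regular_measure (m : set (Borel A) -> \bar R) :=
  forall B, measurable B ->
    m B = ereal_inf [set m U | U in [set U : set A | open U /\ B `<=` U]] /\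
    m B = ereal_sup [set m K | K in [set K : set A | compact K /\ K `<=` B]].

(* [sm_nonborel] normalizes the values of the underlying set function outside
   the Borel sets, so that equal measures are equal as terms. *)
Record signed_measure := SignedMeasure {
  sm_charge :> {charge set (Borel A) -> \bar R} ;
  sm_regular : regular_measure (total_variation sm_charge) ;
  sm_nonborel : forall B : set (Borel A), ~ measurable B -> sm_charge B = 0%E }.

HB.instance Definition _ := gen_eqMixin signed_measure.
HB.instance Definition _ := gen_choiceMixin signed_measure.

Lemma signed_measureP (mu nu : signed_measure) :
  mu = nu <-> forall B : set (Borel A), mu B = nu B.
Proof.
split=> [->//|munu].
case: mu nu munu => mu rmu nmu [nu rnu nnu] /= /funext munu.
have {}munu : mu = nu.
  case: mu nu munu {rmu nmu rnu nnu} => mu [[m1] [m2] [m3]] [nu [[n1] [n2] [n3]]] /= munu.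
  subst nu; congr Charge.Pack; congr Charge.Class; congr (_ _); exact: Prop_irrelevance.
by subst nu; congr SignedMeasure; exact: Prop_irrelevance.
Qed.

Lemma sm_fin_num (mu : signed_measure) (B : set (Borel A)) : mu B \is a fin_num.
Proof.
have [mB|mB] := pselect (measurable B); first exact: fin_num_measure.
by rewrite sm_nonborel.
Qed.

Let eps_regular (m : set (Borel A) -> \bar R) :=
  forall (B : set (Borel A)) (e : R), measurable B -> 0 < e ->
  exists K U : set (Borel A),
    [/\ @compact A K, measurable K, @open A U, K `<=` B /\ B `<=` U &
        (m (U `\` K) < e%:E)%E].

Let open_Borel (U : set A) : open U -> @measurable _ (Borel A) U.
Proof. exact: sub_sigma_algebra. Qed.

Let regular_measureP (m : {measure set (Borel A) -> \bar R}) :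
  (forall B, measurable B -> m B < +oo)%E ->
  (forall B, ~ measurable B -> m B = 0)%E ->
  regular_measure m <-> eps_regular m.
Proof.
move=> mfin m0; split=> [mreg B e mB e0|mreg B mB].
  have [infB supB] := mreg B mB.
  have e20 : 0 < e / 2 by rewrite divr_gt0.
  have mBfin : m B \is a fin_num by rewrite ge0_fin_numE// mfin.
  have : (m B < m B + (e / 2)%:E)%E by rewrite lteDl.
  rewrite [X in (X < _)%E]infB => /ereal_inf_lt[_ [U [oU BU] <-] mU].
  have : (m B - (e / 2)%:E < m B)%E by rewrite lteBlDr// lteDl.
  rewrite [X in (_ < X)%E]supB => /ereal_sup_gt[_ [K' [cK' KB'] <-] mK'].
  have [K [cK mK KB BK]] : exists K : set (Borel A),
      [/\ @compact A K, measurable K, K `<=` B & (m B - (e / 2)%:E < m K)%E].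
    have [mK|mK] := pselect (@measurable _ (Borel A) K'); first by exists K'.
    exists set0; split => //; first exact: compact0.
    by rewrite measure0 -(m0 _ mK).
  have moU := open_Borel oU.
  exists K, U; split=> //.
  have UK : (m B + (e / 2)%:E < e%:E + m K)%E.
    have mKfin : m K \is a fin_num by rewrite ge0_fin_numE// mfin.
    move: BK; rewrite -(fineK mKfin) -(fineK mBfin).
    by rewrite -EFinB -!EFinD !lte_fin; clear; lra.
  rewrite measureD//; last exact: mfin.
  rewrite [U `&` K](_ : _ = K); last by apply/setIidPr/(subset_trans KB).
  by rewrite lteBlDr ?(lt_trans mU UK)// ge0_fin_numE// mfin.
split; apply/eqP; rewrite eq_le; apply/andP; split.
- apply: le_ereal_inf_tmp => _ [U [oU BU] <-].
  by apply: le_measure => //; rewrite inE//; exact: open_Borel.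
- apply/lee_addgt0Pr => e e0; have [K [U [cK mK oU [KB BU] UK]]] := mreg B e mB e0.
  have mU := open_Borel oU.
  apply: (@le_trans _ _ (m U)); first by apply: ereal_inf_lbound; exists U.
  rewrite (measureDI m mU mB) addeC leeD//.
    by apply: le_measure => //; rewrite ?inE//; exact: measurableI.
  apply: ltW; apply: le_lt_trans UK; apply: le_measure; rewrite ?inE.
  + exact: measurableD.
  + exact: measurableD.
  + exact: setDS.
- apply/lee_addgt0Pr => e e0; have [K [U [cK mK oU [KB BU] UK]]] := mreg B e mB e0.
  have mU := open_Borel oU.
  apply: (@le_trans _ _ (m K + e%:E)%E); last first.
    by rewrite leeD2r//; apply: ereal_sup_ubound; exists K.
  rewrite (measureDI m mB mK) addeC leeD//.
    by apply: le_measure => //; rewrite ?inE//; exact: measurableI.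
  apply: ltW; apply: le_lt_trans UK; apply: le_measure; rewrite ?inE.
  + exact: measurableD.
  + exact: measurableD.
  + exact: setSD.
- apply: ge_ereal_sup => _ [K [cK KB] <-].
  have [mK|mK] := pselect (@measurable _ (Borel A) K); last by rewrite m0.
  by apply: le_measure => //; rewrite inE.
Qed.

Let total_variation_nonborel nu (B : set (Borel A)) : ~ measurable B ->
  total_variation nu B = 0%E.
Proof.
move=> mB; rewrite /total_variation/= /charge_variation/= jordan_posE jordan_negE.
by rewrite cjordan_posE cjordan_negE /crestr0 memNset//= oppr0 adde0.
Qed.

Let tv_regularP nu :
  regular_measure (total_variation nu) <-> eps_regular (total_variation nu).
Proof.
apply: regular_measureP => B; first exact: total_variation_fin.
exact: total_variation_nonborel.
Qed.

Let dominated_by (k : {charge set (Borel A) -> \bar R}) (c d : {nonneg R}) mu nu :=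
  forall B, measurable B -> (`|k B| <= c%:num%:E * `|mu B| + d%:num%:E * `|nu B|)%E.

Let combine (c d : {nonneg R}) mu nu : {measure set (Borel A) -> \bar R} :=
  measure_add (mscale c (total_variation mu)) (mscale d (total_variation nu)).

Let combineE c d mu nu B : combine c d mu nu B =
  (c%:num%:E * total_variation mu B + d%:num%:E * total_variation nu B)%E.
Proof. exact: measure_addE. Qed.

Let tv_combine k c d mu nu : dominated_by k c d mu nu ->
  forall B, measurable B -> (total_variation k B <= combine c d mu nu B)%E.
Proof.
move=> kcd; apply: total_variation_le => B mB; rewrite (le_trans (kcd B mB))//.
rewrite combineE.
by rewrite leeD// lee_wpmul2l ?lee_fin// abse_total_variation.
Qed.

Let regular_dominated k c d mu nu : dominated_by k c d mu nu ->
  regular_measure (total_variation mu) -> regular_measure (total_variation nu) ->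
  regular_measure (total_variation k).
Proof.
move=> kcd /tv_regularP rmu /tv_regularP rnu; apply/tv_regularP => B e mB e0.
have gt0_den (z : {nonneg R}) : 0 < 2 * (z%:num + 1) by rewrite mulr_gt0// ltr_wpDl.
have [K1 [U1 [cK1 mK1 oU1 [KB1 BU1] UK1]]] := rmu B _ mB (divr_gt0 e0 (gt0_den c)).
have [K2 [U2 [cK2 mK2 oU2 [KB2 BU2] UK2]]] := rnu B _ mB (divr_gt0 e0 (gt0_den d)).
have mU1 := open_Borel oU1.
have mU2 := open_Borel oU2.
exists (K1 `|` K2), (U1 `&` U2); split.
- exact: compactU.
- exact: measurableU.
- exact: openI.
- by split; [rewrite subUset|rewrite subsetI].
have mD : measurable ((U1 `&` U2) `\` (K1 `|` K2)).
  by apply: measurableD; [exact: measurableI|exact: measurableU].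
apply: le_lt_trans (tv_combine kcd mD) _.
rewrite combineE.
have half (z : {nonneg R}) (rho : {charge set (Borel A) -> \bar R}) (U K : set (Borel A)) :
    measurable U -> measurable K ->
    (U1 `&` U2) `\` (K1 `|` K2) `<=` U `\` K ->
    (total_variation rho (U `\` K) < (e / (2 * (z%:num + 1)))%:E)%E ->
    (z%:num%:E * total_variation rho ((U1 `&` U2) `\` (K1 `|` K2)) < (e / 2)%:E)%E.
  move=> mU mK sub rhoe.
  apply: (@le_lt_trans _ _ (z%:num%:E * (e / (2 * (z%:num + 1)))%:E)%E).
    rewrite lee_wpmul2l ?lee_fin// ltW//; apply: le_lt_trans rhoe.
    by apply: le_measure; rewrite ?inE//; exact: measurableD.
  rewrite -EFinM lte_fin invfM (mulrA e) mulrCA gtr_pMr ?divr_gt0//.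
  by rewrite ltr_pdivrMr ?mul1r ?ltrDl// ltr_wpDl.
rewrite [e]splitr EFinD lteD//.
  by apply: half UK1 => // a [[? ?]]; rewrite not_orE => -[].
by apply: half UK2 => // a [[? ?]]; rewrite not_orE => -[].
Qed.

Let czero_regular : regular_measure (total_variation (czero : {charge set (Borel A) -> \bar R})).
Proof.
apply/tv_regularP => B e mB e0; exists set0, setT; split => //.
- exact: compact0.
- exact: openT.
- by split; [exact: sub0set|exact: subsetT].
apply: (@le_lt_trans _ _ 0%E); last by rewrite lte_fin.
apply: (@total_variation_le _ _ _ _ mzero); last by rewrite setD0.
by move=> U _; rewrite abse0.
Qed.

Definition sm_zero : signed_measure := SignedMeasure czero_regular (fun _ _ => erefl).

Let cadd_dominated mu nu : dominated_by (cadd mu nu) 1%:nng 1%:nng mu nu.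
Proof. by move=> B mB; rewrite !mul1e; exact: lee_abs_add. Qed.

Let copp_dominated nu : dominated_by (copp nu) 1%:nng 0%:nng nu nu.
Proof. by move=> B mB; rewrite mul1e mul0e adde0 abseN. Qed.

Let cscale_dominated (a : R) nu : dominated_by (cscale a nu) `|a|%:nng 0%:nng nu nu.
Proof. by move=> B mB; rewrite /cscale abseM mul0e adde0. Qed.

Let sm_add_nonborel (mu nu : signed_measure) (B : set (Borel A)) :
  ~ measurable B -> cadd mu nu B = 0%E.
Proof. by move=> mB; rewrite /cadd !sm_nonborel// adde0. Qed.

Definition sm_add (mu nu : signed_measure) : signed_measure :=
  SignedMeasure (regular_dominated (@cadd_dominated mu nu) (sm_regular mu) (sm_regular nu))
    (@sm_add_nonborel mu nu).

Let sm_opp_nonborel (nu : signed_measure) (B : set (Borel A)) :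
  ~ measurable B -> copp nu B = 0%E.
Proof. by move=> mB; rewrite /copp sm_nonborel// oppe0. Qed.

Definition sm_opp (nu : signed_measure) : signed_measure :=
  SignedMeasure (regular_dominated (@copp_dominated nu) (sm_regular nu) (sm_regular nu))
    (@sm_opp_nonborel nu).

Let sm_scale_nonborel a (nu : signed_measure) (B : set (Borel A)) :
  ~ measurable B -> cscale a nu B = 0%E.
Proof. by move=> mB; rewrite /cscale sm_nonborel// mule0. Qed.

Definition sm_scale (a : R) (nu : signed_measure) : signed_measure :=
  SignedMeasure (regular_dominated (@cscale_dominated a nu) (sm_regular nu) (sm_regular nu))
    (@sm_scale_nonborel a nu).

Let sm_addA : associative sm_add.
Proof. by move=> m n p; apply/signed_measureP => B; exact: addeA. Qed.
Let sm_addC : commutative sm_add.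
Proof. by move=> m n; apply/signed_measureP => B; exact: addeC. Qed.
Let sm_add0 : left_id sm_zero sm_add.
Proof. by move=> m; apply/signed_measureP => B; exact: add0e. Qed.
Let sm_addN : left_inverse sm_zero sm_opp sm_add.
Proof.
move=> m; apply/signed_measureP => B.
by rewrite /= /cadd /= addeC subee// sm_fin_num.
Qed.

HB.instance Definition _ := GRing.isZmodule.Build signed_measure
  sm_addA sm_addC sm_add0 sm_addN.

Let sm_scaleA a b m : sm_scale a (sm_scale b m) = sm_scale (a * b) m.
Proof. by apply/signed_measureP => B; rewrite /= /cscale/= EFinM muleA. Qed.
Let sm_scale1 : left_id 1 sm_scale.
Proof. by move=> m; apply/signed_measureP => B; exact: mul1e. Qed.
Let sm_scaleDr : right_distributive sm_scale +%R.
Proof.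
move=> a m n; apply/signed_measureP => B.
by rewrite /= /cscale/= /cadd/= muleDr// fin_num_adde_defl// sm_fin_num.
Qed.
Let sm_scaleDl m : {morph sm_scale^~ m : a b / a + b}.
Proof.
move=> a b; apply/signed_measureP => B.
by rewrite /= /cscale/= /cadd/= /cscale EFinD muleDl// sm_fin_num.
Qed.

HB.instance Definition _ := GRing.Zmodule_isLmodule.Build R signed_measure
  sm_scaleA sm_scale1 sm_scaleDr sm_scaleDl.

Definition weighted_variation (w : Borel A -> R) (mu : signed_measure) : \bar R :=
  (\int[total_variation mu]_x (w x)%:E)%E.

Section weighted_variation.
Variable w : Borel A -> R.
Hypotheses (w0 : forall a, 0 <= w a) (mw : measurable_fun [set: Borel A] w).
Implicit Types m n : signed_measure.

Let mEw : measurable_fun [set: Borel A] (EFin \o w).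
Proof. exact/measurable_EFinP. Qed.

Lemma weighted_variation_ge0 m : (0 <= weighted_variation w m)%E.
Proof. by apply: integral_ge0 => a _; rewrite lee_fin. Qed.

Let weighted_variation_dominated c d m n k : dominated_by k c d m n ->
  (\int[total_variation k]_x (w x)%:E <=
   c%:num%:E * weighted_variation w m + d%:num%:E * weighted_variation w n)%E.
Proof.
move=> kcd.
have Ew0 a : (0 <= (EFin \o w) a)%E by rewrite lee_fin.
apply: le_trans (ge0_le_measure_integral (tv_combine kcd) measurableT Ew0 mEw) _.
have -> := @ge0_integral_measure_add _ _ _ (mscale c (total_variation m))
  (mscale d (total_variation n)) _ measurableT _ (fun a _ => Ew0 a) mEw.
by rewrite !ge0_integral_mscale.
Qed.

Lemma weighted_variationD m n : (weighted_variation w (m + n)%R <= weighted_variation w m + weighted_variation w n)%E.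
Proof. by have := weighted_variation_dominated (@cadd_dominated m n); rewrite !mul1e. Qed.

Lemma weighted_variationZ_le a m : (weighted_variation w (a *: m)%R <= `|a|%:E * weighted_variation w m)%E.
Proof. by have := weighted_variation_dominated (@cscale_dominated a m); rewrite mul0e adde0. Qed.

Lemma weighted_variationZ a m : (weighted_variation w (a *: m)%R = `|a|%:E * weighted_variation w m)%E.
Proof.
apply/eqP; rewrite eq_le weighted_variationZ_le/=; have [->|a0] := eqVneq a 0.
  by rewrite normr0 mul0e weighted_variation_ge0.
rewrite -[in leLHS](scale1r m) -(mulVf a0) -scalerA.
rewrite (le_trans (lee_wpmul2l _ (weighted_variationZ_le _ _)))// ?lee_fin//.
by rewrite muleA -EFinM normfV divff ?mul1e// normr_eq0.
Qed.

Lemma weighted_variation0_eq0 m : (forall a, 0 < w a) -> weighted_variation w m = 0%E -> m = 0.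
Proof.
move=> wpos wm0; apply/signed_measureP => B.
have [mB|mB] := pselect (measurable B); last by rewrite !sm_nonborel.
apply/eqP; rewrite -abse_eq0 eq_le abse_ge0 andbT.
rewrite (le_trans (abse_total_variation _ mB))//.
rewrite (le_trans (le_measure _ _ _ (@subsetT _ B))) ?inE//.
have : (\int[total_variation m]_x `|(w x)%:E| = 0)%E.
  by rewrite -[RHS]wm0; apply: eq_integral => a _; rewrite gee0_abs// lee_fin.
move=> /(ae_eq_integral_abs _ measurableT mEw)[N [mN N0 wN]].
rewrite -N0; apply: le_measure; rewrite ?inE// => a _; apply: wN => /=.
by move=> /(_ I) [] wa; have := wpos a; rewrite wa ltxx.
Qed.

End weighted_variation.

Definition sm_norm (mu : signed_measure) : R := fine (total_variation mu setT).

Let sm_normE (mu : signed_measure) : weighted_variation (cst 1) mu = (sm_norm mu)%:E.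
Proof.
rewrite [LHS](_ : _ = \int[total_variation mu]_x cst 1%:E x)%E//.
rewrite integral_cst// mul1e /sm_norm fineK//.
by rewrite ge0_fin_numE// total_variation_fin.
Qed.

Let sm_normD (mu nu : signed_measure) : sm_norm (mu + nu) <= sm_norm mu + sm_norm nu.
Proof. by rewrite -lee_fin EFinD -!sm_normE; apply: weighted_variationD => //. Qed.

Let sm_normZ a (mu : signed_measure) : sm_norm (a *: mu) = `|a| * sm_norm mu.
Proof. by apply: EFin_inj; rewrite EFinM -!sm_normE; apply: weighted_variationZ. Qed.

Let sm_norm0_eq0 (mu : signed_measure) : sm_norm mu = 0 -> mu = 0.
Proof.
by move=> mu0; apply: (@weighted_variation0_eq0 (cst 1)) => //; rewrite sm_normE mu0.
Qed.

HB.instance Definition _ := @Lmodule_isNormed.Build R signed_measure sm_norm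
  sm_normD sm_normZ sm_norm0_eq0.

Lemma signed_measure_normE (mu : signed_measure) :
  (`|mu|)%:E = total_variation mu setT.
Proof. by rewrite fineK// ge0_fin_numE// total_variation_fin. Qed.

End signed_measures.

Section null_measures.
Context (R : realType) (A : ptopologicalType).
Variables (h : exhaustion R A) (phi : admissible R).
Local Notation M := (signed_measure R A).

Lemma weight_continuous : continuous (weight h phi).
Proof.
move=> a; apply: (@cvg_comp _ _ _ h phi _ (within `[0, +oo[ (nbhs (h a)))).
  move=> V /= hV; have := @exh_continuous _ _ h a _ hV.
  rewrite /nbhs/= /fmap/=; apply: filterS => b; apply.
  by rewrite /= in_itv/= andbT; exact: exh_ge0.
have /subspace_continuousP := @adm_continuous _ phi; apply.
by rewrite /= in_itv/= andbT; exact: exh_ge0.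
Qed.

Let w : A -> R := fun a => (weight h phi a)^-1.

Let w_gt0 a : 0 < w a. Proof. by rewrite invr_gt0 weight_gt0. Qed.

Let w_ge0 a : 0 <= w a. Proof. exact/ltW. Qed.

Let mw : measurable_fun [set: Borel A] w.
Proof.
apply: continuous_Borel_measurable => a; apply: cvgV.
  by rewrite gt_eqF// weight_gt0.
exact: weight_continuous.
Qed.

Definition null_measure_pred : {pred M} :=
  [pred nu : M | `[< nu setT = 0%E /\ (weighted_variation w nu < +oo)%E >]].

Let null_measure_submod : submod_closed null_measure_pred.
Proof.
split.
  apply/asboolP; split=> //.
  by rewrite -(scale0r (0 : M)) weighted_variationZ// normr0 mul0e ltry.
move=> a m n /asboolP[m0 my] /asboolP[n0 ny]; apply/asboolP; split.
  by rewrite /= /cadd/= /cscale/= m0 n0 mule0 adde0.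
rewrite (le_lt_trans (weighted_variationD _ _ _ _))// lte_add_pinfty// weighted_variationZ//.
by rewrite lte_mul_pinfty// lee_fin.
Qed.

HB.instance Definition _ := GRing.isSubmodClosed.Build R M null_measure_pred
  (GRing.submod_closed_semi null_measure_submod).

Record null_measure := NullMeasure {
  null_measure_val :> M ; _ : null_measure_val \in null_measure_pred }.

HB.instance Definition _ := [isSub for null_measure_val].
HB.instance Definition _ := [Choice of null_measure by <:].
HB.instance Definition _ := [SubChoice_isSubLmodule of null_measure by <:].

Implicit Types m n : null_measure.

Definition null_measure_norm m : R := fine (weighted_variation w m).

Let null_normE m : weighted_variation w m = (null_measure_norm m)%:E.
Proof.
by rewrite fineK// ge0_fin_numE ?weighted_variation_ge0//; have /asboolP[] := valP m.
Qed.

Let null_normD m n :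
  null_measure_norm (m + n) <= null_measure_norm m + null_measure_norm n.
Proof. by rewrite -lee_fin EFinD -!null_normE; exact: weighted_variationD. Qed.

Let null_normZ a m : null_measure_norm (a *: m) = `|a| * null_measure_norm m.
Proof. by apply: EFin_inj; rewrite EFinM -!null_normE; exact: weighted_variationZ. Qed.

Let null_norm0_eq0 m : null_measure_norm m = 0 -> m = 0.
Proof.
move=> m0; apply: val_inj; apply: (weighted_variation0_eq0 w_ge0 mw w_gt0).
by rewrite null_normE m0.
Qed.

HB.instance Definition _ := @Lmodule_isNormed.Build R null_measure
  null_measure_norm null_normD null_normZ null_norm0_eq0.

Lemma null_measure_normE m :
  (`|m|)%:E = weighted_variation (fun a => (weight h phi a)^-1) m.
Proof. by rewrite -null_normE. Qed.

End null_measures.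

(* Main.v *)
(* For [f] in X, f - L(f) = O(1 / W) at infinity, and T[f] = W (f - L(f))
   identifies X isometrically with C_0(A). Hence X^* = M(A)
   by the Riesz representation theorem, and f = L(f) + W^-1 T[f] turns
   integration of f against a measure nu of total mass 0 into integration of
   T[f] against W^-1 nu.

   For the Riesz theorem, a positive functional P on C_0(A) yields the outer
   measure mu(E) = inf {sup {P g | 0 <= g <= 1_U} | E subset of U open}. By
   second countability every open set is {u > 0} for some u in C_0(A), which
   takes the place of partitions of unity. A bounded functional is the difference
   of two positive ones.

   The range of nu |-> W^-1 nu is dense: truncate sigma to {h <= n} and correct
   the value of its integral of W by a multiple c / W(a) of a Dirac mass at a far
   away point a. It does not contain Dirac masses. So M_0^{W^-1}(A), isometric to
   a dense proper subspace of M(A), is not complete, whereas a dual is. *)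
Require Import Defs.
From HB Require Import structures.
From mathcomp Require Import all_boot all_order all_algebra.
From mathcomp Require Import all_classical all_reals all_analysis.
From mathcomp Require Import measurable_realfun.
From mathcomp Require Import lra.
Import Order.TTheory GRing.Theory Num.Theory.
Import numFieldNormedType.Exports.
Local Open Scope classical_set_scope.
Local Open Scope ring_scope.
Local Open Scope quotient_scope.
Set Implicit Arguments.
Unset Strict Implicit.
Unset Printing Implicit Defensive.

(* [realfun.total_variation] shadows the total variation of a charge. *)
Local Notation total_variation := Defs.total_variation.

(** * Measures with a density *)

(** Unboundedness of [phi] is what makes the quotient norm tractable: W |f - c| can stay bounded
    near infinity only for c = L(f), so both infima over c are governed by this one constant. Two
    obstacles shape the measure theory. The integral against a charge is defined by its Jordan
    parts, which are not additive in the charge; linearity rests on the fact that every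
    representation of the charge as a difference of finite measures that integrate f gives the same
    value. Moreover an element of M(A) carries a proof of regularity, so it cannot be formed freely;
    on A every finite Borel measure turns out to be regular, so a density, a Dirac mass or a pair of
    measures from the Riesz theorem always yields one. The range can be dense because integration of
    W is an unbounded functional on M(A). The failure of isometry has to be shown for arbitrary
    linear bijections, unrelated to nu |-> Lambda_nu; this is why completeness is used, and not
    merely the range of that map. *)

Section measures.
Context d (T : measurableType d) (R : realType).
Implicit Types (D : set T) (f g : T -> R).

Lemma le_measure_integrable (m1 m2 : {measure set T -> \bar R}) D f :
  measurable D -> (forall B, measurable B -> (m1 B <= m2 B)%E) ->
  m2.-integrable D (EFin \o f) -> m1.-integrable D (EFin \o f).
Proof.
move=> mD m12 /(integrable_mkcond _ mD)/integrableP[mf fy].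
apply/(integrable_mkcond _ mD)/integrableP; split => //; apply: le_lt_trans fy.
by apply: ge0_le_measure_integral => //; exact: measurableT_comp.
Qed.

Lemma bounded_integrable (m : {finite_measure set T -> \bar R}) f (M : R) :
  measurable_fun setT f -> (forall x, `|f x| <= M) ->
  m.-integrable setT (EFin \o f).
Proof.
move=> mf fM; apply: measurable_bounded_integrable => //.
  by rewrite ltey_eq fin_num_measure.
by exists M; split; [exact: num_real|move=> N MN x _; exact/(le_trans (fM x))/ltW].
Qed.

Lemma density_measure (mu : {measure set T -> \bar R}) g :
  (forall x, 0 <= g x) -> mu.-integrable setT (EFin \o g) ->
  exists nu : {finite_measure set T -> \bar R},
    forall A, measurable A -> nu A = (\int[mu]_(x in A) (g x)%:E)%E.
Proof.
move=> g0 ig.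
have pos A : (0 <= induced_charge ig A)%E.
  by apply: integral_ge0 => x _; rewrite lee_fin.
pose k : {measure set T -> \bar R} := measure_of_charge _ pos.
have kfin : fin_num_fun k.
  by move=> A mA; apply: (@fin_num_measure _ _ _ (induced_charge ig)).
pose nu : {finite_measure set T -> \bar R} :=
  HB.pack (k : set T -> \bar R) (Measure.class k)
    (Measure_isFinite.Build _ _ _ _ kfin).
by exists nu.
Qed.

(** The change of variables formula is available for the Radon-Nikodym derivative of [nu] with
    respect to [mu]; having the same integrals over all measurable sets, that derivative is almost
    everywhere [g]. *)
Lemma ge0_integral_density (mu nu : {finite_measure set T -> \bar R})
    (g : T -> R) (f : T -> \bar R) D :
  (forall x, 0 <= g x) -> measurable_fun setT g ->
  (forall A, measurable A -> nu A = (\int[mu]_(x in A) (g x)%:E)%E) ->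
  (forall x, 0 <= f x)%E -> measurable D -> measurable_fun D f ->
  (\int[nu]_(x in D) f x = \int[mu]_(x in D) (f x * (g x)%:E))%E.
Proof.
move=> g0 mg nug f0 mD mf.
have numu : nu `<< mu.
  apply/null_content_dominatesP => A mA A0; rewrite nug//.
  rewrite (eq_measure_integral mzero) ?integral_measure_zero// => B mB BA.
  apply/eqP; rewrite eq_le measure_ge0 andbT -[leRHS]/(0%E) -A0.
  by apply: le_measure; rewrite ?inE.
rewrite -(Radon_Nikodym_SigmaFinite.change_of_variables numu)//.
apply: ae_eq_integral => //.
- apply: emeasurable_funM => //; apply: (measurable_funS measurableT) => //.
  by apply: measurable_int; exact: Radon_Nikodym_SigmaFinite.f_integrable.
- apply: emeasurable_funM => //; apply/measurable_EFinP.
  exact: measurable_funTS.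
apply: ae_eqe_mul2l; apply: (@ae_eq_subset _ _ _ _ _ setT) => //.
apply: integral_ae_eq => //.
- exact: Radon_Nikodym_SigmaFinite.f_integrable.
- exact/measurable_EFinP.
- by move=> A _ mA; rewrite -Radon_Nikodym_SigmaFinite.f_integral// nug.
Qed.

Lemma Rintegral_density (mu nu : {finite_measure set T -> \bar R})
    (g f : T -> R) D :
  (forall x, 0 <= g x) -> measurable_fun setT g ->
  (forall A, measurable A -> nu A = (\int[mu]_(x in A) (g x)%:E)%E) ->
  measurable D -> measurable_fun D f ->
  \int[nu]_(x in D) f x = \int[mu]_(x in D) (f x * g x).
Proof.
move=> g0 mg nug mD mf; rewrite /Rintegral; congr fine.
have mEf : measurable_fun D (EFin \o f) by exact/measurable_EFinP.
rewrite integralE [in RHS]integralE; congr (_ - _)%E.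
- rewrite (ge0_integral_density g0 mg nug)//; last exact: measurable_funepos.
  apply: eq_integral => x _.
  by rewrite !funeposE/= maxe_pMl ?lee_fin// mul0e EFinM.
- rewrite (ge0_integral_density g0 mg nug)//; last exact: measurable_funeneg.
  apply: eq_integral => x _.
  by rewrite !funenegE/= maxe_pMl ?lee_fin// mul0e -mulNr EFinM.
Qed.

End measures.

(** * Integration against a charge *)

(** Trades an equality of differences for an equality of sums, which can be read as an equality of
    measures. *)
Lemma adde_cross (R : numDomainType) (p n a b : \bar R) :
  p \is a fin_num -> n \is a fin_num -> a \is a fin_num -> b \is a fin_num ->
  (p - n = a - b)%E -> (p + b = n + a)%E.
Proof.
move: p n a b => [p||] [n||] [a||] [b||]// _ _ _ _ [pnab].
by rewrite -!EFinD -[p](subrK n) pnab addrAC subrK addrC.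
Qed.

Section charges.
Context d (T : measurableType d) (R : realType).
Implicit Types (D : set T) (f g : T -> R) (nu : {charge set T -> \bar R}).

Local Notation jpos nu := (jordan_pos (hahnP nu)).
Local Notation jneg nu := (jordan_neg (hahnP nu)).

Lemma jordanE nu B : measurable B -> nu B = (jpos nu B - jneg nu B)%E.
Proof. by move=> mB; rewrite [LHS](jordan_decomp (hahnP nu))// /cadd/= cscaleN1. Qed.

Lemma total_variationE nu B : total_variation nu B = (jpos nu B + jneg nu B)%E.
Proof. by []. Qed.

Lemma integrable_total_variation nu D f : measurable D ->
  (total_variation nu).-integrable D (EFin \o f) <->
  (jpos nu).-integrable D (EFin \o f) /\ (jneg nu).-integrable D (EFin \o f).
Proof.
move=> mD; split=> [ftv|[]].
  by split; apply: le_measure_integrable ftv => // B mB;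
    rewrite total_variationE ?leeDl ?leeDr.
move=> /integrableP[mf fp] /integrableP[_ fn]; apply/integrableP; split => //.
rewrite (eq_measure_integral (measure_add (jpos nu) (jneg nu))); last first.
  by move=> A mA _; exact: (esym (measure_addE _ _ A)).
rewrite ge0_integral_measure_add//; last exact: measurableT_comp.
by rewrite lte_add_pinfty.
Qed.

Lemma ge0_integral_total_variation nu D (f : T -> \bar R) : measurable D ->
  (forall x, 0 <= f x)%E -> measurable_fun D f ->
  (\int[total_variation nu]_(x in D) f x =
   \int[jpos nu]_(x in D) f x + \int[jneg nu]_(x in D) f x)%E.
Proof.
move=> mD f0 mf.
rewrite (eq_measure_integral (measure_add (jpos nu) (jneg nu))); last first.
  by move=> A mA _; exact: (esym (measure_addE _ _ A)).
by rewrite ge0_integral_measure_add.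
Qed.

(** Minimality of the Jordan decomposition: on the positive Hahn set [nu] is m1 - m2, hence at most
    m1. Functions integrable for m1 and m2 are thereby integrable for the Jordan parts. *)
Lemma jordan_pos_min nu (m1 m2 : {finite_measure set T -> \bar R}) :
  (forall B, measurable B -> nu B = (m1 B - m2 B)%E) ->
  forall B, measurable B -> (jpos nu B <= m1 B)%E.
Proof.
move=> nuE B mB; have [[mP _] _ _ _] := hahnP nu.
have mBP : measurable (B `&` hahn_pos nu) by exact: measurableI.
rewrite jordan_posE cjordan_posE /= /crestr0 mem_set//= /crestr nuE//.
apply: (@le_trans _ _ (m1 (B `&` hahn_pos nu))).
  by rewrite leeBlDr ?fin_num_measure// leeDl.
by apply: le_measure; rewrite ?inE.
Qed.

Lemma jordan_neg_min nu (m1 m2 : {finite_measure set T -> \bar R}) :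
  (forall B, measurable B -> nu B = (m1 B - m2 B)%E) ->
  forall B, measurable B -> (jneg nu B <= m2 B)%E.
Proof.
move=> nuE B mB; have [_ [mN _] _ _] := hahnP nu.
have mBN : measurable (B `&` hahn_neg nu) by exact: measurableI.
rewrite jordan_negE cjordan_negE /= /crestr0 mem_set//= /crestr nuE//.
rewrite fin_num_oppeB ?fin_num_measure//.
apply: (@le_trans _ _ (m2 (B `&` hahn_neg nu))).
  by rewrite addeC leeBlDr ?fin_num_measure// leeDl.
by apply: le_measure; rewrite ?inE.
Qed.

(** Independence of the decomposition: pos + m2 and neg + m1 are the same measure, and integrating f
    against it in both ways gives the formula after cancellation of finite terms. *)
Lemma charge_integral_diff nu (m1 m2 : {finite_measure set T -> \bar R}) D f :
  measurable D -> (forall B, measurable B -> nu B = (m1 B - m2 B)%E) ->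
  m1.-integrable D (EFin \o f) -> m2.-integrable D (EFin \o f) ->
  (total_variation nu).-integrable D (EFin \o f) /\
  charge_integral nu D f = \int[m1]_(x in D) f x - \int[m2]_(x in D) f x.
Proof.
move=> mD nuE f1 f2.
have fp := le_measure_integrable mD (jordan_pos_min nuE) f1.
have fn := le_measure_integrable mD (jordan_neg_min nuE) f2.
have mf : measurable_fun D (EFin \o f) by case/integrableP : f1.
split; first by apply/integrable_total_variation.
have : (\int[measure_add (jpos nu) m2]_(x in D) (f x)%:E =
        \int[measure_add (jneg nu) m1]_(x in D) (f x)%:E)%E.
  apply: eq_measure_integral => A mA _.
  rewrite [LHS](measure_addE _ _ A) [RHS](measure_addE _ _ A).
  by apply: adde_cross; rewrite ?fin_num_measure// -nuE// jordanE.
rewrite !integral_measure_add// /charge_integral /Rintegral.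
have i1 := integrable_fin_num mD f1; have i2 := integrable_fin_num mD f2.
have i3 := integrable_fin_num mD fp; have i4 := integrable_fin_num mD fn.
move: i1 i2 i3 i4 => /=.
set a := integral _ _ _; set b := integral _ _ _; set p := integral _ _ _.
set n := integral _ _ _ => /fineK <- /fineK <- /fineK <- /fineK <-.
by rewrite -!EFinD => -[/=]; lra.
Qed.

(** The Jordan parts of a sum are not the sums of the Jordan parts, but these sums still represent
    [nu] as a difference of finite measures, which is enough. *)
Lemma charge_integralD (nu nu1 nu2 : {charge set T -> \bar R}) D f :
  measurable D -> (forall B, measurable B -> nu B = (nu1 B + nu2 B)%E) ->
  (total_variation nu1).-integrable D (EFin \o f) ->
  (total_variation nu2).-integrable D (EFin \o f) ->
  charge_integral nu D f = charge_integral nu1 D f + charge_integral nu2 D f.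
Proof.
move=> mD nuE /(integrable_total_variation _ _ mD)[fp1 fn1].
move=> /(integrable_total_variation _ _ mD)[fp2 fn2].
have add (m1 m2 : {finite_measure set T -> \bar R}) :
    m1.-integrable D (EFin \o f) -> m2.-integrable D (EFin \o f) ->
    exists m : {finite_measure set T -> \bar R},
    [/\ forall B, measurable B -> m B = (m1 B + m2 B)%E,
        m.-integrable D (EFin \o f) &
        \int[m]_(x in D) f x = \int[m1]_(x in D) f x + \int[m2]_(x in D) f x].
  move=> f1 f2; have mf : measurable_fun D (EFin \o f) by case/integrableP : f1.
  have afin : fin_num_fun (measure_add m1 m2).
    by move=> B mB; rewrite [measure_add _ _ _]measure_addE fin_numD !fin_num_measure.
  pose m : {finite_measure set T -> \bar R} :=
    HB.pack (measure_add m1 m2 : set T -> \bar R) (Measure.class (measure_add m1 m2))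
    (Measure_isFinite.Build _ _ _ _ afin).
  exists m; split.
  - by move=> B mB; exact: (measure_addE m1 m2 B).
  - apply/integrableP; split => //.
    rewrite (eq_measure_integral (measure_add m1 m2))//.
    rewrite ge0_integral_measure_add//; last exact: measurableT_comp.
    by move/integrableP : f1 => [_ ?]; move/integrableP : f2 => [_ ?];
      rewrite lte_add_pinfty.
  - rewrite /Rintegral (eq_measure_integral (measure_add m1 m2))//.
    by rewrite integral_measure_add// fineD//; exact: integrable_fin_num.
have [mp [mpE ip intp]] := add _ _ fp1 fp2.
have [mn [mnE ni intn]] := add _ _ fn1 fn2.
rewrite (charge_integral_diff mD _ ip ni).2; first by rewrite intp intn opprD addrACA.
move=> B mB; rewrite nuE// mpE// mnE// (jordanE nu1)// (jordanE nu2)//.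
by rewrite fin_num_oppeD ?fin_num_measure// addeACA.
Qed.

Lemma bounded_integrable_total_variation nu f (M : R) :
  measurable_fun setT f -> (forall x, `|f x| <= M) ->
  (total_variation nu).-integrable setT (EFin \o f).
Proof.
move=> mf fM; apply: measurable_bounded_integrable => //.
  exact: total_variation_fin.
by exists M; split; [exact: num_real|move=> N MN x _; exact/(le_trans (fM x))/ltW].
Qed.

Lemma charge_integral_le nu f (M : R) :
  measurable_fun setT f -> (forall x, `|f x| <= M) ->
  `|charge_integral nu setT f| <= M * fine (total_variation nu setT).
Proof.
move=> mf fM; have := bounded_integrable_total_variation nu mf fM.
move=> /(integrable_total_variation _ _ measurableT)[fp fn].
rewrite total_variationE fineD ?fin_num_measure// mulrDr.
apply: le_trans (ler_normB _ _) _; apply: lerD.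
all: apply: (le_trans (le_normr_Rintegral _ _)) => //.
all: rewrite -Rintegral_cst//; apply: le_Rintegral => //.
all: rewrite ?integrable_norm//.
all: exact: finite_measure_integrable_cst.
Qed.

(** Carriers P and N of mutually singular m1 and m2 form a Hahn decomposition of m1 - m2, and Hahn
    decompositions agree up to null sets. *)
Lemma jordan_singular nu (m1 m2 : {finite_measure set T -> \bar R}) P N :
  measurable P -> measurable N -> P `|` N = setT -> P `&` N = set0 ->
  m1 N = 0%E -> m2 P = 0%E ->
  (forall B, measurable B -> nu B = (m1 B - m2 B)%E) ->
  forall B, measurable B -> jpos nu B = m1 B /\ jneg nu B = m2 B.
Proof.
move=> mP mN PNT PN0 m1N m2P nuE.
have null (m : {finite_measure set T -> \bar R}) S B : measurable S ->
    m S = 0%E -> measurable B -> m (B `&` S) = 0%E.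
  move=> mS mS0 mB; apply/eqP; rewrite eq_le measure_ge0 andbT -mS0.
  by apply: le_measure; rewrite ?inE//; exact: measurableI.
have nuP B : measurable B -> nu (B `&` P) = m1 (B `&` P).
  by move=> mB; rewrite nuE ?(null _ _ _ _ m2P) ?sube0//; exact: measurableI.
have nuN B : measurable B -> nu (B `&` N) = (- m2 (B `&` N))%E.
  by move=> mB; rewrite nuE ?(null _ _ _ _ m1N) ?sub0e//; exact: measurableI.
have H : hahn_decomposition nu P N.
  split => //; split => // B mB /setIidPl <-.
    by rewrite nuP.
  by rewrite nuN// oppe_le0.
have split_ (m : {finite_measure set T -> \bar R}) B : measurable B ->
    m B = (m (B `&` P) + m (B `&` N))%E.
  move=> mB; rewrite -measureU; [|exact: measurableI|exact: measurableI|].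
    by rewrite -setIUr PNT setIT.
  by rewrite setIACA PN0 setI0.
move=> B mB; have [eP eN] := Hahn_decomposition_uniq (hahnP nu) H mB.
split.
  rewrite jordan_posE cjordan_posE /= /crestr0 mem_set//= /crestr eP nuP//.
  by rewrite [RHS]split_// (null _ _ _ _ m1N)// adde0.
rewrite jordan_negE cjordan_negE /= /crestr0 mem_set//= /crestr eN nuN// oppeK.
by rewrite [RHS]split_// (null _ _ _ _ m2P)// add0e.
Qed.

(** The relation usually written kappa = g nu. It constrains [kappa] on measurable sets only, so a
    regular signed measure that agrees there with a constructed charge qualifies too. *)
Definition charge_density nu (g : T -> R) (kappa : {charge set T -> \bar R}) :=
  forall B, measurable B -> kappa B = (charge_integral nu B g)%:E.

Section charge_density.
Variables (nu : {charge set T -> \bar R}) (g : T -> R).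
Hypotheses (g0 : forall x, 0 <= g x)
  (ig : (total_variation nu).-integrable setT (EFin \o g)).

Let mg : measurable_fun setT g.
Proof. by apply/measurable_EFinP; case/integrableP : ig. Qed.

Let charge_integral_measures :
  exists m1 m2 : {finite_measure set T -> \bar R},
  [/\ forall A, measurable A -> m1 A = (\int[jpos nu]_(x in A) (g x)%:E)%E,
      forall A, measurable A -> m2 A = (\int[jneg nu]_(x in A) (g x)%:E)%E &
      forall A, measurable A -> (charge_integral nu A g)%:E = (m1 A - m2 A)%E].
Proof.
have [gp gn] := (integrable_total_variation _ _ measurableT).1 ig.
have [m1 m1E] := density_measure g0 gp.
have [m2 m2E] := density_measure g0 gn.
exists m1, m2; split => // A mA.
rewrite /charge_integral EFinB m1E// m2E// !fineK//.
  by rewrite -m2E// fin_num_measure.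
by rewrite -m1E// fin_num_measure.
Qed.

Lemma charge_density_exists : exists kappa, charge_density nu g kappa.
Proof.
have [m1 [m2 [_ _ mE]]] := charge_integral_measures.
exists (cadd (charge_of_finite_measure m1)
             (cscale (-1) (charge_of_finite_measure m2))) => B mB.
by rewrite mE// /= /cadd/= cscaleN1.
Qed.

Variables (kappa : {charge set T -> \bar R}).
Hypothesis nug : charge_density nu g kappa.

(** Since g >= 0, a Hahn decomposition for [nu] carries the two measures g pos and g neg separately,
    so they are singular and are the Jordan parts of g nu. In particular |g nu| = g |nu|. *)
Let jordan_density A : measurable A ->
  jpos kappa A = (\int[jpos nu]_(x in A) (g x)%:E)%E /\
  jneg kappa A = (\int[jneg nu]_(x in A) (g x)%:E)%E.
Proof.
move=> mA; have [m1 [m2 [m1E m2E mE]]] := charge_integral_measures.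
have [[mP _] [mN _] PN PN0] := hahnP nu.
have null (m : {measure set T -> \bar R}) S : measurable S -> m S = 0%E ->
    (\int[m]_(x in S) (g x)%:E = 0)%E.
  move=> mS mS0.
  rewrite (eq_measure_integral mzero) ?integral_measure_zero// => B mB BS.
  apply/eqP; rewrite eq_le measure_ge0 andbT -[leRHS]/(0%E) -mS0.
  by apply: le_measure; rewrite ?inE.
have jN0 : jpos nu (hahn_neg nu) = 0%E.
  rewrite jordan_posE cjordan_posE /= /crestr0 mem_set//= /crestr.
  by rewrite setIC PN0 charge0.
have jP0 : jneg nu (hahn_pos nu) = 0%E.
  rewrite jordan_negE cjordan_negE /= /crestr0 mem_set//= /crestr.
  by rewrite PN0 charge0 oppe0.
rewrite -m1E// -m2E//; apply: (jordan_singular mP mN PN PN0) => //.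
- by rewrite m1E//; exact: null jN0.
- by rewrite m2E//; exact: null jP0.
- by move=> B mB; rewrite nug// mE.
Qed.

Lemma ge0_integral_charge_density (f : T -> \bar R) D :
  (forall x, 0 <= f x)%E -> measurable D -> measurable_fun D f ->
  (\int[total_variation kappa]_(x in D) f x =
   \int[total_variation nu]_(x in D) (f x * (g x)%:E))%E.
Proof.
move=> f0 mD mf; rewrite !ge0_integral_total_variation//; last 2 first.
- by move=> x; rewrite mule_ge0 ?lee_fin.
- apply: emeasurable_funM => //; apply/measurable_EFinP.
  exact: measurable_funTS.
by congr (_ + _)%E; apply: ge0_integral_density => // A /jordan_density[].
Qed.

Lemma charge_integral_density f D : measurable D -> measurable_fun D f ->
  charge_integral kappa D f = charge_integral nu D (fun x => f x * g x).
Proof.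
move=> mD mf; congr (_ - _); apply: Rintegral_density => // A /jordan_density[]//.
Qed.

End charge_density.

Lemma charge_integralZ (nu nu' : {charge set T -> \bar R}) (c : R) D f :
  measurable D -> (forall B, measurable B -> nu B = (c%:E * nu' B)%E) ->
  (total_variation nu').-integrable D (EFin \o f) ->
  (total_variation nu).-integrable D (EFin \o f) /\
  charge_integral nu D f = c * charge_integral nu' D f.
Proof.
(* A negative factor is moved into the charge: the opposite charge is represented by the Jordan
   parts of [nu'] in exchanged order. *)
wlog c0 : c nu' / 0 <= c => [wlg mD nuE fnu'|].
  have [/wlg|/ltW c0] := leP 0 c; first by apply.
  have [fp fn] := (integrable_total_variation _ _ mD).1 fnu'.
  have oppE B : measurable B -> copp nu' B = (jneg nu' B - jpos nu' B)%E.
    move=> mB; rewrite /copp /= jordanE// fin_num_oppeB ?fin_num_measure//.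
    by rewrite addeC.
  have [iN E] := charge_integral_diff mD oppE fn fp.
  have [|B mB|//|i ->] := wlg (- c) (copp nu') _ mD.
  - by rewrite oppr_ge0.
  - by rewrite nuE// EFinN mulNe -muleN /copp /= oppeK.
  - by split => //; rewrite E mulNr -mulrN opprB.
move=> mD nuE fnu'; have [fp fn] := (integrable_total_variation _ _ mD).1 fnu'.
have mf : measurable_fun D f by apply/measurable_EFinP; case/integrableP : fnu'.
have cst_int : (total_variation nu').-integrable setT (EFin \o cst c).
  exact: (@bounded_integrable_total_variation _ _ `|c|).
(* For c >= 0 the multiple has constant density c, so the results on densities apply. *)
have nuc : charge_density nu' (cst c) nu.
  move=> B mB; rewrite nuE// jordanE// /charge_integral !Rintegral_cst//.
  by rewrite -mulrBr EFinM EFinB !fineK//; exact: fin_num_measure.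
split; last first.
  rewrite (@charge_integral_density nu' (cst c) (fun=> c0) cst_int)//.
  by rewrite /charge_integral !RintegralZr// -mulrBl mulrC.
apply/integrableP; split; first exact/measurable_EFinP.
have mnf : measurable_fun D (fun x => `|(EFin \o f) x|)%E.
  by apply: measurableT_comp => //; exact/measurable_EFinP.
rewrite (ge0_integral_charge_density (fun=> c0) cst_int nuc)//.
rewrite ge0_integralZr// ?lee_fin// muleC lte_mul_pinfty ?lee_fin//.
by case/integrableP : fnu'.
Qed.

End charges.

(** * Functions vanishing at infinity *)

Lemma half_expr_le (R : realType) (e : R) : 0 < e -> exists n, 2^-1 ^+ n <= e.
Proof.
move=> e0; have : (2^-1 ^+ n : R) @[n --> \oo] --> 0.
  by apply: cvg_expr; rewrite ger0_norm ?invr_ge0// invf_lt1// ltr1n.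
move=> /cvgrPdist_le/(_ _ e0)[n _ /(_ n (leqnn _))].
by rewrite sub0r normrN => /(le_trans (ler_norm _)); exists n.
Qed.

Section limits_of_continuous_functions.
Context (R : realType) (A : topologicalType).
Implicit Types (u g : A -> R).

Lemma uniform_approx_continuous u :
  (forall e, 0 < e -> exists2 g, continuous g & forall a, `|u a - g a| <= e) ->
  continuous u.
Proof.
move=> ug a; apply/cvgrPdist_le => e e0.
have e30 : 0 < e / 3 by rewrite divr_gt0.
have [g cg gu] := ug _ e30.
have /cvgrPdist_le/(_ _ e30) := cg a; apply: filterS => b gab.
have -> : u a - u b = (u a - g a) + (g a - g b) + (g b - u b) by lra.
have -> : e = e / 3 + e / 3 + e / 3 by lra.
apply: (le_trans (ler_normD _ _)); apply: lerD; last by rewrite distrC.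
by apply: (le_trans (ler_normD _ _)); apply: lerD.
Qed.

(** The function is the sum of 2^-(i+1) f_i. The third clause drops these weights: a positive lower
    bound for u is then already visible in finitely many f_i, which is how a finite subfamily is
    extracted later. *)
Lemma dyadic_series_continuous (f : nat -> A -> R) :
  (forall n, continuous (f n)) -> (forall n a, 0 <= f n a <= 1) ->
  exists u, [/\ continuous u, forall a, 0 <= u a <= 1,
    forall n a, u a <= \sum_(i < n) f i a + 2^-1 ^+ n &
    forall a, 0 < u a <-> exists n, 0 < f n a].
Proof.
move=> cf f01.
have f0 n a : 0 <= f n a by have /andP[] := f01 n a.
have f1 n a : f n a <= 1 by have /andP[] := f01 n a.
pose S n a : R := \sum_(i < n) 2^-1 ^+ i.+1 * f i a.
have ipow n : 0 < 2^-1 ^+ n :> R by rewrite exprn_gt0// invr_gt0.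
have SS n a : S n.+1 a = S n a + 2^-1 ^+ n.+1 * f n a by rewrite /S big_ord_recr.
(* S n increases while S n + 2^-n decreases, because f <= 1. All later partial sums are thus
   enclosed, and the limit can be taken as a supremum. *)
have Sle n m a : (n <= m)%N -> S n a <= S m a /\ S m a + 2^-1 ^+ m <= S n a + 2^-1 ^+ n.
  move=> /subnK <-; elim: (m - n)%N => [|k [IH1 IH2]]; first by rewrite add0n.
  rewrite addSn SS; split.
    by rewrite (le_trans IH1)// lerDl mulr_ge0// ltW.
  rewrite (le_trans _ IH2)// -addrA lerD2l.
  rewrite [leRHS](_ : _ = 2^-1 ^+ (k + n).+1 * 1 + 2^-1 ^+ (k + n).+1).
    by rewrite lerD2r ler_pM2l.
  by rewrite exprS; lra.
have Sub n m a : S m a <= S n a + 2^-1 ^+ n.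
  have [nm|/ltnW mn] := leqP n m.
    by rewrite (le_trans _ (Sle _ _ a nm).2)// lerDl ltW.
  by rewrite (le_trans (Sle _ _ a mn).1)// lerDl ltW.
pose u a := sup (range (S ^~ a)).
have hs a : has_sup (range (S ^~ a)).
  split; first by exists (S 0%N a); exists 0%N.
  by exists (S 0%N a + 2^-1 ^+ 0) => _ [m _ <-].
have uge n a : S n a <= u a by apply: sup_upper_bound => //; exists n.
have ule n a : u a <= S n a + 2^-1 ^+ n by apply: ge_sup => [|_ [m _ <-]//]; case: (hs a).
have S0 a : S 0%N a = 0 by rewrite /S big_ord0.
exists u; split.
- apply: uniform_approx_continuous => e e0.
  have [n ne] := half_expr_le e0.
  exists (S n).
    apply: continuous_big => [|i _]; first exact: add_continuous.
    by move=> a; apply: cvgM; [exact: cvg_cst|exact: cf].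
  move=> a; rewrite ger0_norm ?subr_ge0// lerBlDl (le_trans (ule n a))// lerD2l//.
- move=> a; rewrite -{1}(S0 a) uge/= (le_trans (ule 0%N a))// S0 add0r expr0//.
- move=> n a; rewrite (le_trans (ule n a))// lerD2r; apply: ler_sum => i _.
  by rewrite ler_piMl// exprn_ile1// ?invr_ge0// invf_le1// ler1n.
- move=> a; split=> [ua|[n fn]]; last first.
    apply: lt_le_trans (uge n.+1 a); rewrite SS ltr_wpDl ?mulr_gt0//.
    by rewrite -(S0 a); exact: (Sle 0%N n a _).1.
  apply/not_existsP => fn; move: ua; apply/negP; rewrite -leNgt.
  apply: ge_sup => [|_ [m _ <-]]; first by case: (hs a).
  rewrite /S big1// => i _; rewrite [f i a](_ : _ = 0) ?mulr0//.
  by apply/eqP; rewrite eq_le f0 andbT leNgt; apply/negP/fn.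
Qed.

End limits_of_continuous_functions.

Section vanishing_functions.
Context (R : realType) (A : topologicalType) (h : exhaustion R A).
Implicit Types (f g u : A -> R).

(** Membership in C_0(A): the sets {h <= M} are compact, and every compact set lies in one of them
    because h is bounded on it. *)
Definition c0_fun g := continuous g /\
  forall e, 0 < e -> exists M, forall a, M < h a -> `|g a| <= e.

Lemma c0_cont g : c0_fun g -> continuous g. Proof. by case. Qed.

Lemma c0_bounded g : c0_fun g -> exists2 M, 0 <= M & forall a, `|g a| <= M.
Proof.
move=> [cg g0]; have [M gM] := g0 1 ltr01.
have : bounded_set (g @` (h @^-1` `[0, M])).
  apply: compact_bounded; apply: continuous_compact; last exact: exh_proper.
  exact: continuous_subspaceT.
move=> /ex_strict_bound_gt0[k k0 gk]; exists (Num.max k 1); first by rewrite le_max ltW.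
move=> a; have [ha|/gM ga] := leP (h a) M; last by rewrite le_max ga orbT.
rewrite le_max ltW//; apply: gk; exists a => //=.
by rewrite in_itv/= exh_ge0.
Qed.

(** The closure of C_0(A) under scaling, maxima, minima and truncation reduces to this
    comparison. *)
Lemma c0_dominated f g (k : R) : continuous f -> c0_fun g ->
  (forall a, `|f a| <= k * `|g a|) -> c0_fun f.
Proof.
move=> cf [cg g0] fg; split => // e e0.
have k1 : 0 < `|k| + 1 by rewrite ltr_wpDl.
have [M gM] := g0 _ (divr_gt0 e0 k1); exists M => a /gM ga.
rewrite (le_trans (fg a))// (@le_trans _ _ ((`|k| + 1) * `|g a|))//.
  by rewrite ler_wpM2r// (le_trans (ler_norm k))// lerDl.
by rewrite mulrC -ler_pdivlMr.
Qed.

Lemma c0_0 : c0_fun (fun=> 0).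
Proof. by split=> [|e e0]; [exact: cst_continuous|exists 0 => a _; rewrite normr0 ltW]. Qed.

Lemma c0_D f g : c0_fun f -> c0_fun g -> c0_fun (f \+ g).
Proof.
move=> [cf f0] [cg g0]; split => [|e e0].
  by move=> a; apply: cvgD; [exact: cf|exact: cg].
have e2 : 0 < e / 2 by rewrite divr_gt0.
have [M fM] := f0 _ e2; have [N gN] := g0 _ e2.
exists (Num.max M N) => a; rewrite gt_max => /andP[/fM fa /gN ga].
by rewrite (le_trans (ler_normD _ _))// [e]splitr lerD.
Qed.

Lemma c0_Z (k : R) g : c0_fun g -> c0_fun (k \*o g).
Proof.
move=> cg; apply: (@c0_dominated _ g `|k|) => //.
  by move=> a; apply: cvgM; [exact: cvg_cst|exact: c0_cont].
by move=> a; rewrite normrM.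
Qed.

Lemma c0_sub f g : c0_fun f -> c0_fun g -> c0_fun (fun a => f a - g a).
Proof.
move=> cf cg; have -> : (fun a => f a - g a) = f \+ (-1 \*o g).
  by apply/funext => a /=; rewrite mulN1r.
exact/c0_D/c0_Z.
Qed.

Lemma c0_sum n (f : 'I_n -> A -> R) : (forall i, c0_fun (f i)) ->
  c0_fun (fun a => \sum_(i < n) f i a).
Proof.
elim: n f => [|n IH] f cf.
  rewrite (_ : (fun _ => _) = fun=> 0); first exact: c0_0.
  by apply/funext => a; rewrite big_ord0.
rewrite (_ : (fun _ => _) = f ord0 \+ fun a => \sum_(i < n) f (lift ord0 i) a).
  by apply: c0_D => //; apply: IH.
by apply/funext => a; rewrite big_ord_recl.
Qed.

Lemma c0_max f g : c0_fun f -> c0_fun g -> c0_fun (f \max g).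
Proof.
move=> cf cg.
have c k : c0_fun k -> c0_fun (fun a => `|k a|).
  move=> ck; apply: (@c0_dominated _ k 1) => //.
    by move=> a; apply: cvg_norm; exact: c0_cont.
  by move=> a; rewrite normr_id mul1r.
apply: (@c0_dominated _ (fun a => `|f a| + `|g a|) 1).
- by move=> a; apply: continuous_max; exact: c0_cont.
- by apply: c0_D; exact: c.
- move=> a; rewrite mul1r [leRHS]ger0_norm ?addr_ge0//=.
  by case: (leP (f a) (g a)) => _; rewrite ?lerDl ?lerDr.
Qed.

Lemma c0_min f g : continuous f -> (forall a, 0 <= f a) -> c0_fun g ->
  (forall a, 0 <= g a) -> c0_fun (f \min g).
Proof.
move=> cf f0 cg g0; apply: (@c0_dominated _ g 1) => //.
  by move=> a; apply: continuous_min; [exact: cf|exact: c0_cont].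
move=> a; rewrite mul1r !ger0_norm ?le_min ?f0 ?g0//.
by rewrite ge_min lexx orbT.
Qed.

Lemma c0_superlevel_compact g (e : R) : c0_fun g -> 0 < e ->
  compact [set a | e <= g a].
Proof.
move=> [cg g0] e0; have e20 : 0 < e / 2 by rewrite divr_gt0.
have [M gM] := g0 _ e20.
apply: (@subclosed_compact _ _ (h @^-1` `[0, M])).
- by move/continuous_closedP : cg => /(_ _ (@closed_ge R e)).
- exact: exh_proper.
- move=> a /= ega; rewrite in_itv/= exh_ge0/= leNgt; apply/negP => /gM.
  by rewrite leNgt (lt_le_trans _ (ler_norm _))// (lt_le_trans _ ega)//; lra.
Qed.

Lemma compact_positive_lower_bound (K : set A) u : compact K -> continuous u ->
  (forall a, K a -> 0 < u a) -> exists2 e, 0 < e & forall a, K a -> e <= u a.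
Proof.
move=> cK cu u0; have [->|/set0P K0] := eqVneq K set0; first by exists 1.
have [b /set_mem Kb ub] := compact_EVT_min K0 cK (continuous_subspaceT cu).
by exists (u b) => [|a Ka]; [exact: u0|exact/ub/mem_set].
Qed.

End vanishing_functions.

(** * Open sets as positivity sets of functions in C_0(A) *)

Section cozero.
Context (R : realType) (A : topologicalType) (h : exhaustion R A).
Hypotheses (A_hausdorff : hausdorff_space A)
  (A_locally_compact : locally_compact [set: A])
  (A_second_countable : @second_countable A).

(* Second countability reduces the functions separating the points of U from
   its complement to countably many, which can be summed. *)
Lemma open_cozero (U : set A) : open U ->
  exists u : A -> R, [/\ c0_fun h u, forall a, 0 <= u a <= 1 &
                         forall a, 0 < u a <-> U a].
Proof.
move=> oU; have [B /countable_injP[f injf] [Bo Bb]] := A_second_countable.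
(* [n] is the code of a basic open set b; a good function is positive on b and only inside U. *)
pose good n (phi : A -> R) := exists b, [/\ B b, f b = n, continuous phi,
  forall a, 0 <= phi a <= 1 & (forall a, b a -> 0 < phi a) /\
  (forall a, 0 < phi a -> U a)].
(* When no function is good for the code n, the zero function is taken, which contributes nothing to
   the series. *)
have E n : exists phi : A -> R, [/\ continuous phi, forall a, 0 <= phi a <= 1,
    forall a, 0 < phi a -> U a &
    forall psi, good n psi -> good n phi].
  have [[phi gphi]|ngood] := pselect (exists phi, good n phi).
    by exists phi; have [b [? ? ? ? []]] := gphi; split.
  exists (cst 0); split=> [|a|a|psi gpsi].
  - exact: cst_continuous.
  - by rewrite lexx ler01.
  - by rewrite ltxx.
  - by case: ngood; exists psi.
pose F n := sval (cid (E n)).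
have FP n : [/\ continuous (F n), forall a, 0 <= F n a <= 1,
    forall a, 0 < F n a -> U a &
    forall psi, good n psi -> good n (F n)] := svalP (cid (E n)).
have [u [cu u01 _ upos]] := @dyadic_series_continuous R A F
  (fun n => let: And4 c _ _ _ := FP n in c) (fun n => let: And4 _ c _ _ := FP n in c).
have uU a : 0 < u a <-> U a.
  rewrite upos; split=> [[n Fna]|Ua]; first by have [_ _ + _] := FP n; apply.
  have clU : closed (~` U) by exact: open_closedC.
  have /(@uniform_separatorP _ R) [phi [cphi phi01 phia phiU]] :=
    @locally_compact_completely_regular A R A_locally_compact A_hausdorff a _ clU
      (fun nUa => nUa Ua).
  have {}phi01 b : 0 <= phi b <= 1.
    by have := phi01 (phi b); rewrite /= in_itv; apply; exists b.
  pose psi b := 1 - phi b.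
  have cpsi : continuous psi.
    by move=> b; apply: cvgB; [exact: cvg_cst|exact: cphi].
  have psia : 0 < psi a.
    by rewrite /psi (phia (phi a)) ?subr0//; exists a.
  have /(Bb a)[b [Bb' ba] bpsi] : nbhs a [set b | 0 < psi b].
    apply: open_nbhs_nbhs; split => //.
    by move/continuousP : cpsi => /(_ _ (@open_gt R 0)).
  have gpsi : good (f b) psi.
    exists b; split => //.
      by move=> c; have := phi01 c; rewrite /psi; lra.
    split; first by move=> c /bpsi.
    move=> c psic; apply: contrapT => nUc; move: psic.
    by rewrite /psi (phiU (phi c)) ?subrr ?ltxx//; exists c.
  (* The function selected for the code of b need not be [psi], but it is good for that code;
     injectivity of the coding returns b, on which it is positive. *)
  have [_ _ _ /(_ _ gpsi)[b' [Bb'' /injf bb' _ _ [pos _]]]] := FP (f b).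
  by exists (f b); apply: pos; rewrite bb' ?inE.
have h1 a : 0 < 1 + h a by rewrite ltr_pwDl// exh_ge0.
(* Division by 1 + h forces decay at infinity and leaves the positivity set unchanged. *)
pose v a := u a / (1 + h a).
have u0 a : 0 <= u a by have /andP[] := u01 a.
have u1 a : u a <= 1 by have /andP[] := u01 a.
have vle a e : 0 < e -> e^-1 < h a -> v a <= e.
  move=> e0 eh; rewrite ler_pdivrMr// (le_trans (u1 a))//.
  by rewrite mulrC -ler_pdivrMr// mul1r (le_trans (ltW eh))// lerDr.
exists v; split.
- split=> [a|e e0].
    apply: cvgM; first exact: cu.
    apply: cvgV; first by rewrite gt_eqF.
    by apply: cvgD; [exact: cvg_cst|exact: exh_continuous].
  exists e^-1 => a /(vle _ _ e0); rewrite ger0_norm// divr_ge0//.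
  exact: ltW.
- move=> a; rewrite divr_ge0 ?(ltW (h1 a))//= ler_pdivrMr// mul1r.
  by rewrite (le_trans (u1 a))// lerDl exh_ge0.
- by move=> a; rewrite pmulr_lgt0 ?invr_gt0.
Qed.

End cozero.

(** * Regularity of finite Borel measures *)

(** Take min(1, u / e), where u is positive exactly on U and e > 0 is a lower bound of u on K. *)
Lemma c0_urysohn (R : realType) (A : topologicalType) (h : exhaustion R A)
    (K U : set A) :
  hausdorff_space A -> locally_compact [set: A] -> @second_countable A ->
  compact K -> open U -> K `<=` U ->
  exists g : A -> R, [/\ c0_fun h g, forall a, 0 <= g a <= 1,
    forall a, K a -> g a = 1 & forall a, ~ U a -> g a = 0].
Proof.
move=> hA lA sA cK oU KU.
have [u [cu u01 upos]] := open_cozero h hA lA sA oU.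
have u0 a : 0 <= u a by have /andP[] := u01 a.
have [|e e0 Ke] := compact_positive_lower_bound cK (c0_cont cu).
  by move=> a /KU /upos.
exists (cst 1 \min (e^-1 \*o u)); split.
- apply: c0_min => [|//||a]; [exact: cst_continuous|exact: c0_Z|].
  by rewrite /= mulr_ge0// invr_ge0 ltW.
- by move=> a /=; rewrite le_min ler01 ge_min lexx /= andbT mulr_ge0// invr_ge0 ltW.
- by move=> a /Ke ea /=; apply/min_idPl; rewrite -ler_pdivrMl ?invr_gt0// invrK mulr1.
- move=> a nUa /=; have /eqP -> : u a == 0.
    by rewrite eq_le u0 andbT leNgt; apply/negP => /upos.
  by rewrite mulr0; apply/min_idPr.
Qed.

Lemma nondecreasing_measure_setD d (T : measurableType d) (R : realType)
    (m : {finite_measure set T -> \bar R}) (F : nat -> set T) (e : R) :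
  0 < e -> (forall n, measurable (F n)) -> nondecreasing_seq F ->
  exists n, (m (\bigcup_n F n `\` F n) <= e%:E)%E.
Proof.
move=> e0 mF ndF.
have mU : measurable (\bigcup_n F n) by exact: bigcup_measurable.
have D0 : \bigcap_n (\bigcup_n F n `\` F n) = set0.
  apply/seteqP; split => // a aF; have [[n _ Fna] _] := aF 0%N I.
  by have [_] := aF n I.
have : m (\bigcup_n F n `\` F k) @[k --> \oo] --> m set0.
  rewrite -D0; apply: nonincreasing_cvg_mu => //.
  - by rewrite ltey_eq fin_num_measure//; exact: measurableD.
  - by move=> n; exact: measurableD.
  - by rewrite D0.
  - by move=> n k nk; apply/subsetPset; apply: setDS; exact/subsetPset/ndF.
rewrite measure0 => /fine_cvgP[[N _ fN]] /cvgrPdist_le/(_ _ e0)[k _ ke].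
exists (maxn N k); rewrite -[leLHS]fineK ?lee_fin; last exact/fN/leq_maxl.
have := ke (maxn N k) (leq_maxr _ _).
by rewrite /= sub0r normrN; apply: le_trans; exact: ler_norm.
Qed.

Section regularity.
Context (R : realType) (A : ptopologicalType) (h : exhaustion R A).
Hypotheses (A_hausdorff : hausdorff_space A)
  (A_locally_compact : locally_compact [set: A])
  (A_second_countable : @second_countable A).

Lemma open_Borel (U : set A) : open U -> @measurable _ (Borel A) U.
Proof. exact: sub_sigma_algebra. Qed.

Lemma closed_Borel (C : set A) : closed C -> @measurable _ (Borel A) C.
Proof.
by move=> cC; rewrite -[C]setCK; apply: measurableC; apply: open_Borel; exact: closed_openC.
Qed.

Lemma c0_integrable (m : {finite_measure set (Borel A) -> \bar R}) (g : Borel A -> R) :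
  c0_fun h g -> m.-integrable setT (EFin \o g).
Proof.
move=> cg; have [M _ gM] := c0_bounded cg; apply: (@bounded_integrable _ (Borel A) R m g M _ gM).
exact: (continuous_Borel_measurable (c0_cont cg)).
Qed.

Section finite_measure.
Variable m : {finite_measure set (Borel A) -> \bar R}.

(** Inner approximation by closed instead of compact sets makes the class stable under complements.
    Compactness is recovered at the end by intersecting with {h <= n}. *)
Let regular_set (B : set A) := forall e : R, 0 < e -> exists C U : set A,
  [/\ closed C, open U, C `<=` B, B `<=` U & (m (U `\` C) <= e%:E)%E].

(** For u positive exactly on U, the closed sets {u >= 1/(n+1)} increase to U. *)
Let open_regular U : open U -> regular_set U.
Proof.
move=> oU e e0.
have [u [cu u01 uU]] :=
  open_cozero h A_hausdorff A_locally_compact A_second_countable oU.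
pose F n : set (Borel A) := [set a | n.+1%:R^-1 <= u a].
have clF n : @closed A (F n).
  have /continuous_closedP ucl := c0_cont cu.
  exact: (ucl _ (@closed_ge R n.+1%:R^-1)).
have FU n : F n `<=` U.
  by move=> a Fa; apply/uU; apply: lt_le_trans Fa; rewrite invr_gt0.
have UF : \bigcup_n F n = U.
  apply/seteqP; split=> [a [n _ /FU]//|a /uU ua].
  exists (Num.truncn (u a)^-1) => //; rewrite /F/=.
  rewrite -[leRHS]invrK lef_pV2 ?posrE ?invr_gt0//.
  by rewrite ltW// truncnS_gt.
have [|n k /= nk|n] := @nondecreasing_measure_setD _ _ _ m F e e0.
- by move=> n; exact: closed_Borel.
- apply/subsetPset => a; apply: le_trans.
  by rewrite lef_pV2 ?posrE// ler_nat.
- by rewrite UF => UFe; exists (F n), U; split.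
Qed.

Let regular_sigma_algebra : sigma_algebra setT regular_set.
Proof.
split.
- by apply: open_regular; exact: open0.
- move=> B rB e e0; have [C [U [cC oU CB BU mUC]]] := rB e e0.
  exists (~` U), (~` C); split.
  + exact: open_closedC.
  + exact: closed_openC.
  + by rewrite setTD; exact: subsetC.
  + by rewrite setTD; exact: subsetC.
  + by rewrite setDE setCK setIC -setDE.
- move=> F rF e e0.
  (* Half of e pays for cutting the union of the closed sets down to a finite one, which is closed;
     the other half is spread geometrically over the approximations of the F n. *)
  have e20 : 0 < e / 2 by rewrite divr_gt0.
  have en0 n : 0 < e / 2 / (2 ^ n.+1)%:R by rewrite divr_gt0// ltr0n expn_gt0.
  have /(@choice _ _ (fun n CU => [/\ closed CU.1, open CU.2, CU.1 `<=` F n,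
      F n `<=` CU.2 & (m (CU.2 `\` CU.1) <= (e / 2 / (2 ^ n.+1)%:R)%:E)%E]))[CU CUP] :
      forall n, exists CU : set A * set A, [/\ closed CU.1, open CU.2, CU.1 `<=` F n,
      F n `<=` CU.2 & (m (CU.2 `\` CU.1) <= (e / 2 / (2 ^ n.+1)%:R)%:E)%E].
    by move=> n; have [C [U ?]] := rF n _ (en0 n); exists (C, U).
  pose C n := (CU n).1; pose U n := (CU n).2.
  have clC n : closed (C n) by have [] := CUP n.
  have oU n : open (U n) by have [] := CUP n.
  pose D n : set (Borel A) := \big[setU/set0]_(i < n) C i.
  have clD n : @closed A (D n) by apply: closed_bigsetU.
  have [|//|N mN] := @nondecreasing_measure_setD _ _ _ m D _ e20.
  + by move=> n; exact: closed_Borel.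
  + by move=> n k nk; apply/subsetPset; exact: subset_bigsetU.
  exists (D N), (\bigcup_n U n); split => //.
  + exact: bigcup_open.
  + by move=> a; rewrite /D -bigcup_mkord => -[n _ Cna]; exists n => //;
      have [_ _ + _ _] := CUP n; apply.
  + by move=> a [n _ Fna]; exists n => //; have [_ _ _ + _] := CUP n; apply.
  rewrite [e]splitr EFinD.
  have mD n : measurable (D n) by exact: closed_Borel.
  have mC n : @measurable _ (Borel A) (C n) by exact: closed_Borel.
  have mU n : @measurable _ (Borel A) (U n) by exact: open_Borel.
  have mUC n : @measurable _ (Borel A) (U n `\` C n) by exact: measurableD.
  have mDD : measurable (\bigcup_n D n `\` D N).
    by apply: measurableD => //; exact: bigcup_measurable.
  apply: (@le_trans _ _ (m ((\bigcup_n (U n `\` C n)) `|` (\bigcup_n D n `\` D N)))).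
    apply: le_measure; rewrite ?inE.
    + by apply: measurableD => //; exact: bigcup_measurable.
    + by apply: measurableU => //; exact: bigcup_measurable.
    + move=> a [[n _ Una] nDN]; have [Cna|nCna] := pselect (C n a); last by left; exists n.
      right; split => //; exists n.+1 => //.
      by rewrite /D -bigcup_mkord; exists n => //=.
  apply: (le_trans (measureU2 _ _ _)) => //; first exact: bigcup_measurable.
  apply: leeD => //.
  apply: le_trans (epsilon_trick0 xpredT (ltW e20)).
  apply: (@le_trans _ _ (\sum_(n <oo) m (U n `\` C n))%E).
    by apply: measure_sigma_subadditive => //; exact: bigcup_measurable.
  by apply: lee_nneseries => // n _; have [_ _ _ _] := CUP n.
Qed.

Let measurable_regular (B : set (Borel A)) : measurable B -> regular_set B.
Proof. by apply: smallest_sub => //; exact: open_regular. Qed.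

Lemma finite_measure_regular : regular_measure m.
Proof.
move=> B mB; split; apply/eqP; rewrite eq_le; apply/andP; split.
- apply: le_ereal_inf_tmp => _ [U [oU BU] <-].
  by apply: le_measure => //; rewrite inE//; exact: open_Borel.
- apply/lee_addgt0Pr => e /(measurable_regular mB)[C [U [cC oU CB BU mUC]]].
  have mU := open_Borel oU; have mC := closed_Borel cC.
  apply: (@le_trans _ _ (m U)); first by apply: ereal_inf_lbound; exists U.
  rewrite (measureDI m mU mB) addeC leeD//.
    by apply: le_measure => //; rewrite ?inE//; exact: measurableI.
  apply: le_trans mUC; apply: le_measure; rewrite ?inE.
  + exact: measurableD.
  + exact: measurableD.
  + exact: setDS.
- apply/lee_addgt0Pr => e e0; have e20 : 0 < e / 2 by rewrite divr_gt0.
  have [C [U [cC oU CB BU mUC]]] := measurable_regular mB e20.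
  have mU := open_Borel oU; have mC := closed_Borel cC.
  (* These compact pieces of C increase to C, so one of them carries all but e / 2 of its mass. *)
  pose F n : set (Borel A) := C `&` h @^-1` `[0, n%:R].
  have cF n : @compact A (F n).
    by rewrite /F setIC; apply: compact_closedI => //; exact: exh_proper.
  have mF n : measurable (F n) by apply: closed_Borel; exact: compact_closed.
  have UF : \bigcup_n F n = C.
    rewrite -setI_bigcupr; apply/setIidPl => a _.
    exists (Num.truncn (h a)).+1 => //=.
    by rewrite in_itv/= exh_ge0/= ltW// truncnS_gt.
  have [n k nk|n] := nondecreasing_measure_setD m e20 mF.
    apply/subsetPset; apply: setIS => a /=; rewrite !in_itv/= => /andP[->/=].
    by move=> /le_trans; apply; rewrite ler_nat.
  rewrite UF => mCF.
  apply: (@le_trans _ _ (m (F n) + e%:E)%E); last first.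
    rewrite leeD2r//; apply: ereal_sup_ubound; exists (F n) => //.
    by split => // a [/CB].
  apply: (@le_trans _ _ (m (F n `|` ((C `\` F n) `|` (U `\` C))))).
    apply: le_measure; rewrite ?inE//.
      by apply: measurableU => //; apply: measurableU; exact: measurableD.
    move=> a Ba; have [Fa|nFa] := pselect (F n a); first by left.
    by right; have [Ca|nCa] := pselect (C a); [left|right; split => //; exact: BU].
  apply: (le_trans (measureU2 _ _ _)) => //.
    by apply: measurableU; exact: measurableD.
  rewrite leeD2l// [e]splitr EFinD (le_trans (measureU2 _ _ _))//.
  + exact: measurableD.
  + exact: measurableD.
  + exact: leeD.
- apply: ge_ereal_sup => _ [K [cK KB] <-].
  have mK : @measurable _ (Borel A) K by apply: closed_Borel; exact: compact_closed.
  by apply: le_measure => //; rewrite inE.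
Qed.

End finite_measure.

Lemma charge_regular (nu : {charge set (Borel A) -> \bar R}) :
  regular_measure (total_variation nu).
Proof.
have tfin : fin_num_fun (total_variation nu).
  by move=> B mB; rewrite ge0_fin_numE// total_variation_fin.
pose m : {finite_measure set (Borel A) -> \bar R} :=
  HB.pack (total_variation nu : set (Borel A) -> \bar R)
    (Measure.class (total_variation nu)) (Measure_isFinite.Build _ _ _ _ tfin).
exact: (finite_measure_regular m).
Qed.

(** Regularity is automatic, and [crestr0] resets the charge to 0 off the Borel sets, as
    [sm_nonborel] demands. *)
Lemma charge_signed_measure (nu : {charge set (Borel A) -> \bar R}) :
  exists sigma : signed_measure R A,
    forall B : set (Borel A), measurable B -> sigma B = nu B.
Proof.
pose nu0 : {charge set (Borel A) -> \bar R} := crestr0 nu measurableT.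
have nb (B : set (Borel A)) : ~ measurable B -> nu0 B = 0%E.
  by move=> mB; rewrite /nu0 /= /crestr0 memNset.
exists (SignedMeasure (@charge_regular nu0) nb) => B mB.
by rewrite /= /crestr0 mem_set//= /crestr setIT.
Qed.

End regularity.

(** * The Riesz representation theorem for positive functionals *)

Section riesz_positive.
Context (R : realType) (A : ptopologicalType) (h : exhaustion R A).
Hypotheses (A_hausdorff : hausdorff_space A)
  (A_locally_compact : locally_compact [set: A])
  (A_second_countable : @second_countable A).
Implicit Types (f g k u : A -> R) (U V X : set A).

(** Positive functionals are studied on nonnegative functions only, since the positive part of a
    signed functional is defined by a supremum that is additive just there. *)
Definition c0_cone g := c0_fun h g /\ forall a, 0 <= g a.

Lemma cone0 : c0_cone (fun=> 0). Proof. by split => //; exact: c0_0. Qed.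

Lemma coneD f g : c0_cone f -> c0_cone g -> c0_cone (f \+ g).
Proof. by move=> [cf f0] [cg g0]; split=> [|a]; [exact: c0_D|exact: addr_ge0]. Qed.

Lemma coneZ (r : R) g : 0 <= r -> c0_cone g -> c0_cone (r \*o g).
Proof. by move=> r0 [cg g0]; split=> [|a]; [exact: c0_Z|exact: mulr_ge0]. Qed.

Lemma cone_sum n (f : 'I_n -> A -> R) : (forall i, c0_cone (f i)) ->
  c0_cone (fun a => \sum_(i < n) f i a).
Proof.
move=> cf; split=> [|a]; first by apply: c0_sum => i; have [] := cf i.
by apply: sumr_ge0 => i _; have [] := cf i.
Qed.

Lemma cone_min_cst g (r : R) : 0 <= r -> c0_cone g -> c0_cone (cst r \min g).
Proof.
move=> r0 [cg g0]; split=> [|a]; last by rewrite /= le_min r0 g0.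
by apply: c0_min => //; exact: cst_continuous.
Qed.

Lemma cone_trunc g (r : R) : 0 <= r -> c0_cone g ->
  c0_cone (fun a => Num.max (g a - r) 0).
Proof.
move=> r0 [cg g0]; split=> [|a]; last by rewrite le_max lexx orbT.
apply: (@c0_dominated _ _ _ _ g 1) => //.
  move=> a; apply: (@continuous_max _ _ (fun a => g a - r) (cst 0)); last exact: cst_continuous.
  by apply: cvgB; [exact: (c0_cont cg)|exact: cvg_cst].
move=> a; rewrite mul1r !ger0_norm ?g0 ?le_max ?lexx ?orbT//.
by rewrite ge_max g0 andbT lerBlDr lerDl.
Qed.

Lemma additive_cone_sum (I : (A -> R) -> R) n (f : 'I_n -> A -> R) :
  (forall f g, c0_cone f -> c0_cone g -> I (f \+ g) = I f + I g) ->
  (forall i, c0_cone (f i)) ->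
  I (fun a => \sum_(i < n) f i a) = \sum_(i < n) I (f i).
Proof.
move=> ID; elim: n f => [|n IH] f cf.
  rewrite big_ord0 (_ : (fun _ => _) = fun=> 0); last first.
    by apply/funext => a; rewrite big_ord0.
  have := ID _ _ cone0 cone0.
  rewrite (_ : (fun=> 0) \+ (fun=> 0) = fun=> 0 :> R); last first.
    by apply/funext => a; rewrite /= addr0.
  by move=> /eqP; rewrite -subr_eq0 opprD addNKr oppr_eq0 => /eqP.
rewrite big_ord_recl -IH// -ID//.
  by congr I; apply/funext => a; rewrite big_ord_recl.
exact: cone_sum.
Qed.

(** Layer-cake decomposition: the part of g between the heights i e and (i+1) e. *)
Definition slice (e : R) (g : A -> R) (i : nat) : A -> R :=
  cst e \min (fun a => Num.max (g a - i%:R * e) 0).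

Lemma cone_slice e g i : 0 < e -> c0_cone g -> c0_cone (slice e g i).
Proof.
move=> e0 cg; apply: cone_min_cst; first exact: ltW.
by apply: cone_trunc => //; rewrite mulr_ge0// ltW.
Qed.

Lemma slice_sum e g n a : 0 < e -> 0 <= g a -> g a <= n%:R * e ->
  \sum_(i < n) slice e g i a = g a.
Proof.
move=> e0 ga0 gan; have -> : \sum_(i < n) slice e g i a = Num.min (g a) (n%:R * e).
  elim: n {gan} => [|n IH].
    by rewrite big_ord0 mul0r; apply/esym/min_idPr.
  rewrite big_ord_recr /= IH -[in RHS]natr1 mulrDl mul1r.
  rewrite /slice /=; move: (n%:R * e) => z.
  by rewrite !minElt !maxElt; do ?case: ifPn; rewrite -?leNgt; lra.
exact/min_idPl.
Qed.

(* Both a positive functional and integration map the i-th slice of g to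
   between e times the measures of {g > (i+1) e} and {g > i e}; summing over i
   shows that they differ by at most e times the total mass. *)
Lemma slice_comparison (I J : (A -> R) -> R) (om : set A -> R) (C : R) g :
  (forall f g, c0_cone f -> c0_cone g -> I (f \+ g) = I f + I g) ->
  (forall f g, c0_cone f -> c0_cone g -> J (f \+ g) = J f + J g) ->
  c0_cone g -> (forall U, 0 <= om U <= C) ->
  (forall e i, 0 < e -> I (slice e g i) <= e * om [set a | i%:R * e < g a]) ->
  (forall e i, 0 < e -> e * om [set a | i.+1%:R * e < g a] <= J (slice e g i)) ->
  I g <= J g.
Proof.
move=> ID JD cg omC Ile Jge; have [cg0 g0] := cg.
have C0 : 0 <= C by have /andP[/le_trans] := omC setT; apply.
apply/ler_addgt0Pr => e' e'0.
(* The total error will be at most e C; the added 1 keeps the divisor positive when C = 0. *)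
pose e := e' / (C + 1); have e0 : 0 < e by rewrite divr_gt0// ltr_wpDl.
have [M M0 gM] := c0_bounded cg0.
pose n := (Num.truncn (M / e)).+1.
have gn a : g a <= n%:R * e.
  rewrite (le_trans (ler_norm _))// (le_trans (gM a))// -ler_pdivrMr//.
  by rewrite ltW// truncnS_gt.
have gE : (fun a => \sum_(i < n) slice e g i a) = g.
  by apply/funext => a; exact: slice_sum.
have cs (i : 'I_n) : c0_cone (slice e g i) by exact: cone_slice.
rewrite -[in leLHS]gE -[in leRHS]gE !additive_cone_sum//.
pose o i := e * om [set a | i%:R * e < g a].
apply: (@le_trans _ _ (\sum_(i < n) o i)); first by apply: ler_sum => i _; exact: Ile.
apply: (@le_trans _ _ (\sum_(i < n) o i.+1 + e')); last first.
  by rewrite lerD2r; apply: ler_sum => i _; exact: Jge.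
(* The two sums differ by a shift of the index, so their difference telescopes to o 0 - o n. *)
rewrite -lerBlDl -sumrB -(big_mkord xpredT (fun i => o i - o i.+1)).
have -> : \sum_(0 <= i < n) (o i - o i.+1) = o 0%N - o n.
  rewrite -[RHS]opprB -telescope_sumr// -sumrN.
  by apply: eq_bigr => i _; rewrite opprB.
rewrite (@le_trans _ _ (o 0%N))//.
  by rewrite gerBl mulr_ge0 ?(ltW e0)//; have /andP[] := omC [set a | n%:R * e < g a].
rewrite (@le_trans _ _ (e * C))//.
  by rewrite ler_pM2l//; have /andP[] := omC [set a | 0%:R * e < g a].
by rewrite /e mulrAC ler_pdivrMr ?ltr_wpDl// ler_pM2l// lerDl.
Qed.

Variables (P : (A -> R) -> R) (C : R).
Hypotheses (PD : forall f g, c0_cone f -> c0_cone g -> P (f \+ g) = P f + P g)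
  (PZ : forall r g, 0 <= r -> c0_cone g -> P (r \*o g) = r * P g)
  (P0 : forall g, c0_cone g -> 0 <= P g)
  (PC : forall g s, c0_cone g -> (forall a, g a <= s) -> P g <= C * s).

Let P_le f g : c0_cone f -> c0_cone g -> (forall a, f a <= g a) -> P f <= P g.
Proof.
move=> [cf f0] [cg g0] fg; have cgf : c0_cone (fun a => g a - f a).
  by split=> [|a]; [exact: c0_sub|rewrite subr_ge0].
have -> : g = f \+ (fun a => g a - f a) by apply/funext => a /=; rewrite addrC subrK.
by rewrite PD// lerDl P0.
Qed.

Let C0 : 0 <= C.
Proof.
have := PC cone0 (s := 1) (fun=> ler01); rewrite mulr1; apply: le_trans.
by apply: P0; exact: cone0.
Qed.

(** The part cut off is min(e, g), bounded by e. What remains is positive only inside {g >= e}, a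
    compact set. *)
Let P_trunc g (e : R) : 0 <= e -> c0_cone g ->
  P g <= P (fun a => Num.max (g a - e) 0) + C * e.
Proof.
move=> e0 cg; have [_ g0] := cg.
have {1}-> : g = (fun a => Num.max (g a - e) 0) \+ (cst e \min g).
  by apply/funext => a /=; rewrite minElt maxElt; do ?case: ifPn; rewrite -?leNgt; lra.
rewrite PD ?lerD2l; [|exact: cone_trunc|exact: cone_min_cst].
by apply: PC; [exact: cone_min_cst|move=> a; rewrite /= ge_min lexx].
Qed.

(** Competitors need not have compact support in U; where such a margin is wanted, [P_trunc]
    provides it. *)
Let sub U g := [/\ c0_cone g, forall a, g a <= 1 & forall a, ~ U a -> g a = 0].

Let om U : \bar R := ereal_sup [set (P g)%:E | g in sub U].

Let om_ge0 U : (0 <= om U)%E.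
Proof.
apply: (@le_trans _ _ (P (fun=> 0))%:E); first by rewrite lee_fin; apply/P0/cone0.
by apply: ereal_sup_ubound; exists (fun=> 0) => //; split => //; exact: cone0.
Qed.

Let om_leC U : (om U <= C%:E)%E.
Proof.
apply: ge_ereal_sup => _ [g [cg g1 _] <-]; rewrite lee_fin.
by have := PC cg g1; rewrite mulr1.
Qed.

Let om_le U V : U `<=` V -> (om U <= om V)%E.
Proof.
move=> UV; apply: le_ereal_sup => _ [g [cg g1 gU] <-].
by exists g => //; split => // a nVa; apply: gU => /UV.
Qed.

Let om0 : om set0 = 0%E.
Proof.
apply/eqP; rewrite eq_le om_ge0 andbT; apply: ge_ereal_sup => _ [g [cg g1 g0] <-].
have -> : g = 0 \*o g by apply/funext => a; rewrite /= g0// mulr0.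
by rewrite PZ// mul0r.
Qed.

(** For g <= 1 vanishing off the union, the compact set {g >= e} lies in the union. Functions w_i in
    [sub] (U_i), finitely many, are built with sum at least 1 on that set; they dominate (g - e)^+,
    and additivity of P concludes. *)
Let om_sigma_subadditive (U : nat -> set A) : (forall n, open (U n)) ->
  (om (\bigcup_n U n) <= \sum_(n <oo) om (U n))%E.
Proof.
move=> oU; apply: ge_ereal_sup => _ [g [cg g1 gU] <-].
apply/lee_addgt0Pr => e' e'0.
pose e := e' / (C + 1); have e0 : 0 < e by rewrite divr_gt0// ltr_wpDl.
have Ce : C * e <= e'.
  by rewrite /e mulrCA -ler_pdivlMl// mulVf ?gt_eqF// ler_pdivrMr ?ltr_wpDl// mul1r lerDl.
have [cg0 g0] := cg.
have /choice[u uP] : forall n, exists u : A -> R,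
    [/\ c0_fun h u, forall a, 0 <= u a <= 1 & forall a, 0 < u a <-> U n a].
  by move=> n; exact: open_cozero.
have cu n : c0_fun h (u n) by have [] := uP n.
have u0 n a : 0 <= u n a by have [_ /(_ a)/andP[]] := uP n.
have [v [cv v01 vle vpos]] := dyadic_series_continuous
  (fun n => c0_cont (cu n)) (fun n => let: And3 _ w _ := uP n in w).
have [|d d0 Kd] := compact_positive_lower_bound (c0_superlevel_compact cg0 e0) cv.
  move=> a /= ega; apply/vpos; apply: contrapT => nU.
  have : ~ (\bigcup_n U n) a.
    by move=> [n _ Una]; apply: nU; exists n; have [_ _ ->] := uP n.
  by move=> /gU ga0; move: ega; rewrite ga0 leNgt e0.
(* The tail of the series after n is at most d / 2, so on {g >= e}, where v >= d, the first n
   functions u i still add up to at least d / 2. *)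
have [n nd] : exists n, 2^-1 ^+ n <= d / 2 :> R.
  exact: half_expr_le (divr_gt0 d0 (ltr0n _ 2)).
pose w i := cst 1 \min ((d / 2)^-1 \*o u i).
have w0 i a : 0 <= w i a.
  by rewrite /w /= le_min ler01 mulr_ge0// invr_ge0 divr_ge0// ltW.
have cw i : c0_cone (w i).
  apply: cone_min_cst => //; apply: coneZ; last by split.
  by rewrite invr_ge0 divr_ge0// ltW.
have wU i : sub (U i) (w i).
  split => // [a|a nUa]; first by rewrite /w /= ge_min lexx.
  have -> : w i a = Num.min 1 ((d / 2)^-1 * u i a) by [].
  rewrite (_ : u i a = 0) ?mulr0; first exact/min_idPr.
  by apply/eqP; rewrite eq_le u0 andbT leNgt; apply/negP; have [_ _ ->] := uP i.
rewrite (@le_trans _ _ ((P (fun a => Num.max (g a - e) 0))%:E + e'%:E)%E)//.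
  by rewrite -EFinD lee_fin (le_trans (P_trunc (ltW e0) cg))// lerD2l.
rewrite leeD2r// (@le_trans _ _ (\sum_(i < n) om (U i))%E)//; last first.
  rewrite -(big_mkord xpredT (fun i => om (U i))).
  by apply: nneseries_lim_ge => // i _; exact: om_ge0.
rewrite (@le_trans _ _ (\sum_(i < n) P (w i))%:E)//; last first.
  rewrite -sumEFin; apply: lee_sum => i _.
  by apply: ereal_sup_ubound; exists (w i).
rewrite lee_fin -(additive_cone_sum PD)//.
apply: P_le; [exact: cone_trunc (ltW e0) cg|exact: cone_sum|] => a.
rewrite ge_max [X in _ && X]sumr_ge0 ?andbT//.
have [ega|gae] := leP e (g a); last first.
  by rewrite (@le_trans _ _ 0)// ?sumr_ge0// subr_le0 ltW.
rewrite (@le_trans _ _ 1)// ?lerBlDr ?(le_trans (g1 a))// ?lerDl ?(ltW e0)//.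
(* Truncating every summand at 1 keeps the sum at least 1 where it was at least 1. *)
have min_sum N (x : 'I_N -> R) : (forall i, 0 <= x i) ->
    Num.min 1 (\sum_(i < N) x i) <= \sum_(i < N) Num.min 1 (x i).
  elim: N x => [|N IH] x x0; first by rewrite !big_ord0 ge_min lexx orbT.
  rewrite !big_ord_recl; have := IH _ (fun i => x0 (lift ord0 i)); move: (x0 ord0).
  have : 0 <= \sum_(i < N) x (lift ord0 i) by apply: sumr_ge0.
  move: (\sum_(i < N) x (lift ord0 i)) (x ord0) => p r.
  move: (\sum_(i < N) Num.min 1 (x (lift ord0 i))) => q.
  by rewrite !minElt; do ?case: ifPn; rewrite -?leNgt; lra.
apply: (@le_trans _ _ (Num.min 1 (\sum_(i < n) (d / 2)^-1 * u i a))); last first.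
  by apply: min_sum => i; rewrite mulr_ge0// invr_ge0 divr_ge0// ltW.
rewrite le_min lexx -mulr_sumr mulrC ler_pdivlMr ?divr_gt0// mul1r/=.
have := Kd a ega; have := vle n a; lra.
Qed.

Let mu X : \bar R := ereal_inf [set om U | U in [set U | open U /\ X `<=` U]].

Let mu_open U : open U -> mu U = om U.
Proof.
move=> oU; apply/eqP; rewrite eq_le; apply/andP; split.
  by apply: ereal_inf_lbound; exists U => //; split.
by apply: le_ereal_inf_tmp => _ [V [oV UV] <-]; exact: om_le.
Qed.

Let mu_ge0 X : (0 <= mu X)%E.
Proof. by apply: le_ereal_inf_tmp => _ [V _ <-]. Qed.

Let mu0 : mu set0 = 0%E.
Proof. by rewrite mu_open ?om0//; exact: open0. Qed.

Let le_mu : {homo mu : X Y / X `<=` Y >-> (X <= Y)%E}.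
Proof.
move=> X Y XY; apply: le_ereal_inf => _ [V [oV YV] <-].
by exists V => //; split => //; exact: subset_trans YV.
Qed.

Let mu_leC X : (mu X <= C%:E)%E.
Proof.
apply: le_trans (om_leC setT); apply: ereal_inf_lbound.
by exists setT => //; split => //; exact: openT.
Qed.

Let mu_fin X : mu X \is a fin_num.
Proof. by rewrite ge0_fin_numE// (le_lt_trans (mu_leC X))// ltry. Qed.

Let mu_adherent X e : 0 < e -> exists U, [/\ open U, X `<=` U & (om U <= mu X + e%:E)%E].
Proof.
move=> e0; have : (mu X < mu X + e%:E)%E by rewrite lteDl// mu_fin.
by move=> /ereal_inf_lt[_ [U [oU XU] <-] /ltW ?]; exists U.
Qed.

Let mu_sigma_subadditive : sigma_subadditive mu.
Proof.
move=> F; apply/lee_addgt0Pr => e e0.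
have en0 n : 0 < e / (2 ^ n.+1)%:R by rewrite divr_gt0// ltr0n expn_gt0.
have /choice[U UP] n := mu_adherent (F n) (en0 n).
apply: (@le_trans _ _ (\sum_(n <oo) om (U n))%E).
  apply: le_trans (om_sigma_subadditive _) => [|n]; last by have [] := UP n.
  rewrite -mu_open; last by apply: bigcup_open => n _; have [] := UP n.
  by apply: le_mu => a [n _ Fna]; exists n => //; have [_ + _] := UP n; apply.
apply: le_trans (epsilon_trick xpredT _ (ltW e0)); last by move=> n; exact: mu_ge0.
by apply: lee_nneseries => // n _; have [] := UP n.
Qed.

Let mu_outer : {outer_measure set A -> \bar R} :=
  HB.pack mu (isOuterMeasure.Build R A mu mu0 mu_ge0 le_mu mu_sigma_subadditive).

(** Let g compete for V meet U and set K = {g >= e}, a closed subset of U. A competitor k for V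
    minus K vanishes on K, while (g - e)^+ vanishes off K, so their sum competes for V. Additivity
    of P then yields the Caratheodory inequality up to C e. *)
Let open_caratheodory U : open U -> mu_outer.-caratheodory U.
Proof.
move=> oU; apply: le_caratheodory_measurable => X.
change (mu (X `&` U) + mu (X `&` ~` U) <= mu X)%E.
apply: le_ereal_inf_tmp => _ [V [oV XV] <-].
apply: (@le_trans _ _ (om (V `&` U) + mu (V `&` ~` U))%E).
  apply: leeD; last by apply: le_mu; exact: setSI.
  by rewrite -mu_open; [apply: le_mu; exact: setSI|exact: openI].
rewrite -leeBrDr ?mu_fin//; apply: ge_ereal_sup => _ [g [cg g1 gVU] <-].
apply/lee_addgt0Pr => e' e'0.
pose e := e' / (C + 1); have e0 : 0 < e by rewrite divr_gt0// ltr_wpDl.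
have Ce : C * e <= e'.
  by rewrite /e mulrCA -ler_pdivlMl// mulVf ?gt_eqF// ler_pdivrMr ?ltr_wpDl// mul1r lerDl.
pose g' a := Num.max (g a - e) 0.
have cg' : c0_cone g' by apply: cone_trunc => //; exact: ltW.
pose K := [set a | e <= g a].
have oVK : open (V `\` K).
  rewrite setDE; apply: openI => //; apply: closed_openC.
  have /continuous_closedP gcl := c0_cont cg.1.
  exact: (gcl _ (@closed_ge R e)).
have KU : K `<=` U.
  move=> a /= ega; apply: contrapT => nUa; move: ega.
  by rewrite /K /= gVU ?leNgt ?e0// => -[].
suff : ((P g')%:E + mu (V `&` ~` U) <= om V)%E.
  rewrite -leeBrDr ?mu_fin// => Pg'.
  rewrite (@le_trans _ _ ((P g')%:E + e'%:E)%E)//; last exact: leeD2r.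
  by rewrite -EFinD lee_fin (le_trans (P_trunc (ltW e0) cg))// lerD2l.
apply: (@le_trans _ _ ((P g')%:E + om (V `\` K))%E).
  rewrite leeD2l// -mu_open//; apply: le_mu.
  by rewrite -setDE; exact: setDS.
rewrite addeC -leeBrDr//; apply: ge_ereal_sup => _ [k [ck k1 kVK] <-].
rewrite leeBrDr// -EFinD -PD//; apply: ereal_sup_ubound.
exists (k \+ g') => //; split => [||a nVa].
- exact: coneD.
- move=> a /=; have [Ka|nKa] := pselect (K a).
    rewrite kVK ?add0r; last by move=> [].
    by rewrite /g' ge_max ler01 andbT lerBlDr (le_trans (g1 a))// lerDl ltW.
  rewrite (_ : g' a = 0) ?addr0//; apply/max_idPr.
  by rewrite subr_le0 ltW// ltNge; apply/negP.
- rewrite /= kVK; last by move=> [].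
  rewrite add0r; apply/max_idPr; rewrite gVU ?sub0r ?oppr_le0 ?(ltW e0)//.
  by move=> [].
Qed.

Let measurable_caratheodory (B : set (Borel A)) : measurable B ->
  @measurable _ (caratheodory_type mu_outer) B.
Proof.
apply: smallest_sub; last by move=> U oU; exact: open_caratheodory.
split; first exact: measurable0.
- by move=> X mX; rewrite setTD; exact: measurableC.
- by move=> F mF; exact: bigcup_measurable.
Qed.

Let m (B : set (Borel A)) : \bar R := mu B.

Let m_sigma_additive : semi_sigma_additive m.
Proof.
move=> F mF tF mUF.
exact: (@caratheodory_measure_sigma_additive R A mu_outer F
  (fun n => measurable_caratheodory (mF n)) tF (measurable_caratheodory mUF)).
Qed.

Let m_fin : fin_num_fun m. Proof. by move=> B _; exact: mu_fin. Qed.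

Theorem riesz_positive : exists nu : {finite_measure set (Borel A) -> \bar R},
  forall g, c0_cone g -> \int[nu]_x g x = P g.
Proof.
pose nu0 : {measure set (Borel A) -> \bar R} :=
  HB.pack m (isMeasure.Build _ _ _ m mu0 mu_ge0 m_sigma_additive).
pose nu : {finite_measure set (Borel A) -> \bar R} :=
  HB.pack m (Measure.class nu0) (Measure_isFinite.Build _ _ _ nu0 m_fin).
exists nu => g cg; pose J f := \int[nu]_x f x.
have ic0 f : c0_fun h f -> nu.-integrable setT (EFin \o (f : Borel A -> R)).
  exact: c0_integrable.
have JD f g' : c0_cone f -> c0_cone g' -> J (f \+ g') = J f + J g'.
  by move=> [cf _] [cg' _]; rewrite /J RintegralD//; exact: ic0.
pose omr U := fine (om U).
have omE U : om U = (omr U)%:E.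
  by rewrite fineK// ge0_fin_numE// (le_lt_trans (om_leC U))// ltry.
have omr_bounds U : 0 <= omr U <= C by rewrite -!lee_fin -omE om_ge0 om_leC.
have nuE U : open U -> nu U = (omr U)%:E by move=> oU; rewrite -omE -mu_open.
have oE (t : R) : open [set a | t < g a].
  have /continuousP gop := c0_cont cg.1.
  exact: (gop _ (@open_gt R t)).
have mE (t : R) : @measurable _ (Borel A) [set a | t < g a] by exact: open_Borel.
have iind (E : set (Borel A)) e : measurable E ->
    \int[nu]_x (e * \1_E x) = e * fine (nu E) /\
    nu.-integrable setT (EFin \o (fun x => e * \1_E x)).
  move=> mE'; have i1 : nu.-integrable setT (EFin \o (\1_E : Borel A -> R)).
    by apply: integrable_indic; rewrite // ?ltey_eq ?fin_num_measure.
  split; last exact: (integrableZl measurableT e i1).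
  by rewrite RintegralZl// /Rintegral integral_indic// setIT.
have slice_le e i a : 0 < e -> slice e g i a <= e * \1_[set a | i%:R * e < g a] a.
  move=> e0; rewrite indicE; case: (boolP (a \in _)) => [_|].
    by rewrite mulr1 /slice /= ge_min lexx.
  move=> /negP; rewrite inE /= => /negP; rewrite -leNgt mulr0 => ga.
  by rewrite /slice /= ge_min ge_max lexx subr_le0 ga orbT.
have slice_ge e i a : 0 < e -> e * \1_[set a | i.+1%:R * e < g a] a <= slice e g i a.
  move=> e0; rewrite indicE; case: (boolP (a \in _)) => [|_].
    rewrite inE /= mulr1 /slice /= le_min lexx /= le_max lerBrDr.
    by rewrite -natr1 mulrDl mul1r addrC => /ltW ->.
  by rewrite mulr0; have [_] := cone_slice i e0 cg; apply.
(* Divided by e, the slice is at most 1 and vanishes off {g > i e}, so it competes in the supremum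
   defining [om]. *)
have Ple e i : 0 < e -> P (slice e g i) <= e * omr [set a | i%:R * e < g a].
  move=> e0; have cs := cone_slice i e0 cg.
  have ei0 : 0 <= e^-1 by rewrite invr_ge0 ltW.
  rewrite -ler_pdivrMl// -PZ// -lee_fin -omE.
  apply: ereal_sup_ubound; exists (e^-1 \*o slice e g i) => //.
  split => [|a|a nE]; first exact: coneZ.
    by rewrite /= mulrC ler_pdivrMr// mul1r /slice /= ge_min lexx.
  rewrite /= (_ : slice e g i a = 0) ?mulr0//; apply/eqP.
  rewrite eq_le (cs.2 a) andbT (le_trans (slice_le _ _ _ e0))//.
  by rewrite indicE memNset// mulr0.
(* Divided by e, the slice equals 1 on {g > (i+1) e}, hence dominates every competitor for that
   set. *)
have Pge e i : 0 < e -> e * omr [set a | i.+1%:R * e < g a] <= P (slice e g i).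
  move=> e0; have cs := cone_slice i e0 cg.
  have ei0 : 0 <= e^-1 by rewrite invr_ge0 ltW.
  rewrite -ler_pdivlMl// -PZ// -lee_fin -omE.
  apply: ge_ereal_sup => _ [k [ck k1 kE] <-]; rewrite lee_fin.
  apply: P_le => // [|a]; first exact: coneZ.
  have [Ea|nEa] := pselect (i.+1%:R * e < g a); last first.
    by rewrite kE// /= mulr_ge0//; have [_] := cs.
  rewrite (le_trans (k1 a))//= mulrC ler_pdivlMr// mul1r.
  by have := slice_ge e i a e0; rewrite indicE mem_set// mulr1.
have Jle e i : 0 < e -> J (slice e g i) <= e * omr [set a | i%:R * e < g a].
  move=> e0; have [ie ii] := iind _ e (mE (i%:R * e)).
  have -> : omr [set a | i%:R * e < g a] = fine (nu [set a | i%:R * e < g a]).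
    by rewrite nuE.
  rewrite -ie; apply: le_Rintegral => // [|a _]; last exact: slice_le.
  by apply: ic0; have [] := cone_slice i e0 cg.
have Jge e i : 0 < e -> e * omr [set a | i.+1%:R * e < g a] <= J (slice e g i).
  move=> e0; have [ie ii] := iind _ e (mE (i.+1%:R * e)).
  have -> : omr [set a | i.+1%:R * e < g a] = fine (nu [set a | i.+1%:R * e < g a]).
    by rewrite nuE.
  rewrite -ie; apply: le_Rintegral => // [|a _]; last exact: slice_ge.
  by apply: ic0; have [] := cone_slice i e0 cg.
(* P and the integral obey the same slice bounds with the same [omr], so the comparison works in
   both directions. *)
apply/eqP; rewrite eq_le (slice_comparison JD PD cg omr_bounds Jle Pge).
exact: (slice_comparison PD JD cg omr_bounds Ple Jge).
Qed.

End riesz_positive.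

(** * The Riesz representation theorem for bounded functionals *)

Section riesz_signed.
Context (R : realType) (A : ptopologicalType) (h : exhaustion R A).
Hypotheses (A_hausdorff : hausdorff_space A)
  (A_locally_compact : locally_compact [set: A])
  (A_second_countable : @second_countable A).
Variables (F : (A -> R) -> R) (C : R).
Hypotheses (FD : forall f g, c0_fun h f -> c0_fun h g -> F (f \+ g) = F f + F g)
  (FZ : forall r g, c0_fun h g -> F (r \*o g) = r * F g)
  (FC : forall g s, c0_fun h g -> (forall a, `|g a| <= s) -> `|F g| <= C * s).
Implicit Types (f g k : A -> R).
Local Notation cone := (c0_cone h).

Let F0 : F (fun=> 0) = 0.
Proof.
rewrite (_ : (fun=> 0) = 0 \*o (fun=> 0 : R)); last first.
  by apply/funext => a; rewrite /= mulr0.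
by rewrite FZ ?mul0r//; exact: c0_0.
Qed.

(* positive part of F on the cone of nonnegative functions *)
Let P g := sup [set F k | k in [set k | cone k /\ forall a, k a <= g a]].

Let hasP g : cone g -> has_sup [set F k | k in [set k | cone k /\ forall a, k a <= g a]].
Proof.
move=> [cg g0]; split.
  by exists (F (fun=> 0)), (fun=> 0) => //; split => //; exact: cone0.
have [M M0 gM] := c0_bounded cg.
exists (C * M) => _ [k [[ck k0] kg] <-].
rewrite (le_trans (ler_norm _))// FC// => a.
by rewrite ger0_norm// (le_trans (kg a))// (le_trans (ler_norm _)).
Qed.

Let P_ge g k : cone g -> cone k -> (forall a, k a <= g a) -> F k <= P g.
Proof. by move=> cg ck kg; apply: sup_upper_bound; [exact: hasP|exists k]. Qed.

Let P_le g r : cone g -> (forall k, cone k -> (forall a, k a <= g a) -> F k <= r) ->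
  P g <= r.
Proof.
by move=> cg kr; apply: ge_sup => [|_ [k [ck kg] <-]]; [case: (hasP cg)|exact: kr].
Qed.

(** Riesz decomposition: any k between 0 and f + g is the sum of min(k, f), which is below f, and a
    remainder between 0 and g. *)
Let PD f g : cone f -> cone g -> P (f \+ g) = P f + P g.
Proof.
move=> cf cg; have cfg := coneD cf cg; apply/eqP; rewrite eq_le; apply/andP; split.
  apply: P_le => // k ck kfg; have [ck0 k0] := ck.
  have ck1 : cone (k \min f).
    split=> [|a]; last by rewrite /= le_min k0; have [_ ->] := cf.
    by apply: c0_min => //; [exact: c0_cont ck0|exact: cf.1|exact: cf.2].
  have ck2 : cone (fun a => k a - (k \min f) a).
    split=> [|a]; first by apply: c0_sub => //; exact: ck1.1.
    by rewrite subr_ge0 /= ge_min lexx.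
  have -> : k = (k \min f) \+ (fun a => k a - (k \min f) a).
    by apply/funext => a /=; rewrite addrC subrK.
  rewrite FD; [|exact: ck1.1|exact: ck2.1].
  apply: lerD; apply: P_ge => // a; first by rewrite /= ge_min lexx orbT.
  have := kfg a; have := cg.2 a => /=.
  by rewrite minElt; case: ifPn; rewrite -?leNgt; lra.
rewrite -lerBrDr; apply: P_le => // k1 ck1 k1f.
rewrite lerBrDr -lerBrDl; apply: P_le => // k2 ck2 k2g.
rewrite lerBrDl -FD; [|exact: ck1.1|exact: ck2.1].
by apply: P_ge => // [|a]; [exact: coneD|exact: lerD].
Qed.

Let PZ r g : 0 <= r -> cone g -> P (r \*o g) = r * P g.
Proof.
(* Applied to a factor and to its inverse, this inequality becomes an equality. *)
have le_PZ s f : 0 < s -> cone f -> P (s \*o f) <= s * P f.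
  move=> s0 cf; have si0 : 0 <= s^-1 by rewrite invr_ge0 ltW.
  apply: P_le => [|k ck ksf]; first by apply: coneZ; rewrite // ltW.
  rewrite -ler_pdivrMl// -FZ; last exact: ck.1.
  apply: P_ge => // [|a]; first exact: coneZ.
  by rewrite /= ler_pdivrMl//; exact: ksf.
rewrite le_eqVlt => /predU1P[<-|r0] cg.
  rewrite mul0r; apply/eqP; rewrite eq_le; apply/andP; split; last first.
    rewrite -[leLHS]F0; apply: P_ge; [exact: coneZ|exact: cone0|] => a.
    by rewrite /= mul0r.
  apply: P_le => [|k [ck k0] kg]; first exact: coneZ.
  rewrite (_ : k = fun=> 0) ?F0//; apply/funext => a.
  by apply/eqP; rewrite eq_le k0 andbT; have := kg a; rewrite /= mul0r.
apply/eqP; rewrite eq_le le_PZ//= -ler_pdivlMl//.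
rewrite (le_trans _ (le_PZ _ _ _ _)) ?invr_gt0//; last by apply: coneZ; rewrite // ltW.
rewrite (_ : r^-1 \*o (r \*o g) = g)//.
by apply/funext => a /=; rewrite mulrA mulVf ?mul1r// gt_eqF.
Qed.

Let P0 g : cone g -> 0 <= P g.
Proof.
by move=> cg; rewrite -F0; apply: P_ge => //; [exact: cone0|exact: cg.2].
Qed.

Let PC g s : cone g -> (forall a, g a <= s) -> P g <= C * s.
Proof.
move=> cg gs; apply: P_le => // k ck kg.
rewrite (le_trans (ler_norm _))// FC//; first exact: ck.1.
by move=> a; rewrite ger0_norm ?(le_trans (kg a))//; exact: ck.2.
Qed.

Theorem riesz_signed : exists m1 m2 : {finite_measure set (Borel A) -> \bar R},
  forall g, c0_fun h g -> F g = \int[m1]_x g x - \int[m2]_x g x.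
Proof.
have [m1 m1P] := riesz_positive A_hausdorff A_locally_compact A_second_countable
  PD PZ P0 PC.
(* The negative part of F. It is nonnegative because g itself competes in the supremum P g, and it
   is bounded with constant C + C. *)
pose N g := P g - F g.
have ND f g : cone f -> cone g -> N (f \+ g) = N f + N g.
  by move=> cf cg; rewrite /N PD// (FD cf.1 cg.1) opprD addrACA.
have NZ r g : 0 <= r -> cone g -> N (r \*o g) = r * N g.
  by move=> r0 cg; rewrite /N PZ// (FZ _ cg.1) mulrBr.
have N0 g : cone g -> 0 <= N g by move=> cg; rewrite subr_ge0 P_ge.
have NC g s : cone g -> (forall a, g a <= s) -> N g <= (C + C) * s.
  move=> cg gs; rewrite mulrDl lerD ?PC// (le_trans (ler_norm _))// normrN FC//.
    exact: cg.1.
  by move=> a; rewrite ger0_norm//; exact: cg.2.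
have [m2 m2P] := riesz_positive A_hausdorff A_locally_compact A_second_countable
  ND NZ N0 NC.
exists m1, m2 => g cg.
pose gp := g \max (fun=> 0); pose gn := (-1 \*o g) \max (fun=> 0).
have cgp : cone gp.
  by split=> [|a]; [apply: c0_max => //; exact: c0_0|rewrite /gp /= le_max lexx orbT].
have cgn : cone gn.
  split=> [|a]; last by rewrite /gn /= le_max lexx orbT.
  by apply: c0_max; [exact: c0_Z|exact: c0_0].
have gE : g = fun a => gp a - gn a.
  by apply/funext => a; rewrite /gp /gn /= mulN1r !maxElt; do ?case: ifPn; rewrite -?leNgt; lra.
have FE : F g = F gp - F gn.
  rewrite [LHS](_ : _ = F (gp \+ (-1 \*o gn))).
    by rewrite (FD cgp.1 (c0_Z _ cgn.1)) (FZ _ cgn.1) mulN1r.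
  by rewrite [in LHS]gE; congr F; apply/funext => a /=; rewrite mulN1r.
have intE (m : {finite_measure set (Borel A) -> \bar R}) :
    \int[m]_x g x = \int[m]_x gp x - \int[m]_x gn x.
  rewrite -RintegralB//; [|exact: c0_integrable cgp.1|exact: c0_integrable cgn.1].
  by rewrite -gE.
by rewrite FE !intE !m1P// !m2P// /N; lra.
Qed.

End riesz_signed.

(** * The transform T *)

Section weighted_transform.
Context (R : realType) (A : ptopologicalType).
Variables (h : exhaustion R A) (phi : admissible R).
Hypothesis phi_unbounded : phi t @[t --> +oo] --> +oo.
Local Notation W := (weight h phi).
Local Notation Q := (ctsmod R A).
Local Notation X := (wclass h phi).

Lemma weight_infty (M : R) : exists N, forall a, N < h a -> M < W a.
Proof.
have /cvgryPgt/(_ M)[N [_ NM]] := phi_unbounded.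
by exists N => a /NM.
Qed.

(** Since W tends to infinity, a bound on W |f - c| near infinity forces f to converge to c; hence c
    is unique. *)
Lemma exh_lim_weight (f : A -> R) (c B M : R) :
  (forall a, M < h a -> W a * `|f a - c| <= B) -> exh_lim h f = c.
Proof.
move=> fB; have FF := exh_infty_proper h.
apply/cvg_lim => //; apply/cvgrPdist_le => e e0.
have [N NB] := weight_infty (B / e).
exists (Num.max M N) => // a /=; rewrite gt_max => /andP[/fB Wf /NB].
rewrite ltr_pdivrMr// distrC => BW.
rewrite -(ler_pM2l (weight_gt0 h phi a)) (le_trans Wf)// ltW//.
Qed.

(** Any c that gives a finite supremum equals the limit of f, so the infimum over constants is
    attained there and is the sup-norm of the transform. *)
Lemma fsharp_norm_transform (f : continuousType A R) (s : R) :
  (fsharp_norm h phi f <= s%:E)%E <-> (forall a, `|weighted_transform h phi f a| <= s).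
Proof.
have normT a : `|weighted_transform h phi f a| = W a * `|f a - exh_lim h f|.
  by rewrite normrM gtr0_norm// weight_gt0.
rewrite sharp_normP; split=> [fs a|fs e e0]; last first.
  by exists (exh_lim h f) => a; rewrite -normT (le_trans (fs a))// lerDl ltW.
apply/ler_addgt0Pr => e /fs[c fc]; rewrite normT.
by rewrite (@exh_lim_weight f c (s + e) 0)// => b _; exact: fc.
Qed.

Lemma fsharp_limsup_transform (f : continuousType A R) :
  fsharp_limsup h phi f = 0%E -> forall e, 0 < e ->
  exists M, forall a, M < h a -> `|weighted_transform h phi f a| <= e.
Proof.
move=> /sharp_limsupP f0 e /f0[c [M fc]]; exists M => a Ma.
rewrite normrM gtr0_norm ?weight_gt0// (@exh_lim_weight f c e M)//.
exact: fc.
Qed.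

Lemma wclass_fsharp (x : X) (f : continuousType A R) : \pi_Q f = wclass_val x ->
  [/\ (`|x|)%:E = fsharp_norm h phi f & fsharp_limsup h phi f = 0%E].
Proof.
move=> fx; have /asboolP[_ xl] := valP x.
by split; [rewrite wclass_normE -fx sharp_norm_pi|rewrite -sharp_limsup_pi fx].
Qed.

(** Computed on the canonical representative; [weighted_transform_pi] shows that every
    representative gives the same function, as an added constant shifts the limit equally. *)
Definition wtransform (x : X) : A -> R :=
  weighted_transform h phi (repr (wclass_val x)).

Let repr_wclass (x : X) : \pi_Q (repr (wclass_val x)) = wclass_val x.
Proof. exact: reprK. Qed.

Let wtransform_bound (x : X) (f : continuousType A R) a :
  \pi_Q f = wclass_val x -> W a * `|f a - exh_lim h f| <= `|x|.
Proof.
move=> fx; have -> : W a * `|f a - exh_lim h f| = `|weighted_transform h phi f a|.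
  by rewrite normrM gtr0_norm// weight_gt0.
by move: a; apply/fsharp_norm_transform; have [<- _] := wclass_fsharp fx.
Qed.

Lemma weighted_transform_pi (x : X) (f : continuousType A R) :
  \pi_Q f = wclass_val x -> weighted_transform h phi f = wtransform x.
Proof.
move=> fx; have [c fc] := (ctsmodP _ _).1 (etrans fx (esym (repr_wclass x))).
apply/funext => a; rewrite /wtransform /weighted_transform; congr (_ * _).
set r := repr _ in fc *.
rewrite (@exh_lim_weight f (exh_lim h r + c) `|x| 0).
  by rewrite fc opprD addrACA subrr addr0.
move=> b _; rewrite fc opprD addrACA subrr addr0.
exact: (wtransform_bound _ (repr_wclass _)).
Qed.

Lemma wtransform_le x a : `|wtransform x a| <= `|x|.
Proof.
by move: a; apply/fsharp_norm_transform; have [<- _] := wclass_fsharp (repr_wclass x).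
Qed.

Lemma wclass_norm_le x s : (forall a, `|wtransform x a| <= s) -> `|x| <= s.
Proof.
move=> /fsharp_norm_transform; have [<- _] := wclass_fsharp (repr_wclass x).
by rewrite lee_fin.
Qed.

Lemma wtransform_linear r x y :
  wtransform (r *: x + y) = (r \*o wtransform x) \+ wtransform y.
Proof.
pose fx := repr (wclass_val x); pose fy := repr (wclass_val y).
pose f := r *: fx + fy.
have fxy : \pi_Q f = wclass_val (r *: x + y).
  by rewrite -pi_addm -pi_scaleE /fx /fy !repr_wclass.
rewrite -(weighted_transform_pi fxy).
have fE a (c d : R) : f a - (r * c + d) = r * (fx a - c) + (fy a - d).
  by rewrite /f cts_addE cts_scaleE mulrBr opprD addrACA.
have limE : exh_lim h f = r * exh_lim h fx + exh_lim h fy.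
  apply: (@exh_lim_weight f _ (`|r| * `|x| + `|y|) 0) => a _; rewrite fE.
  rewrite (le_trans (ler_wpM2l (ltW (weight_gt0 h phi a)) (ler_normD _ _)))//.
  rewrite mulrDr normrM mulrCA lerD//; last exact: (wtransform_bound _ (repr_wclass _)).
  by rewrite ler_wpM2l//; exact: (wtransform_bound _ (repr_wclass _)).
by apply/funext => a; rewrite /weighted_transform limE fE mulrDr mulrCA.
Qed.

Lemma wtransform_inj : injective wtransform.
Proof.
move=> x y xy; apply/eqP; rewrite -subr_eq0 -normr_le0; apply: wclass_norm_le => a.
rewrite addrC -scaleN1r wtransform_linear /= xy.
by rewrite mulN1r addNr normr0.
Qed.

Lemma wtransform_c0 x : c0_fun h (wtransform x).
Proof.
split; last first.
  by apply: fsharp_limsup_transform; have [] := wclass_fsharp (repr_wclass x).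
move=> a; apply: cvgM; first exact: weight_continuous.
by apply: cvgB; [exact: cts_fun|exact: cvg_cst].
Qed.

(** The preimage is the class of g / W: as g is bounded, g / W has limit 0, and multiplying by W
    returns g. *)
Lemma wtransform_surj g : c0_fun h g -> exists x, wtransform x = g.
Proof.
move=> cg; have [M M0 gM] := c0_bounded cg.
have W0 a := weight_gt0 h phi a.
have cf : continuous (fun a => g a / W a).
  move=> a; apply: cvgM; first exact: (c0_cont cg).
  by apply: cvgV; [rewrite gt_eqF|exact: weight_continuous].
pose f : continuousType A R := mkcts cf.
have Wf a : W a * (f a - 0) = g a.
  by rewrite subr0 /= mulrC divfK// gt_eqF.
have Wnf a : W a * `|f a - 0| = `|g a|.
  by rewrite -[in RHS](Wf a) normrM (gtr0_norm (W0 a)).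
have flim : exh_lim h f = 0.
  by apply: (@exh_lim_weight f 0 M 0) => a _; rewrite Wnf.
have fx : \pi_Q f \in @wclass_pred _ _ h phi.
  apply/asboolP; rewrite sharp_norm_pi sharp_limsup_pi; split.
    rewrite (@le_lt_trans _ _ M%:E) ?ltry//; apply/fsharp_norm_transform => a.
    by rewrite /weighted_transform flim Wf.
  apply/sharp_limsupP => e e0; have [N gN] := cg.2 e e0.
  by exists 0, N => a /gN; rewrite Wnf.
exists (WClass fx); rewrite -(@weighted_transform_pi _ f)//.
by apply/funext => a; rewrite /weighted_transform flim Wf.
Qed.

End weighted_transform.

(** * The dual of X *)

(** Bundles a map whose linearity is established in the course of a proof. *)
Lemma linear_pack (R : nzRingType) (U V : lmodType R) (f : U -> V) :
  linear f -> exists g : {linear U -> V}, g =1 f.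
Proof.
move=> lf.
by exists (HB.pack_for {linear U -> V} f (GRing.isLinear.Build R U V _ f lf)).
Qed.

Section dual.
Context (R : realType) (E : normedModType R).
Implicit Types (f g : dual E) (x y : E).

Lemma dual_le f x : `|f x| <= `|f| * `|x|.
Proof.
have [->|x0] := eqVneq x 0; first by rewrite linear0 !normr0 mulr0.
have nx0 : 0 < `|x| by rewrite normr_gt0.
have := @opnorm_ge _ _ f (`|x|^-1 *: x).
rewrite normrZ normfV normr_id mulVf ?gt_eqF// => /(_ (lexx _)).
rewrite linearZ/= normrM normfV normr_id ler_pdivrMl// mulrC.
by rewrite dual_normE.
Qed.

Lemma dual_norm_le f r : (forall x, `|f x| <= r * `|x|) -> 0 <= r -> `|f| <= r.
Proof.
move=> fr r0; rewrite dual_normE; apply: opnorm_le => x x1.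
by rewrite (le_trans (fr x))// ler_piMr.
Qed.

Lemma dual_eq f g : (forall x, f x = g x) -> f = g.
Proof. by move=> fg; apply/val_inj/funext. Qed.

Lemma bounded_dual (f : E -> R) (C : R) :
  linear (f : E -> R^o) -> (forall x, `|f x| <= C * `|x|) ->
  exists g : dual E, forall x, g x = f x.
Proof.
move=> lf fC; have [f' f'E] := linear_pack lf.
have cf : continuous (f : E -> R^o).
  have -> : f = f' by apply/funext => x; rewrite f'E.
  apply/linear_bounded_continuous/linear_boundedP; exists C.
  split=> [|r /ltW Cr x]; first exact: num_real.
  by rewrite f'E (le_trans (fC x))// ler_wpM2r.
have fd : (f : E -> R^o) \in @dual_pred R E by apply/asboolP.
by exists (Dual fd).
Qed.

(** The limit is taken pointwise; letting the second index of the Cauchy estimate go to infinity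
    gives both its boundedness and the convergence in norm. *)
Lemma dual_complete (u : nat -> dual E) :
  (forall e, 0 < e -> exists N, forall n m, (N <= n)%N -> (N <= m)%N -> `|u n - u m| <= e) ->
  exists f : dual E, forall e, 0 < e -> exists N, forall n, (N <= n)%N -> `|u n - f| <= e.
Proof.
move=> uC.
have sub_le n m x : `|u n x - u m x| <= `|u n - u m| * `|x| by exact: (dual_le (u n - u m)).
have ucvg x : cvg (u n x @[n --> \oo]).
  apply: cauchy_cvg; apply/cauchy_ballP => e e0.
  have x1 : 0 < `|x| + 1 by rewrite ltr_wpDl.
  have [N uN] := uC (e / (`|x| + 1) / 2) (divr_gt0 (divr_gt0 e0 x1) (ltr0n _ 2)).
  have SN : \forall n \near \oo, (N <= n)%N by exists N.
  exists ([set u n x | n in [set n | (N <= n)%N]], [set u n x | n in [set n | (N <= n)%N]]).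
    by split; apply: filterS SN => n Nn; exists n.
  move=> [_ _] /= [[n Nn <-] [m Nm <-]]; rewrite /ball /= /ball_.
  rewrite (le_lt_trans (sub_le _ _ _))// (le_lt_trans (ler_wpM2r _ (uN _ _ Nn Nm)))//.
  rewrite mulrAC ltr_pdivrMr// mulrAC ltr_pdivrMr// -mulrA ltr_pM2l//.
  have := normr_ge0 x; lra.
pose f x := lim (u n x @[n --> \oo]).
have uf e x : 0 < e -> exists N, forall n, (N <= n)%N -> `|f x - u n x| <= e.
  by move=> e0; have /cvgrPdist_le/(_ _ e0)[N _ Ne] := ucvg x; exists N.
have u_f N e n x : (forall n m, (N <= n)%N -> (N <= m)%N -> `|u n - u m| <= e) ->
    (N <= n)%N -> `|u n x - f x| <= e * `|x|.
  move=> uN Nn; apply/ler_addgt0Pr => d d0; have [N' fN'] := uf d x d0.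
  pose m := maxn N N'; rewrite (le_trans (ler_distD (u m x) _ _))// lerD//.
    by rewrite (le_trans (sub_le _ _ _))// ler_wpM2r// uN// leq_maxl.
  by rewrite distrC fN'// leq_maxr.
have lf : linear (f : E -> R^o).
  move=> r x y; apply/eqP; rewrite -subr_eq0 -normr_le0; apply/ler_addgt0Pr => d d0.
  (* Three approximation errors enter the defect of linearity, with weights 1, |r| and 1. *)
  have r1 : 0 < `|r| + 2 by rewrite ltr_wpDl.
  have d' : 0 < d / (`|r| + 2) by rewrite divr_gt0.
  have [N1 f1] := uf _ (r *: x + y) d'; have [N2 f2] := uf _ x d'; have [N3 f3] := uf _ y d'.
  pose n := maxn N1 (maxn N2 N3).
  have {}f1 := f1 n (leq_maxl _ _).
  have {}f2 := f2 n (leq_trans (leq_maxl _ _) (leq_maxr _ _)).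
  have {}f3 := f3 n (leq_trans (leq_maxr _ _) (leq_maxr _ _)).
  have uE : u n (r *: x + y) = r * u n x + u n y by rewrite linearP.
  have -> : f (r *: x + y) - (r *: f x + f y) =
      (f (r *: x + y) - u n (r *: x + y)) - r * (f x - u n x) - (f y - u n y).
    by rewrite uE -[r *: f x]/(r * f x); lra.
  have zE : d / (`|r| + 2) * (`|r| + 2) = d by rewrite divfK// gt_eqF.
  move: (d / (`|r| + 2)) zE f1 f2 f3 {d'} => z zE f1 f2 f3.
  rewrite add0r (_ : d = z + `|r| * z + z); last by rewrite -zE; lra.
  rewrite (le_trans (ler_normB _ _))// lerD// (le_trans (ler_normB _ _))// lerD//.
  by rewrite normrM ler_wpM2l.
have [N uN] := uC 1 ltr01.
have [|f' f'E] := bounded_dual (C := `|u N| + 1) lf.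
  move=> x; rewrite mulrDl -[f x](subKr (u N x)) (le_trans (ler_normB _ _))//.
  by rewrite lerD ?dual_le// (u_f N 1).
exists f' => e e0; have [N' uN'] := uC e e0; exists N' => n N'n.
apply: dual_norm_le => [x|]; last exact: ltW.
by rewrite [X in `|X|](_ : _ = u n x - f x) ?(u_f N')// -f'E.
Qed.

End dual.

(** * The isometry of M(A) onto the dual of X *)

Section duality.
Context (R : realType) (A : ptopologicalType).
Variables (h : exhaustion R A) (phi : admissible R).
Hypotheses (A_hausdorff : hausdorff_space A)
  (A_locally_compact : locally_compact [set: A])
  (A_second_countable : @second_countable A)
  (phi_unbounded : phi t @[t --> +oo] --> +oo).
Local Notation W := (weight h phi).
Local Notation X := (wclass h phi).
Local Notation M := (signed_measure R A).
Local Notation T := (@wtransform R A h phi).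
Lemma c0_integrable_total_variation (sigma : M) (g : Borel A -> R) : c0_fun h g ->
  (total_variation sigma).-integrable setT (EFin \o g).
Proof.
move=> cg; have [B B0 gB] := c0_bounded cg.
apply: (@bounded_integrable_total_variation _ _ _ _ _ B) => //.
by apply: continuous_Borel_measurable; exact: (c0_cont cg).
Qed.

Let T_integrable (sigma : M) x :
  (total_variation sigma).-integrable setT (EFin \o (T x : Borel A -> R)).
Proof. by apply: c0_integrable_total_variation; exact: wtransform_c0. Qed.

Let pairing_linear (sigma : M) :
  linear ((fun x => charge_integral sigma setT (T x)) : X -> R^o).
Proof.
move=> r x y; rewrite wtransform_linear//.
have [xp xn] := (integrable_total_variation sigma _ measurableT).1 (T_integrable sigma x).
have [yp yn] := (integrable_total_variation sigma _ measurableT).1 (T_integrable sigma y).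
have rint (m : {measure set (Borel A) -> \bar R}) :
    m.-integrable setT (EFin \o (T x : Borel A -> R)) ->
    m.-integrable setT (EFin \o ((r \*o T x) : Borel A -> R)).
  by move=> i; exact: (integrableZl measurableT r i).
rewrite /charge_integral !RintegralD//; [|exact: rint..].
rewrite !RintegralZl//; rewrite -[r *: _]/(r * _); lra.
Qed.

Lemma measure_pairing (sigma : M) : exists g : dual X,
  forall x, g x = charge_integral sigma setT (T x).
Proof.
apply: (bounded_dual (C := fine (total_variation sigma setT))) => // x.
rewrite mulrC; apply: charge_integral_le => [|a].
  by apply: continuous_Borel_measurable; exact: c0_cont (wtransform_c0 _ _).
exact: wtransform_le.
Qed.

Definition dual_of_measure (sigma : M) : dual X := sval (cid (measure_pairing sigma)).

Lemma dual_of_measureE sigma x :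
  dual_of_measure sigma x = charge_integral sigma setT (T x).
Proof. exact: (svalP (cid (measure_pairing sigma))). Qed.

Lemma sm_addE (mu nu : M) (B : set (Borel A)) : (mu + nu) B = (mu B + nu B)%E.
Proof. by []. Qed.

Lemma sm_scaleE (r : R) (nu : M) (B : set (Borel A)) : (r *: nu) B = (r%:E * nu B)%E.
Proof. by []. Qed.

Lemma charge_integral_linear (r : R) (mu nu : M) D (f : Borel A -> R) : measurable D ->
  (total_variation mu).-integrable D (EFin \o f) ->
  (total_variation nu).-integrable D (EFin \o f) ->
  charge_integral (r *: mu + nu) D f = r * charge_integral mu D f + charge_integral nu D f.
Proof.
move=> mD fmu fnu; have [|fr <-] := @charge_integralZ _ _ _ (r *: mu) mu r D f mD _ fmu.
  by [].
by apply: charge_integralD.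
Qed.

Lemma dual_of_measure_linear : linear dual_of_measure.
Proof.
move=> r mu nu; apply: dual_eq => x.
by rewrite dual_addE dual_scaleE !dual_of_measureE charge_integral_linear.
Qed.

(** As m is concentrated on P, inner regularity of P controls the mass outside K in the whole
    space. *)
Lemma compact_approx (m : {finite_measure set (Borel A) -> \bar R}) (P : set (Borel A)) e :
  measurable P -> 0 < e -> m (~` P) = 0%E -> exists K : set (Borel A),
  [/\ @compact A K, K `<=` P, measurable K & (m (~` K) <= e%:E)%E].
Proof.
move=> mP e0 mP0.
have [_ supP] := finite_measure_regular h A_hausdorff A_locally_compact A_second_countable m mP.
have : (m P - e%:E < m P)%E by rewrite lteBlDr// lteDl// fin_num_measure.
rewrite [X in (_ < X)%E]supP => /ereal_sup_gt[_ [K [cK KP] <-] mPK].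
have mK : @measurable _ (Borel A) K by apply: closed_Borel; exact: compact_closed.
exists K; split => //.
have mE (S : set (Borel A)) : measurable S -> m setT = (m S + m (~` S))%E.
  by move=> mS; rewrite -measureU ?setUv ?setICr//; exact: measurableC.
have fin S : measurable S -> m S \is a fin_num by move=> mS; exact: fin_num_measure.
have mCK : @measurable _ (Borel A) (~` K) by exact: measurableC.
have := mE _ mK; rewrite (mE _ mP) mP0 adde0 => mPE.
move: mPK; rewrite mPE -(fineK (fin _ mK)) -(fineK (fin _ mCK)) -!EFinD.
by rewrite lte_fin lee_fin /=; lra.
Qed.

(** g dominates 1 - 2 on the complement of K, where only g >= -1 is known, and 1 on K. *)
Lemma Rintegral_concentrated (m : {finite_measure set (Borel A) -> \bar R})
    (K : set (Borel A)) (g : Borel A -> R) e :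
  measurable K -> (m (~` K) <= e%:E)%E -> continuous (g : A -> R) ->
  (forall a, `|g a| <= 1) -> (forall a, K a -> g a = 1) ->
  fine (m setT) - 2 * e <= \int[m]_x g x.
Proof.
move=> mK mKe cg g1 gK; have mCK : measurable (~` K) by exact: measurableC.
have ig : m.-integrable setT (EFin \o g).
  by apply: bounded_integrable g1; exact: continuous_Borel_measurable.
have i1 : m.-integrable setT (EFin \o (\1_(~` K) : Borel A -> R)).
  by apply: integrable_indic; rewrite // ?ltey_eq ?fin_num_measure.
have i2 : m.-integrable setT (EFin \o (fun a : Borel A => 2 * (\1_(~` K) a : R))).
  exact: (integrableZl measurableT 2 i1).
have ic : m.-integrable setT (EFin \o (cst 1 : Borel A -> R)).
  by apply: (@bounded_integrable _ _ _ _ _ 1) => // a; rewrite normr1.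
apply: (@le_trans _ _ (\int[m]_x (1 - 2 * \1_(~` K) x))).
  rewrite RintegralB// Rintegral_cst// mul1r lerD2l lerN2 RintegralZl//.
  rewrite ler_pM2l// /Rintegral integral_indic// setIT -lee_fin fineK//.
  exact: fin_num_measure.
apply: le_Rintegral => // [|a _].
  by apply: (integrableB measurableT ic i2).
rewrite indicE; have [Ka|nKa] := pselect (K a).
  have /negPf -> : a \notin ~` K by rewrite notin_setE => nKa; exact: nKa Ka.
  by rewrite gK// mulr0 subr0.
rewrite mem_set// mulr1; have := g1 a; rewrite ler_norml; lra.
Qed.

(** For the lower bound the functional is tested on a continuous substitute for the sign of [sigma]:
    equal to 1 and -1 on disjoint compact sets that carry almost all of the positive and negative
    parts. *)
Lemma dual_of_measure_norm sigma : `|dual_of_measure sigma| = `|sigma|.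
Proof.
have sE : `|sigma| = fine (total_variation sigma setT) by [].
apply/eqP; rewrite eq_le; apply/andP; split.
  apply: dual_norm_le => // x; rewrite dual_of_measureE mulrC sE.
  apply: charge_integral_le => [|a]; last exact: wtransform_le.
  by apply: continuous_Borel_measurable; exact: (c0_cont (wtransform_c0 _ _)).
(* Each of the two Jordan parts loses at most 2 e, hence the 4. *)
apply/ler_addgt0Pr => e' e'0; pose e := e' / 4.
have e0 : 0 < e by rewrite divr_gt0.
have [[mP _] [mN _] PN PN0] := hahnP sigma.
set P := hahn_pos sigma in mP PN PN0; set N := hahn_neg sigma in mN PN PN0.
set jp := jordan_pos (hahnP sigma); set jn := jordan_neg (hahnP sigma).
have CPN : ~` P = N.
  apply/seteqP; split=> a; last first.
    by move=> Na Pa; have : (P `&` N) a by []; rewrite PN0.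
  have : (P `|` N) a by rewrite PN.
  by case.
have CNP : ~` N = P by rewrite -CPN setCK.
have jp0 : jp (~` P) = 0%E.
  rewrite /jp CPN jordan_posE cjordan_posE /= /crestr0 mem_set//= /crestr.
  by rewrite -/P setIC PN0 charge0.
have jn0 : jn (~` N) = 0%E.
  rewrite /jn CNP jordan_negE cjordan_negE /= /crestr0 mem_set//= /crestr.
  by rewrite -/N PN0 charge0 oppe0.
have [K1 [cK1 K1P mK1 jK1]] := compact_approx mP e0 jp0.
have [K2 [cK2 K2N mK2 jK2]] := compact_approx mN e0 jn0.
have K12 : K1 `<=` ~` K2.
  by move=> a /K1P Pa /K2N Na; have : (P `&` N) a by []; rewrite PN0.
have oC (K : set A) : compact K -> open (~` K).
  by move=> cK; apply: closed_openC; exact: compact_closed.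
have [g1 [cg1 g101 g1K1 g1K2]] := c0_urysohn h A_hausdorff A_locally_compact
  A_second_countable cK1 (oC _ cK2) K12.
have [g2 [cg2 g201 g2K2 g2K1]] := c0_urysohn h A_hausdorff A_locally_compact
  A_second_countable cK2 (oC _ cK1) (subsetCr K12).
pose g a := g1 a - g2 a.
have cg : c0_fun h g by exact: c0_sub.
have gle a : `|g a| <= 1.
  by rewrite ler_norml /g; have := g101 a; have := g201 a; lra.
have gK1 a : K1 a -> g a = 1 by move=> Ka; rewrite /g g1K1// g2K1 ?subr0.
have gK2 a : K2 a -> -1 * g a = 1.
  by move=> Ka; rewrite /g g2K2// g1K2 ?sub0r ?mulN1r ?opprK// => /(_ Ka).
have [x xg] := wtransform_surj phi_unbounded cg.
have x1 : `|x| <= 1 by apply: (wclass_norm_le phi_unbounded); rewrite xg.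
have := le_trans (ler_norm _) (opnorm_ge (dual_of_measure sigma) x1).
rewrite -dual_normE dual_of_measureE xg /charge_integral.
have := Rintegral_concentrated mK1 jK1 (c0_cont cg) gle gK1.
have gle' a : `|-1 * g a| <= 1 by rewrite mulN1r normrN.
have := Rintegral_concentrated mK2 jK2 (c0_cont (c0_Z (-1) cg)) gle' gK2.
have ig : jn.-integrable setT (EFin \o (g : Borel A -> R)).
  by have /(integrable_total_variation sigma _ measurableT)[] :=
    c0_integrable_total_variation sigma cg.
rewrite RintegralZl// sE total_variationE fineD ?fin_num_measure//.
rewrite -/jp -/jn /e; lra.
Qed.

Lemma dual_of_measure_surj (f : dual X) : exists sigma, dual_of_measure sigma = f.
Proof.
have Tsurj g : c0_fun h g -> {x : X | T x = g}.
  by move=> cg; apply: cid; exact: wtransform_surj.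
(* The Riesz theorem takes functionals defined on all functions, so f is transported through the
   inverse of T and given the default value 0 off C_0(A). *)
pose F g : R := if pselect (c0_fun h g) is left cg then f (sval (Tsurj g cg)) else 0.
have FT x : F (T x) = f x.
  rewrite /F; case: pselect => [cg|ncg]; last by case: ncg; exact: wtransform_c0.
  by congr (f _); apply: (wtransform_inj phi_unbounded); exact: (svalP (Tsurj _ cg)).
have FE g : c0_fun h g -> exists2 x, T x = g & F g = f x.
  by move=> cg; have [x <-] := Tsurj _ cg; exists x.
have FD g k : c0_fun h g -> c0_fun h k -> F (g \+ k) = F g + F k.
  move=> /FE[x <- ->] /FE[y <- ->].
  have := wtransform_linear phi_unbounded 1 x y.
  have -> : 1 \*o T x = T x by apply/funext => a /=; rewrite mul1r.
  by move=> <-; rewrite FT scale1r linearD.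
have FZ r g : c0_fun h g -> F (r \*o g) = r * F g.
  move=> /FE[x <- ->]; have := wtransform_linear phi_unbounded r x 0.
  have -> : T 0 = fun=> 0.
    apply/funext => a; apply/eqP; rewrite -normr_le0.
    by have := wtransform_le phi_unbounded (0 : X) a; rewrite normr0.
  have -> : (r \*o T x) \+ (fun=> 0) = r \*o T x by apply/funext => a /=; rewrite addr0.
  by move=> <-; rewrite FT addr0 linearZ.
have FC g s : c0_fun h g -> (forall a, `|g a| <= s) -> `|F g| <= `|f| * s.
  move=> /FE[x <- ->] /(wclass_norm_le phi_unbounded) xs.
  by rewrite (le_trans (dual_le _ _))// ler_wpM2l.
have [m1 [m2 mF]] := riesz_signed A_hausdorff A_locally_compact A_second_countable FD FZ FC.
have [sigma sE] := charge_signed_measure h A_hausdorff A_locally_compact A_second_countable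
  (cadd (charge_of_finite_measure m1) (cscale (-1) (charge_of_finite_measure m2))).
exists sigma; apply: dual_eq => x; rewrite dual_of_measureE -FT mF; last exact: wtransform_c0.
have ic0 (m : {finite_measure set (Borel A) -> \bar R}) :
    m.-integrable setT (EFin \o (T x : Borel A -> R)).
  exact: (c0_integrable m (wtransform_c0 phi_unbounded x)).
apply: (charge_integral_diff measurableT _ (ic0 m1) (ic0 m2)).2 => B mB.
by rewrite sE// /= /cadd/= cscaleN1.
Qed.

End duality.

(** * Multiplication by the inverse weight *)

Lemma isometry_inj (R : numDomainType) (E F : normedModType R) (f : {linear E -> F}) :
  (forall x, `|f x| = `|x|) -> injective f.
Proof.
move=> fi x y fxy; apply/eqP; rewrite -subr_eq0 -normr_eq0 -fi linearB fxy subrr.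
by rewrite normr0.
Qed.

Lemma surjective_isometry_inverse (R : realType) (E F : normedModType R)
    (f : {linear E -> F}) :
  (forall x, `|f x| = `|x|) -> (forall y, exists x, f x = y) ->
  bijective f /\ isometrically_isomorphic F E.
Proof.
move=> fi /choice[g fg]; have finj := isometry_inj fi.
have gf : cancel f g by move=> x; apply: finj; rewrite fg.
split; first by exists g.
have [|g' g'E] := @linear_pack _ _ _ g.
  by move=> r x y; apply: finj; rewrite linearP !fg.
exists g' => [|x]; last by rewrite g'E -fi fg.
by exists f => x; rewrite g'E.
Qed.

(** Approximate y by S (nu n). The nu n form a Cauchy sequence because S is isometric; the supposed
    isometry moves it to the complete space [dual E] and its limit back, so y lies in the range of
    S, which would be everything. *)
Lemma dual_not_isometric_dense_subspace (R : realType) (E N Y : normedModType R)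
    (S : {linear N -> Y}) :
  (forall n, `|S n| = `|n|) -> dense (range S) -> range S <> setT ->
  ~ isometrically_isomorphic (dual E) N.
Proof.
move=> Siso Sdense SnT [f fbij fiso]; apply: SnT; apply/seteqP; split => // y _.
have [f' ff' f'f] := fbij.
have /choice[nu nuE] : forall n, exists nu : N, `|y - S nu| < n.+1%:R^-1.
  move=> n; have n0 : 0 < n.+1%:R^-1 :> R by rewrite invr_gt0.
  have [||z [yz [nu _ nuz]]] := Sdense (ball y n.+1%:R^-1).
  - by exists y; exact: ballxx.
  - exact: ball_open.
  by exists nu; move: yz; rewrite nuz -ball_normE.
have fin_dist n m : `|f' (nu n) - f' (nu m)| = `|S (nu n) - S (nu m)|.
  by rewrite -fiso linearB !f'f -linearB Siso.
have small e : 0 < e -> exists n0, forall n, (n0 <= n)%N -> n.+1%:R^-1 <= e :> R.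
  move=> e0; exists (Num.truncn e^-1) => n n0n.
  rewrite -[leRHS]invrK lef_pV2 ?posrE ?invr_gt0//.
  by rewrite (le_trans (ltW (truncnS_gt _)))// ler_nat ltnS.
have [|g gP] := @dual_complete _ _ (f' \o nu).
  move=> e e0; have [n0 n0P] := small _ (divr_gt0 e0 (ltr0n _ 2)).
  exists n0 => n m n0n n0m; rewrite /= fin_dist (le_trans (ler_distD y _ _))// [e]splitr.
  by rewrite lerD// ltW// ?(lt_le_trans (nuE _))// ?n0P// distrC (lt_le_trans (nuE _))// n0P.
exists (f g) => //; apply/eqP; rewrite eq_sym -subr_eq0 -normr_le0; apply/ler_addgt0Pr => e e0.
have e2 := divr_gt0 e0 (ltr0n _ 2).
have [n0 n0P] := small _ e2; have [n1 n1P] := gP _ e2.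
pose n := maxn n0 n1.
rewrite add0r (le_trans (ler_distD (S (nu n)) _ _))// [e]splitr lerD//.
  by rewrite ltW// (lt_le_trans (nuE _))// n0P// leq_maxl.
rewrite -linearB Siso -(f'f (nu n)) -linearB fiso.
by apply: n1P; exact: leq_maxr.
Qed.

Section embedding.
Context (R : realType) (A : ptopologicalType).
Variables (h : exhaustion R A) (phi : admissible R).
Hypotheses (A_hausdorff : hausdorff_space A)
  (A_locally_compact : locally_compact [set: A])
  (A_second_countable : @second_countable A)
  (phi_unbounded : phi t @[t --> +oo] --> +oo).
Local Notation W := (weight h phi).
Local Notation w := (fun a => (weight h phi a)^-1).
Local Notation X := (wclass h phi).
Local Notation M := (signed_measure R A).
Local Notation N0 := (null_measure h phi).
Local Notation T := (@wtransform R A h phi).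
Lemma signed_measure_eq (mu nu : M) :
  (forall B : set (Borel A), measurable B -> mu B = nu B) -> mu = nu.
Proof.
move=> munu; apply/signed_measureP => B.
have [/munu//|mB] := pselect (measurable B); by rewrite !sm_nonborel.
Qed.

Lemma signed_measure_density (nu : M) (g : Borel A -> R) :
  (forall a, 0 <= g a) -> (total_variation nu).-integrable setT (EFin \o g) ->
  exists sigma : M, charge_density nu g sigma.
Proof.
move=> g0 ig; have [kappa kE] := charge_density_exists g0 ig.
have [sigma sE] :=
  charge_signed_measure h A_hausdorff A_locally_compact A_second_countable kappa.
by exists sigma => B mB; rewrite sE// kE.
Qed.

Lemma weight_measurable : measurable_fun [set: Borel A] (W : Borel A -> R).
Proof. by apply: continuous_Borel_measurable; exact: weight_continuous. Qed.

Lemma weightV_measurable : measurable_fun [set: Borel A] (w : Borel A -> R).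
Proof.
apply: continuous_Borel_measurable => a; apply: cvgV.
  by rewrite gt_eqF// weight_gt0.
exact: weight_continuous.
Qed.

Let W0 a : 0 <= W a. Proof. exact/ltW/weight_gt0. Qed.
Let w0 a : 0 <= w a. Proof. by rewrite invr_ge0. Qed.
Let Ww a : W a * w a = 1. Proof. by rewrite divff// gt_eqF// weight_gt0. Qed.

Let w_integrable (nu : M) : (total_variation nu).-integrable setT (EFin \o (w : Borel A -> R)).
Proof.
apply: (@bounded_integrable_total_variation _ _ _ _ _ 1) => //.
  exact: weightV_measurable.
by move=> a; rewrite ger0_norm// invf_le1 ?weight_gt0// weight_ge1.
Qed.

(** The measure W^-1 nu; it makes sense on all of M(A) because W >= 1. *)
Definition weightV_measure (nu : M) : M :=
  sval (cid (signed_measure_density w0 (w_integrable nu))).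

Lemma weightV_measureP (nu : M) :
  @charge_density _ (Borel A) R nu w (weightV_measure nu).
Proof. exact: (svalP (cid (signed_measure_density w0 (w_integrable nu)))). Qed.

Lemma weightV_measure_linear : linear weightV_measure.
Proof.
move=> r mu nu; apply: signed_measure_eq => B mB.
rewrite sm_addE sm_scaleE !weightV_measureP// -EFinM -EFinD; congr EFin.
by apply: charge_integral_linear => //; exact: (integrableS measurableT).
Qed.

Lemma ge0_integral_weightV_measure (nu : M) (f : Borel A -> \bar R) :
  (forall a, 0 <= f a)%E -> measurable_fun setT f ->
  (\int[total_variation (weightV_measure nu)]_a f a =
   \int[total_variation nu]_a (f a * (w a)%:E))%E.
Proof.
move=> f0 mf.
exact: (@ge0_integral_charge_density _ (Borel A) R nu w w0 (w_integrable nu) _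
  (weightV_measureP nu)).
Qed.

(** The density is nonnegative, so the variation of W^-1 nu is W^-1 |nu|; evaluate it on the whole
    space. *)
Lemma weightV_measure_norm (nu : M) :
  (`|weightV_measure nu|)%:E = weighted_variation w nu.
Proof.
rewrite signed_measure_normE -[LHS]mul1e -integral_cst//.
rewrite ge0_integral_weightV_measure//.
by apply: eq_integral => a _; rewrite mul1e.
Qed.

Lemma weightV_measure_integral (nu : M) (g : Borel A -> R) : measurable_fun setT g ->
  charge_integral (weightV_measure nu) setT g = charge_integral nu setT (fun a => g a * w a).
Proof.
exact: (@charge_integral_density _ (Borel A) R nu w w0 (w_integrable nu) _
  (weightV_measureP nu)).
Qed.

Lemma charge_integral1 (nu : M) : charge_integral nu setT (cst 1) = fine (nu setT).
Proof.
rewrite /charge_integral !Rintegral_cst// !mul1r jordanE// fineB// fin_num_measure//.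
Qed.

(** W^-1 T f = f - L(f), and the constant L(f) integrates to 0 against a measure of total mass 0.
    All functions involved are bounded, as |f - L(f)| <= W |f - L(f)|. *)
Lemma dual_of_weightV_measure (nu : N0) (x : X) (f : continuousType A R) :
  \pi_(ctsmod R A) f = wclass_val x ->
  charge_integral (weightV_measure nu) setT (T x) = charge_integral nu setT f.
Proof.
move=> fx; rewrite -(weighted_transform_pi phi_unbounded fx).
have mcts (g : A -> R) : continuous g -> measurable_fun [set: Borel A] g.
  exact: continuous_Borel_measurable.
have cf : continuous f by move=> a; exact: cts_fun.
have cT : continuous (weighted_transform h phi f).
  by rewrite (weighted_transform_pi phi_unbounded fx); exact: (c0_cont (wtransform_c0 _ _)).
set L := exh_lim h f.
have fL a : `|f a - L| <= `|x|.
  have := wtransform_le phi_unbounded x a; rewrite -(weighted_transform_pi phi_unbounded fx).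
  rewrite normrM (gtr0_norm (weight_gt0 h phi a)); apply: le_trans.
  by rewrite ler_peMl// weight_ge1.
have ifL : (total_variation nu).-integrable setT
    (EFin \o ((fun a => f a - L) : Borel A -> R)).
  apply: (@bounded_integrable_total_variation _ _ _ _ _ `|x|) => //.
  by apply: mcts => a; apply: cvgB; [exact: cf|exact: cvg_cst].
have ff : (total_variation nu).-integrable setT (EFin \o (f : Borel A -> R)).
  apply: (@bounded_integrable_total_variation _ _ _ _ _ (`|x| + `|L|)); first exact: mcts.
  by move=> a; rewrite -[f a](subrK L) (le_trans (ler_normD _ _))// lerD2r.
rewrite weightV_measure_integral; last exact: mcts.
have -> : (fun a => weighted_transform h phi f a / weight h phi a) = (fun a => f a - L).
  by apply/funext => a; rewrite mulrC mulKf// gt_eqF// weight_gt0.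
have [fp fn] := (integrable_total_variation nu _ measurableT).1 ff.
have /asboolP[nu0 _] := valP nu.
(* Total mass 0 means that both Jordan parts have equal mass, so the two contributions of L
   cancel. *)
have := charge_integral1 nu; rewrite nu0 /charge_integral !Rintegral_cst// !mul1r.
rewrite !RintegralB//; [|exact: finite_measure_integrable_cst..].
rewrite !Rintegral_cst// => /eqP; rewrite subr_eq0 => /eqP ->.
by rewrite opprB addrA subrK.
Qed.

Lemma weight_integrable (sigma : M) : (weighted_variation W sigma < +oo)%E ->
  (total_variation sigma).-integrable setT (EFin \o (W : Borel A -> R)).
Proof.
move=> Wy; apply/integrableP; split; first by apply/measurable_EFinP; exact: weight_measurable.
apply: le_lt_trans Wy; rewrite le_eqVlt; apply/orP; left; apply/eqP.
by apply: eq_integral => a _; rewrite gee0_abs// lee_fin; exact: W0.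
Qed.

(** The inverse operation is multiplication by W: the first condition makes W sigma a finite charge,
    whose total mass is the integral in the second, and whose weighted norm is the total variation
    of sigma. *)
Lemma weightV_measure_range (sigma : M) :
  (exists nu : N0, weightV_measure nu = sigma) <->
  (weighted_variation W sigma < +oo)%E /\ charge_integral sigma setT W = 0.
Proof.
split=> [[nu <-]|[Wy W0']].
  have /asboolP[nu0 nuy] := valP nu; split.
    rewrite /weighted_variation.
    rewrite ge0_integral_weightV_measure//.
    - rewrite (eq_integral (cst 1%E)); last by move=> a _; rewrite -EFinM Ww.
      by rewrite integral_cst// mul1e total_variation_fin.
    - by apply/measurable_EFinP; exact: weight_measurable.
  rewrite weightV_measure_integral; last exact: weight_measurable.
  under [X in charge_integral _ _ X]eq_fun do rewrite Ww.
  by rewrite charge_integral1 nu0.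
have iW := weight_integrable Wy.
have [nu nuP] := signed_measure_density W0 iW.
have wW a : w a * W a = 1 by rewrite mulrC.
have nuX : nu \in @null_measure_pred _ _ h phi.
  apply/asboolP; split; first by rewrite nuP// W0'.
  rewrite /weighted_variation (@ge0_integral_charge_density _ (Borel A) R sigma W W0 iW _ nuP)//.
  - rewrite (eq_integral (cst 1%E)); last by move=> a _; rewrite -EFinM wW.
    by rewrite integral_cst// mul1e total_variation_fin.
  - by apply/measurable_EFinP; exact: weightV_measurable.
exists (NullMeasure nuX); apply: signed_measure_eq => B mB.
rewrite weightV_measureP//=.
rewrite (@charge_integral_density _ (Borel A) R sigma W W0 iW _ nuP)//; last first.
  by apply: measurable_funTS; exact: weightV_measurable.
under [X in charge_integral _ _ X]eq_fun do rewrite wW.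
rewrite /charge_integral !Rintegral_cst// !mul1r EFinB !fineK ?fin_num_measure//.
by rewrite -jordanE.
Qed.

(** * Properness and density of the range *)

Lemma dirac_signed_measure (a : A) : exists delta : M,
  [/\ `|delta| <= 1, (weighted_variation W delta < +oo)%E &
      charge_integral delta setT W = W a].
Proof.
pose m : {finite_measure set (Borel A) -> \bar R} := @dirac _ (Borel A) a R.
have [delta dE] := charge_signed_measure h A_hausdorff A_locally_compact A_second_countable
  (charge_of_finite_measure m).
have dm B : measurable B -> delta B = m B by move=> mB; rewrite dE.
have tv_le B : measurable B -> (total_variation delta B <= m B)%E.
  by apply: Defs.total_variation_le => C mC; rewrite dm// gee0_abs.
have mEW : measurable_fun [set: Borel A] (EFin \o (W : Borel A -> R)).
  by apply/measurable_EFinP; exact: weight_measurable.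
have intW : (\int[m]_x (W x)%:E = (W a)%:E)%E.
  by rewrite integral_dirac// diracT mul1e.
exists delta; split.
- rewrite -lee_fin signed_measure_normE (le_trans (tv_le _ measurableT))//.
  by rewrite /m /= diracT.
- rewrite (@le_lt_trans _ _ (\int[m]_x (W x)%:E)%E) ?intW ?ltry//.
  by rewrite -intW; apply: ge0_le_measure_integral => // x; rewrite lee_fin.
- have im : m.-integrable setT (EFin \o (W : Borel A -> R)).
    apply/integrableP; split => //.
    rewrite (eq_integral (EFin \o (W : Borel A -> R))) ?intW ?ltry// => x _.
    by rewrite gee0_abs// lee_fin; exact: W0.
  pose z : {finite_measure set (Borel A) -> \bar R} := mzero.
  have iz : z.-integrable setT (EFin \o (W : Borel A -> R)).
    by apply/integrableP; split => //; rewrite integral_measure_zero.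
  rewrite (charge_integral_diff measurableT _ im iz).2.
    by rewrite /Rintegral intW integral_measure_zero/= subr0.
  by move=> B mB; rewrite dm// /z /= /mzero sube0.
Qed.

Local Notation Rg := [set sigma : M | (weighted_variation W sigma < +oo)%E /\
                 charge_integral sigma setT W = 0].

Lemma weighted_null_measures_proper : Rg <> setT.
Proof.
have [delta [_ _ dW]] := dirac_signed_measure point => RgT.
have : Rg delta by rewrite RgT.
by move=> [_]; rewrite dW => /eqP; rewrite gt_eqF// weight_gt0.
Qed.

(** Restrict [sigma] to {h <= n}: the error is the mass of |sigma| outside, small for large n, and W
    is bounded inside. *)
Lemma truncated_measure (sigma : M) (e : R) : 0 < e -> exists tau : M,
  `|sigma - tau| <= e /\ (weighted_variation W tau < +oo)%E.
Proof.
move=> e0; pose F n : set (Borel A) := h @^-1` `[0, n%:R].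
have mF n : measurable (F n).
  by apply: closed_Borel; apply: compact_closed => //; exact: exh_proper.
have UF : \bigcup_n F n = setT.
  apply/seteqP; split => // a _; exists (Num.truncn (h a)).+1 => //.
  by rewrite /F/= in_itv/= exh_ge0/= ltW// truncnS_gt.
have tfin : fin_num_fun (total_variation sigma).
  by move=> B mB; rewrite ge0_fin_numE// total_variation_fin.
pose m : {finite_measure set (Borel A) -> \bar R} :=
  HB.pack (total_variation sigma : set (Borel A) -> \bar R)
    (Measure.class (total_variation sigma)) (Measure_isFinite.Build _ _ _ _ tfin).
have [n k nk|n] := nondecreasing_measure_setD m e0 mF.
  apply/subsetPset => a /=; rewrite /F/= !in_itv/= => /andP[->/=].
  by move=> /le_trans; apply; rewrite ler_nat.
rewrite UF setTD => mFn.
have ind0 (B : set (Borel A)) a : 0 <= (\1_B a : R) by rewrite indicE.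
have indi (B : set (Borel A)) : measurable B ->
    (total_variation sigma).-integrable setT (EFin \o (\1_B : Borel A -> R)).
  move=> mB; apply: (@bounded_integrable_total_variation _ _ _ _ _ 1) => //.
  by move=> a; rewrite ger0_norm// indicE lern1 leq_b1.
have [tau tauP] := signed_measure_density (ind0 (F n)) (indi _ (mF n)).
have mCF : measurable (~` F n) by exact: measurableC.
exists tau; split.
  (* The difference is itself [sigma] with an indicator density, so its norm is exactly the
     variation outside F n. *)
  have dP : @charge_density _ (Borel A) R sigma (\1_(~` F n)) (sigma - tau).
    move=> B mB; rewrite -[(sigma - tau) B]/(sigma B - tau B)%E tauP//.
    rewrite jordanE// /charge_integral.
    have [ip jn] := (integrable_total_variation sigma _ measurableT).1 (indi _ (mF n)).
    have E (k : {finite_measure set (Borel A) -> \bar R}) :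
        k.-integrable setT (EFin \o (\1_(F n) : Borel A -> R)) ->
        \int[k]_(x in B) \1_(~` F n) x = fine (k B) - \int[k]_(x in B) \1_(F n) x.
      move=> ik; rewrite -[fine (k B)]mul1r -Rintegral_cst// -RintegralB//.
      - apply: eq_Rintegral => x _; rewrite !indicE in_setC.
        by case: (x \in F n); rewrite /= ?subrr ?subr0.
      - exact: finite_measure_integrable_cst.
      - exact: (integrableS measurableT).
    rewrite !E//.
    have fin (k : {finite_measure set (Borel A) -> \bar R}) : k B = (fine (k B))%:E.
      by rewrite fineK// fin_num_measure.
    rewrite (fin (jordan_pos (hahnP sigma))) (fin (jordan_neg (hahnP sigma))) -!EFinB.
    by congr EFin; rewrite !opprB addrACA [RHS]addrACA [- _ - _ in RHS]addrC.
  rewrite -lee_fin signed_measure_normE (le_trans _ mFn)// -[leLHS]mul1e -integral_cst//.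
  rewrite (@ge0_integral_charge_density _ (Borel A) R sigma _ (ind0 _) (indi _ mCF) _ dP)//.
  under eq_integral do rewrite mul1e.
  by rewrite integral_indic// setIT.
rewrite /weighted_variation.
rewrite (@ge0_integral_charge_density _ (Borel A) R sigma _ (ind0 _) (indi _ (mF n)) _
  tauP)//; last first.
  by apply/measurable_EFinP; exact: weight_measurable.
(* On {h <= n} monotonicity bounds W by [phi] at n; elsewhere the density is 0. *)
apply: (@le_lt_trans _ _ (\int[total_variation sigma]_x (cst (phi n%:R)%:E x))%E).
  apply: ge0_le_integral => //.
  - by move=> x _; rewrite mule_ge0// lee_fin.
  - apply: emeasurable_funM; last by apply/measurable_EFinP.
    by apply/measurable_EFinP; exact: weight_measurable.
  - move=> x _; rewrite -EFinM lee_fin indicE.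
    have [Fx|nFx] := pselect (F n x).
      rewrite mem_set// mulr1; move: Fx; rewrite /F /= in_itv /= => /andP[hx0 hx].
      exact: adm_nondecreasing.
    by rewrite memNset// mulr0 (le_trans ler01)// adm_ge1.
rewrite integral_cst// lte_mul_pinfty ?total_variation_fin// lee_fin.
by rewrite (le_trans ler01)// adm_ge1.
Qed.

(** A point mass at a has norm at most 1 but W-integral W a, which is arbitrarily large, so the
    constraint is repaired at arbitrarily small cost in norm. *)
Lemma weighted_null_measures_dense : dense Rg.
Proof.
move=> O [sigma Os] oO.
have /nbhs_normP[e /= e0 eO] : nbhs sigma O by exact: open_nbhs_nbhs.
have e3 : 0 < e / 3 by rewrite divr_gt0.
have [tau [tau_e tauW]] := truncated_measure sigma e3.
pose c := charge_integral tau setT W.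
(* Beyond N the correcting mass |c| / W a is less than e / 3. *)
have [N NW] := weight_infty h phi_unbounded (`|c| / (e / 3)).
have [a Na] := exh_unbounded h N; have {}NW := NW _ Na.
have [delta [d1 dW dWa]] := dirac_signed_measure a.
have W0' : 0 < W a by exact: weight_gt0.
exists (- (c / W a) *: delta + tau); split; last split.
- apply: eO => /=; rewrite opprD addrCA addrC scaleNr opprK.
  rewrite (le_lt_trans (ler_normD _ _))// (@le_lt_trans _ _ (e / 3 + e / 3))//; last lra.
  rewrite lerD// normrZ normrM normfV (gtr0_norm W0').
  rewrite (@le_trans _ _ (`|c| / W a * 1))//; first by rewrite ler_wpM2l// divr_ge0// ltW.
  rewrite mulr1 ler_pdivrMr// mulrC -ler_pdivrMr//; exact: ltW.
- rewrite (le_lt_trans (weighted_variationD _ _ _ _))//; first exact: weight_measurable.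
  rewrite lte_add_pinfty// weighted_variationZ//; last exact: weight_measurable.
  by rewrite lte_mul_pinfty// lee_fin.
- rewrite charge_integral_linear//; [|exact: weight_integrable..].
  by rewrite dWa mulNr divfK ?addNr// gt_eqF.
Qed.

End embedding.

Unset Implicit Arguments.
Set Strict Implicit.
Set Printing Implicit Defensive.

Theorem theorem5p3 (R : realType) (A : ptopologicalType)
    (h : exhaustion R A) (phi : admissible R)
    (A_noncompact : ~ compact [set: A])
    (A_hausdorff : hausdorff_space A)
    (A_locally_compact : locally_compact [set: A])
    (A_sigma_compact : sigma_compact A)
    (A_second_countable : @second_countable A)
    (phi_unbounded : phi t @[t --> +oo] --> +oo) :
  let W := weight h phi in
  let Rg : set (signed_measure R A) :=
    [set sigma | (weighted_variation W sigma < +oo)%E /\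
                 charge_integral sigma setT W = 0] in
  exists (Lambda : {linear null_measure h phi -> dual (wclass h phi)})
         (J : {linear signed_measure R A -> dual (wclass h phi)}),
    (* the isometric linear embedding nu |-> Lambda_nu *)
    [/\ (forall (nu : null_measure h phi) (x : wclass h phi)
                (f : continuousType A R), \pi_(ctsmod R A) f = wclass_val x ->
           Lambda nu x = charge_integral nu setT f) &
        (forall nu : null_measure h phi, `|Lambda nu| = `|nu|)] /\
    (* the identification of M(A) with the dual *)
    [/\ (forall (sigma : signed_measure R A) (x : wclass h phi)
                (f : continuousType A R), \pi_(ctsmod R A) f = wclass_val x ->
           J sigma x = charge_integral sigma setT (weighted_transform h phi f)),
        bijective J &
        (forall sigma : signed_measure R A, `|J sigma| = `|sigma|)] /\
    (* Lambda_nu corresponds to W^-1 nu *)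
    (forall nu : null_measure h phi, exists2 sigma : signed_measure R A,
       (forall B : set (Borel A), measurable B ->
          sigma B = (charge_integral nu B (fun a => (W a)^-1))%:E) &
       Lambda nu = J sigma) /\
    (* the range of nu |-> Lambda_nu, as a subset of M(A) *)
    [/\ J @^-1` range Lambda = Rg, dense Rg & Rg <> setT] /\
    ~ isometrically_isomorphic (dual (wclass h phi)) (null_measure h phi) /\
    isometrically_isomorphic (dual (wclass h phi)) (signed_measure R A).
Proof.
move=> W Rg.
have [J JE] := linear_pack (@dual_of_measure_linear R A h phi phi_unbounded).
pose S0 (nu : null_measure h phi) : signed_measure R A :=
  @weightV_measure R A h phi A_hausdorff A_locally_compact A_second_countable nu.
have S0lin : linear S0 by move=> r mu nu; exact: weightV_measure_linear.
have [S SE] := linear_pack S0lin.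
(* As a composite with the isometric bijection J, Lambda inherits its formula and norm, and its
   range seen in M(A) is that of S. *)
pose Lambda : {linear null_measure h phi -> dual (wclass h phi)} := J \o S.
have Jnorm sigma : `|J sigma| = `|sigma|.
  by rewrite JE; apply: dual_of_measure_norm.
have Jsurj f : exists sigma, J sigma = f.
  have [sigma <-] := dual_of_measure_surj A_hausdorff A_locally_compact
    A_second_countable phi_unbounded f.
  by exists sigma; rewrite JE.
have Snorm nu : `|S nu| = `|nu|.
  by apply: EFin_inj; rewrite SE weightV_measure_norm null_measure_normE.
have Srange : range S = Rg.
  apply/seteqP; split=> sigma.
    move=> [nu _ <-]; rewrite SE.
    by apply/weightV_measure_range; exists nu.
  by move=> /weightV_measure_range-/(_ A_hausdorff A_locally_compact A_second_countable)[nu nuE];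
    exists nu => //; rewrite SE.
have Jinj := isometry_inj Jnorm.
have [Jbij Jiso] := surjective_isometry_inverse Jnorm Jsurj.
have RgD : dense Rg by exact: weighted_null_measures_dense.
have RgT : Rg <> setT by exact: weighted_null_measures_proper.
exists Lambda, J; split; first split.
- by move=> nu x f fx; rewrite /Lambda /= JE dual_of_measureE SE; exact: dual_of_weightV_measure.
- by move=> nu; rewrite /Lambda /= Jnorm Snorm.
split; first split => //.
  by move=> sigma x f fx; rewrite JE dual_of_measureE (weighted_transform_pi phi_unbounded fx).
split.
  by move=> nu; exists (S nu) => // B mB; rewrite SE weightV_measureP.
split; first split => //.
  rewrite -Srange; apply/seteqP; split=> sigma.
    by move=> [nu _ /Jinj <-]; exists nu.
  by move=> [nu _ <-]; exists nu.
(* Applied to S and not to Lambda: the range of S in M(A) is the set already known to be dense and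
   proper. *)
split => //; apply: (dual_not_isometric_dense_subspace (S := S)) => //; by rewrite Srange.
Qed.
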